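(* Let $K\subset\mathbb{R}^N$ be a $C^2_+$-regular convex body that is symmetric with respect to the origin, and let $\Omega\subset\mathbb{R}^N$ be a convex bounded domain. Then $$\frac{T^K(\Omega)}{|\Omega|}\ \ge\ \frac{1}{N(N+2)}\,(R_\Omega^K)^2 .$$ Moreover this inequality is sharp (the constant $\frac{1}{N(N+2)}$ cannot be replaced by a larger one), and equality occurs only if $\Omega=x+rK$ for some $x\in\mathbb{R}^N$ and $r\ge 0$.
   Context: A convex body is a compact convex subset of $\mathbb{R}^N$ with nonempty interior. A convex body $K$ is $C^2_+$-regular if its boundary can be written locally as the graph of a $C^2$ function with positive definite Hessian. The support function of $K$ is $h_K(x)=\max\{x\cdot y : y\in K\}$; when $K$ is symmetric with respect to the origin, $h_K$ is a norm. For a domain $\Omega\subset\mathbb{R}^N$ of finite measure, the $K$-torsional rigidity is $$T^K(\Omega)=\max_{u\in W_0^{1,2}(\Omega)\setminus\{0\}}\frac{\left(\int_\Omega u\,dx\right)^2}{\int_\Omega h_K^2(\nabla u)\,dx}.$$ $|\Omega|$ is Lebesgue measure. The anisotropic inradius $R_\Omega^K$ is the largest $t$ such that $x+tK\subseteq\overline{\Omega}$ for some $x\in\Omega$. Convex domains and their closures are not distinguished: an identity such as $\Omega=x+rK$ is understood up to boundary points. *)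

(* Defs.v *)
From HB Require Import structures.
From mathcomp Require Import all_boot all_order all_algebra.
From mathcomp Require Import all_classical all_reals all_analysis.

Set Implicit Arguments.
Unset Strict Implicit.
Unset Printing Implicit Defensive.

Import Order.TTheory GRing.Theory Num.Theory.
Import numFieldNormedType.Exports.

Local Open Scope classical_set_scope.
Local Open Scope ring_scope.

(* Points of R^N are row vectors.  The normed structure of the library on
   'rV[R]_N is the sup norm: it is used only through the topology and the
   bounded sets, which are those of the Euclidean norm. *)

Section rV_measurable.
Context (R : realType) (n : nat).

Let coords : 'I_n -> 'rV[R]_n -> R := fun i x => x 0 i.

Let rV_set0 : g_sigma_preimage coords set0.
Proof. exact: sigma_algebra0. Qed.

Let rV_setC A : g_sigma_preimage coords A -> g_sigma_preimage coords (~` A).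
Proof. exact: sigma_algebraC. Qed.

Let rV_bigcup (F : _^nat) : (forall i, g_sigma_preimage coords (F i)) ->
  g_sigma_preimage coords (\bigcup_i (F i)).
Proof. exact: sigma_algebra_bigcup. Qed.

(* The sigma-algebra generated by the coordinates, as the library has it on
   n.-tuple R: these are the Borel sets of R^n. *)
HB.instance Definition _ := @isMeasurable.Build default_measure_display
  'rV[R]_n (g_sigma_preimage coords) rV_set0 rV_setC rV_bigcup.

Lemma measurable_coord (i : 'I_n) :
  measurable_fun [set: 'rV[R]_n] (fun x : 'rV[R]_n => x 0 i).
Proof.
move=> _ Y mY; rewrite setTI; apply: sub_sigma_algebra => /=.
rewrite -bigcup_seq/=; exists i => /=; first by rewrite mem_index_enum.
by exists Y => //; rewrite setTI.
Qed.

Lemma measurable_fun_rV d (T : measurableType d) (f : T -> 'rV[R]_n) :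
  (forall i, measurable_fun [set: T] (fun x => f x 0 i)) ->
  measurable_fun [set: T] f.
Proof.
move=> mf.
suff prefS : g_sigma_preimage (fun i => coords i \o f) `<=` measurable.
  move=> _ A mA; apply: prefS; rewrite g_sigma_preimage_comp.
  by exists A.
apply: smallest_sub; first exact: sigma_algebra_measurable.
move=> A; rewrite -bigcup_seq /= => -[i _ [B mB <-]].
exact: mf.
Qed.

End rV_measurable.

Section lebesgue_rV.
Context (R : realType).

Definition cons_rV n (p : R * 'rV[R]_n) : 'rV[R]_n.+1 :=
  row_mx (p.1%:M : 'rV[R]_1) p.2.

Definition uncons_rV n (x : 'rV[R]_n.+1) : R * 'rV[R]_n :=
  (x 0 0, @rsubmx R 1 1 n x).

Lemma cons_rVl n (p : R * 'rV[R]_n) (j : 'I_1) :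
  cons_rV p 0 (@lshift 1 n j) = p.1.
Proof. by apply: etrans (row_mxEl _ _ _ _) _; rewrite (ord1 j) mxE. Qed.

Lemma cons_rVr n (p : R * 'rV[R]_n) (j : 'I_n) :
  cons_rV p 0 (@rshift 1 n j) = p.2 0 j.
Proof. exact: row_mxEr. Qed.

Lemma cons_rVK n : cancel (@cons_rV n) (@uncons_rV n).
Proof.
move=> p; rewrite [RHS]surjective_pairing /uncons_rV; congr pair.
  rewrite -[RHS](cons_rVl p 0); congr (cons_rV p 0 _); exact/val_inj.
exact: row_mxKr.
Qed.

Lemma measurable_cons_rV n : measurable_fun setT (@cons_rV n).
Proof.
apply: measurable_fun_rV => i.
have [j ->|j ->] := @split_ordP 1 n i.
- under eq_fun do rewrite cons_rVl.
  exact: measurable_fst.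
- under eq_fun do rewrite cons_rVr.
  exact: (measurableT_comp (@measurable_coord R n j) measurable_snd).
Qed.

Lemma measurable_uncons_rV n : measurable_fun setT (@uncons_rV n).
Proof.
apply/measurable_fun_pairP; split; first exact: measurable_coord.
apply: measurable_fun_rV => i.
under eq_fun do rewrite /= mxE.
exact: measurable_coord.
Qed.

Section step.
Context n (mu : {sigma_finite_measure set 'rV[R]_n -> \bar R}).

Definition lebesgue_step : set 'rV[R]_n.+1 -> \bar R :=
  pushforward (@lebesgue_measure R \x mu)%E (@cons_rV n).

Let step0 : lebesgue_step set0 = 0%E.
Proof. by rewrite /lebesgue_step /pushforward preimage_set0 measure0. Qed.

Let step_ge0 A : (0 <= lebesgue_step A)%E.
Proof. by rewrite /lebesgue_step /pushforward; apply: measure_ge0. Qed.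

Let step_sigma_additive : semi_sigma_additive lebesgue_step.
Proof.
have mc := @measurable_cons_rV n.
move=> F mF tF mUF; rewrite /lebesgue_step /pushforward preimage_bigcup.
apply: measure_semi_sigma_additive.
- by move=> k; rewrite -[X in measurable X]setTI; exact: mc.
- apply/trivIsetP => /= i j _ _ ij; rewrite -preimage_setI.
  by move/trivIsetP : tF => /(_ _ _ _ _ ij) ->//; rewrite preimage_set0.
- by rewrite -preimage_bigcup -[X in measurable X]setTI; exact: mc.
Qed.

HB.instance Definition _ := isMeasure.Build _ _ _ lebesgue_step
  step0 step_ge0 step_sigma_additive.

Let step_sigma_finite : sigma_finite setT lebesgue_step.
Proof.
have /sigma_finiteP[F [TF ndF Foo]] := sigma_finiteT (@lebesgue_measure R).
have /sigma_finiteP[G [TG ndG Goo]] := sigma_finiteT mu.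
exists (fun k => @uncons_rV n @^-1` (F k `*` G k)).
  apply/seteqP; split => // x _.
  have [i _ Fi] : (\bigcup_k F k) (uncons_rV x).1 by rewrite -TF.
  have [j _ Gj] : (\bigcup_k G k) (uncons_rV x).2 by rewrite -TG.
  exists (maxn i j) => //; split.
    by move: Fi; exact/subsetPset/ndF/leq_maxl.
  by move: Gj; exact/subsetPset/ndG/leq_maxr.
move=> k; have [mF Fk] := Foo k; have [mG Gk] := Goo k; split.
  rewrite -[X in measurable X]setTI.
  by apply: measurable_uncons_rV => //; exact: measurableX.
rewrite /lebesgue_step /pushforward -comp_preimage.
rewrite (_ : _ \o _ = id) ?preimage_id; last first.
  by apply/funext => p /=; rewrite cons_rVK.
by rewrite product_measure1E// lte_mul_pinfty// ge0_fin_numE.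
Qed.

HB.instance Definition _ := Measure_isSigmaFinite.Build _ _ _ lebesgue_step
  step_sigma_finite.

End step.

(* Iterated product of the Lebesgue measure of the line, the first coordinate
   being split off by [cons_rV]; R^0 is a point of mass 1. *)
Fixpoint lebesgue_rV n : {sigma_finite_measure set 'rV[R]_n -> \bar R} :=
  match n with
  | 0 => dirac (0 : 'rV[R]_0)
  | m.+1 => lebesgue_step (lebesgue_rV m)
  end.

End lebesgue_rV.

Section convex_bodies.
Context (R : realType).

Definition dotv n (x y : 'rV[R]_n) : R := \sum_i x 0 i * y 0 i.

Definition boundary n (A : set 'rV[R]_n) : set 'rV[R]_n :=
  closure A `\` interior A.

Definition homothet n (x : 'rV[R]_n) (t : R) (K : set 'rV[R]_n) :
  set 'rV[R]_n := [set x + t *: y | y in K].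

Definition convex_body n (K : set 'rV[R]_n) : Prop :=
  [/\ compact K, convex_set K & interior K !=set0].

Definition origin_symmetric n (K : set 'rV[R]_n) : Prop :=
  forall x, K x -> K (- x).

(* For a convex body the supremum is a maximum. *)
Definition support_fun n (K : set 'rV[R]_n) (x : 'rV[R]_n) : R :=
  sup [set dotv x y | y in K].

Definition partial n (i : 'I_n) (f : 'rV[R]_n -> R) : 'rV[R]_n -> R :=
  fun x => 'D_(delta_mx 0 i) f x.

Fixpoint Ck_on n (k : nat) (W : set 'rV[R]_n) (f : 'rV[R]_n -> R) : Prop :=
  (forall x, W x -> {for x, continuous f}) /\
  match k with
  | 0 => True
  | k'.+1 => forall i : 'I_n,
      (forall x, W x -> derivable f x (delta_mx 0 i)) /\
      Ck_on k' W (partial i f)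
  end.

Definition hessian n (f : 'rV[R]_n -> R) (x : 'rV[R]_n) : 'M[R]_n :=
  \matrix_(i, j) partial i (partial j f) x.

Definition posdefmx n (A : 'M[R]_n) : Prop :=
  forall v : 'rV[R]_n, v != 0 -> 0 < (v *m A *m v^T) 0 0.

(* Around each of its points the boundary is, in suitable orthonormal
   coordinates (the rows of [Q]), the graph of a C^2 function of the last n
   coordinates: the first coordinate is [f y] and the others are [y]. *)
Definition C2plus n (K : set 'rV[R]_n.+1) : Prop :=
  forall p, boundary K p ->
  exists (Q : 'M[R]_n.+1) (U : set 'rV[R]_n.+1) (W : set 'rV[R]_n)
         (f : 'rV[R]_n -> R),
  [/\ Q *m Q^T = 1%:M, open_nbhs p U, open W &
  [/\ Ck_on 2 W f, (forall y, W y -> posdefmx (hessian f y)) &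
      boundary K `&` U = [set cons_rV (f y, y) *m Q | y in W] ]].

Definition convex_domain n (Omega : set 'rV[R]_n) : Prop :=
  [/\ open Omega, Omega !=set0, bounded_set Omega & convex_set Omega].

Definition inradius n (K Omega : set 'rV[R]_n) : R :=
  sup [set t : R | exists2 x, Omega x & homothet x t K `<=` closure Omega].

End convex_bodies.

Section torsion.
Context (R : realType) (n : nat) (Omega : set 'rV[R]_n).
Let mu := @lebesgue_rV R n.

Definition test_fun (phi : 'rV[R]_n -> R) : Prop :=
  let supp := closure [set x | phi x != 0] in
  [/\ forall k, Ck_on k setT phi, compact supp & supp `<=` Omega].

Definition L2_on (f : 'rV[R]_n -> R) : Prop :=
  measurable_fun Omega f /\ (\int[mu]_(x in Omega) ((f x) ^+ 2)%:E < +oo)%E.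

Definition weak_gradient (u : 'rV[R]_n -> R) (g : 'rV[R]_n -> 'rV[R]_n) : Prop :=
  forall phi, test_fun phi -> forall i : 'I_n,
  \int[mu]_(x in Omega) (u x * partial i phi x) =
  - \int[mu]_(x in Omega) (g x 0 i * phi x).

Definition W12 (u : 'rV[R]_n -> R) (g : 'rV[R]_n -> 'rV[R]_n) : Prop :=
  [/\ L2_on u, (forall i, L2_on (fun x => g x 0 i)) & weak_gradient u g].

(* [W12_0 u g]: [u] is in the closure of the test functions for the norm of
   W^{1,2}(Omega), and [g] is (a representative of) its weak gradient. *)
Definition W12_0 (u : 'rV[R]_n -> R) (g : 'rV[R]_n -> 'rV[R]_n) : Prop :=
  W12 u g /\
  exists phi : nat -> 'rV[R]_n -> R, (forall k, test_fun (phi k)) /\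
    (fun k => \int[mu]_(x in Omega)
      ((u x - phi k x) ^+ 2 +
       \sum_(i < n) (g x 0 i - partial i (phi k) x) ^+ 2)%:E)%E
    @ \oo --> 0%E.

Definition ae_zero (u : 'rV[R]_n -> R) : Prop :=
  {ae mu, forall x, Omega x -> u x = 0}.

(* A supremum in \bar R, so that no existence of a maximizer is built into the
   definition; it is the maximum whenever the latter exists. *)
Definition torsion (K : set 'rV[R]_n) : \bar R :=
  ereal_sup [set q : \bar R | exists u g, [/\ W12_0 u g, ~ ae_zero u &
    q = ((\int[mu]_(x in Omega) u x) ^+ 2 /
         \int[mu]_(x in Omega) (support_fun K (g x)) ^+ 2)%:E]].

End torsion.

(* Main.v *)
(* Let x0 + rK be inscribed in Omega with r the inradius, let j be the gauge of
   Omega centred at x0 and k that of x0 + rK, so that j <= k.  Since K is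
   symmetric, the gradients p of j and q of k satisfy h_K(p), h_K(q) <= 1/r, and
   for e >= 0 small the trial function v_e = (1 - j)(1 + j - e k) satisfies
   h_K(grad v_e) <= (2j - e k + e (1 - j)) / r by the triangle inequality.  By
   homogeneity (in the form int (x - x0).grad f = - N int f) all the integrals
   involved are expressed through |Omega|, b = int k and int k^2; in particular
   int j = N |Omega| / (N + 1).  At e = 0 the quotient is r^2 |Omega| / (N (N + 2)),
   which is the inequality, and its derivative at e = 0 has the sign of
   b - int j.  If equality holds this derivative is not positive, whence
   int k <= int j, j = k, and Omega = x0 + rK up to the boundary.

   Conversely N int u = - int (x - x0).grad u <= int k h_K(grad u) and
   Cauchy-Schwarz give (N int u)^2 <= int k^2 int h_K(grad u)^2 (with r = 1),
   which shows that the bound is attained on the interior of K.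

   No differentiability of j and k is used: each one is the support function of
   a polar set and is replaced by (1/s) log sum_i exp (s <a_i, x - x0>), with a_i
   in a finite net of that set; its gradient is a convex combination of the a_i,
   so the bounds on h_K of the gradients are preserved exactly. *)
Require Import Defs.
From mathcomp Require Import all_boot all_order all_algebra.
From mathcomp Require Import all_classical all_reals all_analysis.
From mathcomp Require Import measurable_realfun ring lra.

Set Implicit Arguments.
Unset Strict Implicit.
Unset Printing Implicit Defensive.

Import Order.TTheory GRing.Theory Num.Theory.
Import numFieldNormedType.Exports.

Local Open Scope classical_set_scope.
Local Open Scope ring_scope.

(** * Borel sets and Lebesgue measure of R^n *)

(** The choice of [1 - j^2] is dictated by the model case: on [x0 + rK] the torsion function is a
    multiple of [1 - k^2]. Equality for it alone would only say that h_K of the gradient equals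
    [2j/r] almost everywhere, and smoothing keeps only upper bounds on h_K, so that information is
    lost. The perturbation [- e k (1 - j)] turns rigidity into a condition on integrals: with p and
    q the gradients of j and k, the gradient of v_e is [- (2j - e k) p - e (1 - j) q], so upper
    bounds suffice again as long as [e k <= 2j]. The integral of [k^2], about which nothing is
    known, is multiplied by [e^2]. A second obstacle is that trial functions must have compact
    support: the factor [1 - j] is cut off near the boundary, where the slope of the cut-off is far
    from 1. The energy estimate is nevertheless uniform, because only an upper bound is wanted; in
    the divergence identity the defect is a true error term, removed by dominated convergence. *)

Section rV_borel.
Context (R : realType).

Lemma le_coord_norm n (x : 'rV[R]_n) i : `|x 0 i| <= `|x|.
Proof.
by rewrite [leRHS]/Num.norm /= mx_normrE (le_bigmax _ (fun ij => `|x ij.1 ij.2|) (0, i)).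
Qed.

Lemma rV_norm_le n (x : 'rV[R]_n) (c : R) :
  0 <= c -> (forall i, `|x 0 i| <= c) -> `|x| <= c.
Proof.
move=> c0 xc; rewrite [leLHS]/Num.norm /= mx_normrE; apply/bigmax_leP; split => //.
by move=> -[a b] _ /=; rewrite ord1.
Qed.

Lemma rV_norm_lt n (x : 'rV[R]_n) (c : R) :
  0 < c -> (forall i, `|x 0 i| < c) -> `|x| < c.
Proof.
move=> c0 xc; rewrite [ltLHS]/Num.norm /= mx_normrE; apply/bigmax_ltP; split => //.
by move=> -[a b] _ /=; rewrite ord1.
Qed.

Lemma ballP_norm (V : normedModType R) (a x : V) (r : R) :
  ball a r x <-> `|a - x| < r.
Proof. by rewrite -ball_normE. Qed.

Lemma rV_ballE n (a : 'rV[R]_n) (r : R) : 0 < r ->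
  ball a r = [set x | forall i, ball (a 0 i) r (x 0 i)].
Proof.
move=> r0; apply/seteqP; split=> x /=.
  move=> /ballP_norm axr i; apply/ballP_norm; apply: le_lt_trans axr.
  by have := le_coord_norm (a - x) i; rewrite !mxE.
move=> axr; apply/ballP_norm; apply: rV_norm_lt => // i.
by have /ballP_norm := axr i; rewrite !mxE.
Qed.

Lemma measurable_rV_ball n (a : 'rV[R]_n) (r : R) : measurable (ball a r).
Proof.
have [r0|r0] := ltP 0 r; last first.
  rewrite (_ : ball a r = set0) //; apply/seteqP; split=> // x /ballP_norm.
  by move=> /(le_lt_trans (normr_ge0 _)); rewrite ltNge r0.
rewrite rV_ballE // [X in measurable X](_ : _ = \bigcap_(i in [set: 'I_n])
    [set x : 'rV[R]_n | ball (a 0 i) r (x 0 i)]); last first.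
  by apply/seteqP; split=> x /= ax i; [move=> _; exact: ax|exact: ax].
apply: fin_bigcap_measurable; first exact: finite_finset.
move=> i _; rewrite -[X in measurable X]setTI.
by apply: (@measurable_coord R n i) => //; by apply: open_measurable; exact: ball_open.
Qed.

Lemma rV_rat_dense n (x : 'rV[R]_n) (e : R) : 0 < e ->
  exists q : 'rV[rat]_n, `|x - map_mx ratr q| < e.
Proof.
move=> e0.
have /choice[q xq] : forall i, exists q : rat, `|x 0 i - ratr q| < e.
  move=> i; have [|q] := @rat_in_itvoo _ (x 0 i - e) (x 0 i + e); first by lra.
  by rewrite in_itv /= => /andP[? ?]; exists q; rewrite ltr_norml; lra.
exists (\row_i q i); apply: rV_norm_lt => // i.
by rewrite !mxE.
Qed.

(** The sigma-algebra is generated by the coordinates, so an open set is reached through countably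
    many sup-norm balls, which are boxes; [F] enumerates those with rational centre and radius
    [1 / (m + 1)] that lie in [U]. *)
Lemma rV_open_measurable n (U : set 'rV[R]_n) : open U -> measurable U.
Proof.
move=> oU.
pose b (q : 'rV[rat]_n) (m : nat) := ball (map_mx ratr q : 'rV[R]_n) m.+1%:R^-1.
pose F k : set 'rV[R]_n := match @unpickle ('rV[rat]_n * nat)%type k with
  | Some (q, m) => if `[< b q m `<=` U >] then b q m else set0
  | None => set0 end.
rewrite (_ : U = \bigcup_k F k).
  apply: bigcupT_measurable => k; rewrite /F.
  case: unpickle => [[q m]|] //; case: ifP => // _; exact: measurable_rV_ball.
apply/seteqP; split=> x; last first.
  move=> [k _]; rewrite /F; case: unpickle => [[q m]|] //.
  by case: asboolP => // + ?; apply.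
move=> Ux; have /nbhs_ballP[e /= e0 eU] : nbhs x U by apply: open_nbhs_nbhs.
have [m me] : exists m : nat, m.+1%:R^-1 < e / 2.
  exists (Num.trunc (e / 2)^-1); rewrite invf_plt ?posrE ?divr_gt0 //.
  exact: truncnS_gt.
have m0 : 0 < m.+1%:R^-1 :> R by rewrite invr_gt0.
have [q xq] := rV_rat_dense x m0.
have bU : b q m `<=` U.
  move=> y /ballP_norm qy; apply: eU; apply/ballP_norm.
  rewrite -(subrK (map_mx ratr q) x) -addrA (le_lt_trans (ler_normD _ _))//.
  by rewrite (splitr e) ltrD // (lt_trans _ me).
exists (pickle (q, m)) => //; rewrite /F pickleK.
by case: asboolP => // _; apply/ballP_norm; rewrite distrC.
Qed.

Lemma continuous_rV_measurable n (f : 'rV[R]_n -> R) :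
  continuous f -> measurable_fun setT f.
Proof.
move=> /continuousP cf.
apply: (measurability _ (RGenOpens.measurableE R)).
move=> _ [_ [a [b ->] <-]]; rewrite setTI; apply: rV_open_measurable.
exact/cf/interval_open.
Qed.

Lemma lebesgue_rVS n (A : set 'rV[R]_n.+1) : lebesgue_rV R n.+1 A =
  (@lebesgue_measure R \x lebesgue_rV R n)%E (@cons_rV R n @^-1` A).
Proof. by []. Qed.

Lemma preimage_cons_rV_ball n (a : 'rV[R]_n.+1) (r : R) : 0 < r ->
  @cons_rV R n @^-1` ball a r
  = ball (a 0 0) r `*` ball (@rsubmx R 1 1 n a) r.
Proof.
move=> r0; rewrite !rV_ballE //; apply/seteqP; split=> -[t y] /=.
  move=> h; split => [|i].
    have := h (@lshift 1 n 0); rewrite cons_rVl.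
    by rewrite (_ : lshift n 0 = 0) //; exact/val_inj.
  by have := h (@rshift 1 n i); rewrite cons_rVr mxE.
move=> [ht hy] i; have [j ->|j ->] := @split_ordP 1 n i.
  rewrite cons_rVl (ord1 j) (_ : lshift n 0 = 0) //; exact/val_inj.
by rewrite cons_rVr; have := hy j; rewrite mxE.
Qed.

Lemma lebesgue_rV_ball n (a : 'rV[R]_n) (r : R) : 0 < r ->
  lebesgue_rV R n (ball a r) = ((r *+ 2) ^+ n)%:E.
Proof.
move=> r0; elim: n a => [|n IH] a.
  by rewrite /= diracE mem_set // rV_ballE // => -[].
rewrite lebesgue_rVS preimage_cons_rV_ball // product_measure1E; last 2 first.
- by apply: open_measurable; exact: ball_open.
- exact: measurable_rV_ball.
rewrite IH [X in (X * _)%E](_ : _ = (r *+ 2)%:E) -?EFinM ?exprS //.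
exact: lebesgue_measure_ball (ltW r0).
Qed.

Lemma bounded_onI (T : Type) (V : normedModType R) (A : set T) (f : T -> V)
    (M : R) : (forall x, A x -> `|f x| <= M) -> [bounded f x | x in A].
Proof.
move=> fM; exists M; split; first exact: num_real.
by move=> C MC x Ax; rewrite /= (le_trans (fM _ Ax)) // ltW.
Qed.

Lemma bounded_rV_le n (A : set 'rV[R]_n) : bounded_set A ->
  exists2 M : R, 0 < M & forall x, A x -> `|x| <= M.
Proof.
move=> /ex_strict_bound_gt0 [M M0 AM]; exists M => // x Ax.
exact/ltW/AM.
Qed.

Lemma lebesgue_rV_bounded n (A : set 'rV[R]_n) :
  measurable A -> bounded_set A -> (lebesgue_rV R n A < +oo)%E.
Proof.
move=> mA /bounded_rV_le[M M0 AM].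
have M10 : 0 < M + 1 by lra.
apply: (@le_lt_trans _ _ (lebesgue_rV R n (ball 0 (M + 1)))).
  apply: le_measure; rewrite ?inE //; first exact: measurable_rV_ball.
  move=> x /AM xM; apply/ballP_norm; rewrite sub0r normrN; lra.
by rewrite lebesgue_rV_ball // ltry.
Qed.

Lemma lebesgue_rV_open_gt0 n (A : set 'rV[R]_n) :
  open A -> A !=set0 -> (0 < lebesgue_rV R n A)%E.
Proof.
move=> oA [x Ax].
have /nbhs_ballP[e /= e0 eA] : nbhs x A by apply: open_nbhs_nbhs.
apply: (@lt_le_trans _ _ (lebesgue_rV R n (ball x e))).
  by rewrite lebesgue_rV_ball // lte_fin exprn_gt0 // pmulrn_lgt0.
apply: le_measure; rewrite ?inE //; first exact: measurable_rV_ball.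
exact: rV_open_measurable.
Qed.

Lemma continuous_integrable n (Omega : set 'rV[R]_n) (f : 'rV[R]_n -> R) :
  open Omega -> bounded_set Omega -> continuous f ->
  (lebesgue_rV R n).-integrable Omega (EFin \o f).
Proof.
move=> oO bO cf; apply: measurable_bounded_integrable.
- exact: rV_open_measurable.
- by apply: lebesgue_rV_bounded => //; exact: rV_open_measurable.
- by apply: measurable_funTS; exact: continuous_rV_measurable.
- have [M M0 OM] := bounded_rV_le bO.
  have cB : compact (closed_ball (0 : 'rV[R]_n) M).
    apply: bounded_closed_compact; last exact: closed_ball_closed.
    apply: (@bounded_onI _ _ _ id M) => x; rewrite closed_ballE // /closed_ball_ /=.
    by rewrite sub0r normrN.
  have /compact_bounded/ex_strict_bound_gt0[C C0 fC] :
      compact (f @` closed_ball (0 : 'rV[R]_n) M).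
    apply: continuous_compact => //; exact: continuous_subspaceT.
  apply: (@bounded_onI _ _ _ f C) => x Ox; apply/ltW/fC; exists x => //.
  by rewrite closed_ballE // /closed_ball_ /= sub0r normrN OM.
Qed.

End rV_borel.


(** * Integral of a partial derivative *)

Section divergence.
Context (R : realType).

Lemma lipschitz_continuousW (V W : normedModType R) (g : V -> W) (C : R) :
  (forall x y, `|g x - g y| <= C * `|x - y|) -> continuous g.
Proof.
move=> gC x; apply/cvgrPdist_lt => e e0.
have C0 : 0 < `|C| + 1 by rewrite ltr_pwDr.
near=> y; apply: le_lt_trans (gC _ _) _.
apply: (@le_lt_trans _ _ ((`|C| + 1) * `|x - y|)).
  by rewrite ler_wpM2r // (le_trans (ler_norm _)) // lerDl.
rewrite -ltr_pdivlMl //; near: y; apply/nbhs_ballP.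
exists ((`|C| + 1)^-1 * e); first by rewrite /= mulr_gt0 ?invr_gt0.
by move=> y /ballP_norm.
Unshelve. all: by end_near. Qed.

(** A directional derivative depends only on the restriction to a line. This moves derivatives
    between a function and its slices, and later yields the chain rule. *)
Lemma is_derive_line (V W : normedModType R) (f : V -> R) (g : W -> R)
    x v y w (d : R) : (forall h, g (h *: w + y) = f (h *: v + x)) ->
  is_derive x v f d -> is_derive y w g d.
Proof.
move=> gf [df <-].
have E : (fun h : R => h^-1 *: ((g \o shift y) (h *: w) - g y)) =
         (fun h : R => h^-1 *: ((f \o shift x) (h *: v) - f x)).
  apply/funext => h /=; rewrite gf.
  by have := gf 0; rewrite !scale0r !add0r => ->.
by split; rewrite /derivable /derive E.
Qed.

Lemma cons_rV_lipschitz n (p q : R * 'rV[R]_n) :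
  `|cons_rV p - cons_rV q| <= Num.max `|p.1 - q.1| `|p.2 - q.2|.
Proof.
apply: rV_norm_le => [|i]; first by rewrite le_max normr_ge0.
have -> : (cons_rV p - cons_rV q) 0 i = cons_rV p 0 i - cons_rV q 0 i by rewrite !mxE.
rewrite le_max; have [j ->|j ->] := @split_ordP 1 n i.
  by rewrite !cons_rVl lexx.
apply/orP; right; rewrite !cons_rVr.
by have := le_coord_norm (p.2 - q.2) j; rewrite !mxE.
Qed.

Lemma continuous_cons_rV_l n (y : 'rV[R]_n) : continuous (fun t => cons_rV (t, y)).
Proof.
apply: (@lipschitz_continuousW R _ _ 1) => s t; rewrite mul1r.
by apply: le_trans (cons_rV_lipschitz _ _) _; rewrite /= subrr normr0 ge_max lexx /=.
Qed.

Lemma continuous_cons_rV_r n (t : R) : continuous (fun y : 'rV[R]_n => cons_rV (t, y)).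
Proof.
apply: (@lipschitz_continuousW 'rV_n _ _ 1) => y z; rewrite mul1r.
by apply: le_trans (cons_rV_lipschitz _ _) _; rewrite /= subrr normr0 ge_max lexx andbT.
Qed.

Lemma cons_rV_norm_l n (t : R) (y : 'rV[R]_n) : `|t| <= `|cons_rV (t, y)|.
Proof. by have := le_coord_norm (cons_rV (t, y)) (@lshift 1 n 0); rewrite cons_rVl. Qed.

Lemma cons_rV_norm_r n (t : R) (y : 'rV[R]_n) : `|y| <= `|cons_rV (t, y)|.
Proof.
apply: rV_norm_le => // i.
by have := le_coord_norm (cons_rV (t, y)) (@rshift 1 n i); rewrite cons_rVr.
Qed.

Lemma continuous_integrableT n (f : 'rV[R]_n -> R) (M : R) :
  continuous f -> (forall x, M < `|x| -> f x = 0) ->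
  (lebesgue_rV R n).-integrable setT (EFin \o f).
Proof.
move=> cf f0; pose B := ball (0 : 'rV[R]_n) (`|M| + 1).
have := @continuous_integrable R n B f (ball_open _ _) _ cf.
have bB : bounded_set B.
  apply: (@bounded_onI _ _ _ _ id (`|M| + 1)) => x /ballP_norm.
  by rewrite sub0r normrN => /ltW.
move=> /(_ bB) /integrable_mkcond.
rewrite (_ : (EFin \o f) \_ B = EFin \o f); first by apply; exact: measurable_rV_ball.
apply/funext => x; rewrite /patch; case: ifPn => // /negP xB.
rewrite /= f0 // ltNge; apply/negP => xM; apply: xB; rewrite inE; apply/ballP_norm.
by rewrite sub0r normrN (le_lt_trans xM) // (le_lt_trans (ler_norm M)) // ltrDl.
Qed.

Lemma integral_derive_compact (f df : R -> R) (M : R) :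
  continuous df -> (forall x : R, is_derive x 1 f (df x)) ->
  (forall x, M < `|x| -> f x = 0) -> (forall x, M < `|x| -> df x = 0) ->
  (\int[lebesgue_measure]_x (df x)%:E = 0)%E.
Proof.
move=> cdf fdf f0 df0; pose a : R := `|M| + 1.
have Ma : M < a by rewrite (le_lt_trans (ler_norm M)) // ltrDl.
have a0 : 0 < a by rewrite ltr_pwDr.
have cf : continuous f.
  move=> x; apply/differentiable_continuous/derivable1_diffP.
  exact: (@ex_derive _ _ _ _ _ _ _ (fdf x)).
transitivity (\int[lebesgue_measure]_(x in `[(- a)%R, a]%classic) (df x)%:E)%E.
  rewrite [RHS]integral_mkcond; apply: eq_integral => x _.
  rewrite /patch; case: ifPn => // /negP xa; rewrite df0 // (lt_le_trans Ma) //.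
  rewrite leNgt; apply/negP => /ltW; rewrite ler_norml => xx.
  by apply: xa; rewrite inE /= in_itv.
rewrite (@continuous_FTC2 _ df f).
- by rewrite (f0 a) ?(f0 (- a)) ?normrN ?(gtr0_norm a0) // sube0.
- by rewrite gtrN.
- exact: continuous_subspaceT.
- split; first by move=> x _; exact: (@ex_derive _ _ _ _ _ _ _ (fdf x)).
    exact/cvg_at_right_filter/cf.
  exact/cvg_at_left_filter/cf.
- by move=> x _; rewrite derive1E (@derive_val _ _ _ _ _ _ _ (fdf x)).
Qed.

(** The change of variables is free of integrability conditions only for nonnegative functions, so
    it is applied to the absolute value; the signed formula then becomes available. *)
Let mprod_integrable n (f : 'rV[R]_n.+1 -> R) (M : R) :
  continuous f -> (forall x, M < `|x| -> f x = 0) ->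
  (@lebesgue_measure R \x lebesgue_rV R n)%E.-integrable setT
    (EFin \o f \o @cons_rV R n).
Proof.
move=> cf f0; have := continuous_integrableT cf f0.
move=> /integrableP[mf foo]; apply/integrableP; split.
  apply/measurable_EFinP.
  by apply: measurableT_comp (@measurable_cons_rV R n); exact: continuous_rV_measurable.
move: foo; rewrite [X in (X < _)%E -> _](_ : _ = \int[pushforward
  (@lebesgue_measure R \x lebesgue_rV R n)%E (@cons_rV R n)]_x `|(f x)%:E|)%E //.
rewrite ge0_integral_pushforward //; first exact: measurable_cons_rV.
by apply: measurableT_comp.
Qed.

Lemma integral_cons_rV n (f : 'rV[R]_n.+1 -> R) (M : R) :
  continuous f -> (forall x, M < `|x| -> f x = 0) ->
  (\int[lebesgue_rV R n.+1]_x (f x)%:E =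
   \int[@lebesgue_measure R \x lebesgue_rV R n]_p (f (cons_rV p))%:E)%E.
Proof.
move=> cf f0; transitivity (\int[pushforward
  (@lebesgue_measure R \x lebesgue_rV R n)%E (@cons_rV R n)]_x ((EFin \o f) x))%E => //.
rewrite integral_pushforward //.
- exact: measurable_cons_rV.
- by apply/measurable_EFinP; exact: continuous_rV_measurable.
- exact: (mprod_integrable cf f0).
Qed.

(** Induction on the dimension with Fubini: if [i] is the first coordinate, the inner integral over
    it vanishes by the fundamental theorem of calculus; otherwise the inner integral runs over the
    remaining coordinates and vanishes by induction. *)
Lemma integral_partial_compact n (i : 'I_n) (f df : 'rV[R]_n -> R) (M : R) :
  continuous df -> (forall x, is_derive x (delta_mx 0 i) f (df x)) ->
  (forall x, M < `|x| -> f x = 0) -> (forall x, M < `|x| -> df x = 0) ->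
  (\int[lebesgue_rV R n]_x (df x)%:E = 0)%E.
Proof.
elim: n i f df => [[]//|n IH] i f df cdf fdf f0 df0.
rewrite (integral_cons_rV cdf df0).
have idf := mprod_integrable cdf df0.
have deltaE m h (k l : 'I_m) (x : 'rV[R]_m) :
    (h *: delta_mx 0 k + x) 0 l = h * (l == k)%:R + x 0 l.
  by rewrite !mxE.
have rl j : (@rshift 1 n j == @lshift 1 n 0 :> 'I_n.+1) = false by exact: (@eq_rlshift 1 n).
have lr j k : (@lshift 1 n k == @rshift 1 n j :> 'I_n.+1) = false by exact: (@eq_lrshift 1 n).
have rr j k : (@rshift 1 n k == @rshift 1 n j :> 'I_n.+1) = (k == j) by exact: (@eq_rshift 1 n).
have consl h (t : R) (y : 'rV[R]_n) :
    cons_rV (h *: (1 : R) + t, y) = h *: delta_mx 0 (@lshift 1 n 0) + cons_rV (t, y).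
  apply/rowP => k; rewrite deltaE; have [j ->|j ->] := @split_ordP 1 n k.
    by rewrite !cons_rVl (ord1 j) !eqxx.
  by rewrite !cons_rVr rl mulr0 add0r.
have consr h (t : R) (y : 'rV[R]_n) j :
    cons_rV (t, h *: delta_mx 0 j + y) = h *: delta_mx 0 (@rshift 1 n j) + cons_rV (t, y).
  apply/rowP => k; rewrite deltaE; have [l ->|l ->] := @split_ordP 1 n k.
    by rewrite !cons_rVl lr mulr0 add0r.
  by rewrite !cons_rVr deltaE rr.
have [j ij|j ij] := @split_ordP 1 n i.
- rewrite -(integral21_prod_meas1 idf); apply: integral0_eq => y _.
  rewrite /fubini_G /=; apply: (@integral_derive_compact (fun t => f (cons_rV (t, y))) _ M).
  + move=> t; apply: continuous_comp; first exact: continuous_cons_rV_l.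
    exact: cdf.
  + move=> t; apply: is_derive_line (fdf (cons_rV (t, y))) => h.
    by rewrite consl ij (ord1 j).
  + by move=> t Mt; apply: f0; apply: lt_le_trans Mt _; exact: cons_rV_norm_l.
  + by move=> t Mt; apply: df0; apply: lt_le_trans Mt _; exact: cons_rV_norm_l.
- rewrite -(integral12_prod_meas1 idf); apply: integral0_eq => t _.
  rewrite /fubini_F /=; apply: (IH j (fun y => f (cons_rV (t, y)))).
  + move=> y; apply: continuous_comp; first exact: continuous_cons_rV_r.
    exact: cdf.
  + move=> y; apply: is_derive_line (fdf (cons_rV (t, y))) => h.
    by rewrite consr ij.
  + by move=> y My; apply: f0; apply: lt_le_trans My _; exact: cons_rV_norm_r.
  + by move=> y My; apply: df0; apply: lt_le_trans My _; exact: cons_rV_norm_r.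
Qed.

End divergence.

(** * Scalar product and convex sets *)

Section dotv_theory.
Context (R : realType).
Implicit Types n : nat.

Lemma dotvC n (x y : 'rV[R]_n) : dotv x y = dotv y x.
Proof. by apply: eq_bigr => i _; rewrite mulrC. Qed.

Lemma dotvDl n (x y z : 'rV[R]_n) : dotv (x + y) z = dotv x z + dotv y z.
Proof. by rewrite -big_split; apply: eq_bigr => i _; rewrite !mxE mulrDl. Qed.

Lemma dotvDr n (x y z : 'rV[R]_n) : dotv z (x + y) = dotv z x + dotv z y.
Proof. by rewrite dotvC dotvDl !(dotvC _ z). Qed.

Lemma dotvZl n (a : R) (x z : 'rV[R]_n) : dotv (a *: x) z = a * dotv x z.
Proof. by rewrite /dotv mulr_sumr; apply: eq_bigr => i _; rewrite !mxE mulrA. Qed.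

Lemma dotvZr n (a : R) (x z : 'rV[R]_n) : dotv z (a *: x) = a * dotv z x.
Proof. by rewrite dotvC dotvZl dotvC. Qed.

Lemma dotvNl n (x z : 'rV[R]_n) : dotv (- x) z = - dotv x z.
Proof. by rewrite -scaleN1r dotvZl mulN1r. Qed.

Lemma dotvNr n (x z : 'rV[R]_n) : dotv z (- x) = - dotv z x.
Proof. by rewrite dotvC dotvNl dotvC. Qed.

Lemma dotvBl n (x y z : 'rV[R]_n) : dotv (x - y) z = dotv x z - dotv y z.
Proof. by rewrite dotvDl dotvNl. Qed.

Lemma dotvBr n (x y z : 'rV[R]_n) : dotv z (x - y) = dotv z x - dotv z y.
Proof. by rewrite dotvDr dotvNr. Qed.

Lemma dotv0l n (z : 'rV[R]_n) : dotv 0 z = 0.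
Proof. by rewrite -(scale0r z) dotvZl mul0r. Qed.

Lemma dotv0r n (z : 'rV[R]_n) : dotv z 0 = 0.
Proof. by rewrite dotvC dotv0l. Qed.

Lemma dotv_delta n (x : 'rV[R]_n) i : dotv x (delta_mx 0 i) = x 0 i.
Proof.
rewrite /dotv (bigD1 i) //= !mxE !eqxx mulr1 big1 ?addr0 // => j ji.
by rewrite mxE eqxx (negbTE ji) mulr0.
Qed.

Lemma norm_delta_rV n (i : 'I_n) : `|delta_mx 0 i : 'rV[R]_n| = 1.
Proof.
apply/le_anti/andP; split.
  apply: rV_norm_le => // j; rewrite mxE eqxx /=; case: eqP => _ /=.
    by rewrite normr1.
  by rewrite normr0.
by have := le_coord_norm (delta_mx 0 i : 'rV[R]_n) i; rewrite mxE !eqxx normr1.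
Qed.

Lemma dotv_norm_le n (x y : 'rV[R]_n) : `|dotv x y| <= n%:R * `|x| * `|y|.
Proof.
apply: le_trans (ler_norm_sum _ _ _) _.
apply: (@le_trans _ _ (\sum_(i < n) `|x| * `|y|)).
  by apply: ler_sum => i _; rewrite normrM ler_pM // le_coord_norm.
by rewrite sumr_const card_ord -mulrA mulr_natl.
Qed.

Lemma dotv_sqr_gt0 n (x : 'rV[R]_n) : x != 0 -> 0 < dotv x x.
Proof.
move=> x0; have [i xi] : exists i, x 0 i != 0.
  apply/existsP; apply: contraNT x0 => /existsPn x0; apply/eqP/rowP => i.
  by have := x0 i; rewrite negbK mxE => /eqP.
rewrite /dotv (bigD1 i) //=; apply: ltr_pwDl; first by rewrite -expr2 exprn_even_gt0.
by apply: sumr_ge0 => j _; rewrite -expr2 sqr_ge0.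
Qed.

Lemma convex_comb n (A : set 'rV[R]_n) (x y : 'rV[R]_n) (l : R) :
  convex_set A -> A x -> A y -> 0 <= l -> l <= 1 -> A (l *: x + (1 - l) *: y).
Proof.
move=> cA Ax Ay l0 l1.
have := cA x y (Itv01 l0 l1); rewrite !inE => /(_ Ax Ay).
done.
Qed.

Lemma convex_combI n (A : set 'rV[R]_n) :
  (forall x y (l : R), A x -> A y -> 0 <= l -> l <= 1 ->
     A (l *: x + (1 - l) *: y)) -> convex_set A.
Proof.
by move=> h x y l; rewrite !inE => Ax Ay; apply: h.
Qed.

Lemma closure_rV_approx n (A : set 'rV[R]_n) x e : closure A x -> 0 < e ->
  exists2 y, A y & `|x - y| < e.
Proof.
by move=> /(_ _ (nbhsx_ballx x e _)) + e0 => /(_ e0) [y [Ay /ballP_norm xy]]; exists y.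
Qed.

Lemma closure_rVI n (A : set 'rV[R]_n) x :
  (forall e, 0 < e -> exists2 y, A y & `|x - y| < e) -> closure A x.
Proof.
move=> h B /nbhs_ballP[e /= e0 eB]; have [y Ay xy] := h _ e0.
by exists y; split => //; apply/eB/ballP_norm.
Qed.

Lemma closure_convex n (A : set 'rV[R]_n) : convex_set A -> convex_set (closure A).
Proof.
move=> cA; apply: convex_combI => x y l Ax Ay l0 l1; apply: closure_rVI => e e0.
have [x' Ax' xx'] := closure_rV_approx Ax e0.
have [y' Ay' yy'] := closure_rV_approx Ay e0.
exists (l *: x' + (1 - l) *: y'); first exact: convex_comb.
rewrite opprD addrACA -!scalerBr (le_lt_trans (ler_normD _ _)) // !normrZ.
rewrite (ger0_norm l0) ger0_norm ?subr_ge0 //.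
have [->|l1'] := eqVneq l 1; first by rewrite subrr mul0r addr0 mul1r.
have l1s : 0 < 1 - l by rewrite subr_gt0 lt_neqAle l1'.
have : 0 < (1 - l) * (e - `|y - y'|) by rewrite mulr_gt0 // subr_gt0.
have : 0 <= l * (e - `|x - x'|) by rewrite mulr_ge0 // subr_ge0 ltW.
lra.
Qed.

Lemma closure_bounded n (A : set 'rV[R]_n) : bounded_set A -> bounded_set (closure A).
Proof.
move=> /bounded_rV_le[M M0 AM]; apply: (@bounded_onI _ _ _ _ id (M + 1)) => x Ax.
have [y Ay xy] := closure_rV_approx Ax ltr01.
rewrite -(subrK y x) (le_trans (ler_normD _ _)) // addrC lerD // ?AM //; exact: ltW.
Qed.

(* y is approximated by y' in A, and the error is absorbed in the ball. *)
Lemma convex_cone_interior n (A : set 'rV[R]_n) c r y s : convex_set A ->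
  0 < r -> ball c r `<=` A -> closure A y -> 0 <= s -> s < 1 ->
  interior A (c + s *: (y - c)).
Proof.
move=> cA r0 rA Ay s0 s1.
have e0 : 0 < (1 - s) * r / 2 by rewrite !mulr_gt0 // subr_gt0.
have [y' Ay' yy'] := closure_rV_approx Ay e0.
apply/nbhs_ballP; exists ((1 - s) * r / 2) => //= w /ballP_norm cw.
have s1' : 1 - s != 0 by rewrite subr_eq0 gt_eqF.
pose z := (1 - s)^-1 *: (w - s *: y').
have -> : w = s *: y' + (1 - s) *: z.
  by rewrite scalerA divff // scale1r addrC subrK.
apply: convex_comb => //; last exact: ltW.
apply/rA/ballP_norm; rewrite -(ltr_pM2l (x := 1 - s)) ?subr_gt0 //.
rewrite -[X in X * _]gtr0_norm ?subr_gt0 // -normrZ scalerBr scalerA divff // scale1r.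
have -> : (1 - s) *: c - (w - s *: y') = (c + s *: (y - c) - w) - s *: (y - y').
  by apply/rowP => i; rewrite !mxE; ring.
rewrite (le_lt_trans (ler_normD _ _)) // normrN normrZ (ger0_norm s0).
rewrite (splitr (_ * r)) ltr_leD //; have := normr_ge0 (y - y'); nra.
Qed.

End dotv_theory.

(** * Support functions and polar sets *)

Section support_polar.
Context (R : realType) (n : nat).
Implicit Types (A B C : set 'rV[R]_n) (x y : 'rV[R]_n).

Lemma support_fun_has_ubound A x : bounded_set A ->
  has_ubound [set dotv x y | y in A].
Proof.
move=> /bounded_rV_le[M M0 AM]; exists (n%:R * `|x| * M) => _ [y Ay <-].
apply: le_trans (ler_norm _) _; apply: le_trans (dotv_norm_le _ _) _.
by rewrite ler_wpM2l ?mulr_ge0 // AM.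
Qed.

Lemma le_support_fun A x a : bounded_set A -> A a -> dotv x a <= support_fun A x.
Proof.
by move=> bA Aa; apply: ub_le_sup; [exact: support_fun_has_ubound|exists a].
Qed.

Lemma support_fun_le A x c : A !=set0 -> (forall a, A a -> dotv x a <= c) ->
  support_fun A x <= c.
Proof.
move=> [a Aa] h; apply: ge_sup; first by exists (dotv x a), a.
by move=> _ [b Ab <-]; exact: h.
Qed.

Lemma support_funD A x y : bounded_set A -> A !=set0 ->
  support_fun A (x + y) <= support_fun A x + support_fun A y.
Proof.
move=> bA A0; apply: support_fun_le => // a Aa.
by rewrite dotvDl lerD // le_support_fun.
Qed.

Lemma support_funZ A x t : bounded_set A -> A !=set0 -> 0 < t ->
  support_fun A (t *: x) = t * support_fun A x.
Proof.
move=> bA A0 t0; apply/le_anti/andP; split.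
  by apply: support_fun_le => // a Aa; rewrite dotvZl ler_pM2l // le_support_fun.
rewrite mulrC -ler_pdivlMr //; apply: support_fun_le => // a Aa.
by rewrite ler_pdivlMr // mulrC -dotvZl le_support_fun.
Qed.

Lemma support_fun0 A : A !=set0 -> support_fun A 0 = 0.
Proof.
move=> A0; rewrite /support_fun (_ : [set _ | _ in _] = [set 0]) ?sup1 //.
apply/seteqP; split => [_ [a _ <-]|_ ->]; first by rewrite dotv0l.
by have [a Aa] := A0; exists a => //; rewrite dotv0l.
Qed.

Lemma support_fun_ge0 A x : bounded_set A -> A 0 -> 0 <= support_fun A x.
Proof. by move=> bA A0; rewrite -(dotv0r x); exact: le_support_fun. Qed.

Lemma support_funS A B x : bounded_set B -> A !=set0 -> A `<=` B ->
  support_fun A x <= support_fun B x.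
Proof.
by move=> bB A0 AB; apply: support_fun_le => // a /AB; exact: le_support_fun.
Qed.

Lemma support_funN A x : origin_symmetric A ->
  support_fun A (- x) = support_fun A x.
Proof.
move=> sA; rewrite /support_fun; congr sup; apply/seteqP; split.
  by move=> _ [a Aa <-]; exists (- a); [exact: sA|rewrite dotvNl dotvNr].
by move=> _ [a Aa <-]; exists (- a); [exact: sA|rewrite dotvNl dotvNr opprK].
Qed.

Lemma support_fun_lipschitz A M x y : A !=set0 -> (forall a, A a -> `|a| <= M) ->
  `|support_fun A x - support_fun A y| <= n%:R * M * `|x - y|.
Proof.
move=> A0 AM; have bA : bounded_set A by exact: (@bounded_onI _ _ _ _ id M).
have h u v : support_fun A u <= support_fun A v + n%:R * M * `|u - v|.
  rewrite -{1}(subrK v u) addrC; apply: le_trans (support_funD _ _ bA A0) _.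
  rewrite lerD2l; apply: support_fun_le => // a Aa.
  apply: le_trans (ler_norm _) _; apply: le_trans (dotv_norm_le _ _) _.
  by rewrite -mulrA (mulrC `|_|) mulrA ler_wpM2r // ler_wpM2l // AM.
rewrite ler_norml; apply/andP; split.
  by have := h y x; rewrite distrC; lra.
by have := h x y; lra.
Qed.

Lemma support_fun_continuous A : bounded_set A -> A !=set0 ->
  continuous (support_fun A).
Proof.
move=> /bounded_rV_le[M M0 AM] A0.
apply: (@lipschitz_continuousW R _ _ _ (n%:R * M)) => x y.
exact: support_fun_lipschitz.
Qed.

(** Each coordinate is tested on [r / 2] times a signed unit vector; the half keeps this vector
    inside the open ball. *)
Lemma support_fun_ball_ge A r x : bounded_set A -> 0 < r -> ball 0 r `<=` A ->
  (r / 2) * `|x| <= support_fun A x.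
Proof.
move=> bA r0 rA; rewrite mulrC -ler_pdivlMr ?divr_gt0 //.
have A0 : A 0 by apply: rA; exact: ballxx.
apply: rV_norm_le => [|i]; first by rewrite mulr_ge0 ?support_fun_ge0 // invr_ge0 divr_ge0 ?ltW.
rewrite ler_pdivlMr ?divr_gt0 //.
have hb s : `|s| <= 1 -> A ((s * (r / 2)) *: delta_mx 0 i).
  move=> s1; apply/rA/ballP_norm; rewrite sub0r normrN normrZ norm_delta_rV mulr1.
  rewrite normrM (gtr0_norm (_ : 0 < r / 2)) ?divr_gt0 //.
  have := normr_ge0 s; nra.
have [x0|x0] := leP 0 (x 0 i).
  have := le_support_fun x bA (hb 1 _); rewrite normr1 => /(_ (lexx _)).
  by rewrite dotvZr dotv_delta mul1r mulrC ger0_norm.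
have := le_support_fun x bA (hb (- 1) _); rewrite normrN normr1 => /(_ (lexx _)).
by rewrite dotvZr dotv_delta ltr0_norm // mulN1r mulrC mulNr mulrN.
Qed.

(** The one-sided polar: for a closed convex set around the origin its support function is the gauge
    of the set. Gauges are always used in this form, as suprema of linear forms. *)
Definition polar A : set 'rV[R]_n := [set a | forall y, A y -> dotv a y <= 1].

Lemma polar0 A : polar A 0.
Proof. by move=> y _; rewrite dotv0l. Qed.

Lemma polar_neq0 A : polar A !=set0.
Proof. by exists 0; exact: polar0. Qed.

Lemma polarS A B : A `<=` B -> polar B `<=` polar A.
Proof. by move=> AB a aB y /AB; exact: aB. Qed.

Lemma polar_closure A : polar (closure A) = polar A.
Proof.
apply/seteqP; split; first exact/polarS/subset_closure.
move=> a aA y Ay; apply/ler_addgt0Pr => e e0.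
have e1 : 0 < e / (n%:R * `|a| + 1) by rewrite divr_gt0 // ltr_wpDl ?mulr_ge0.
have [z Az yz] := closure_rV_approx Ay e1.
rewrite -(subrK z y) dotvDr addrC lerD ?aA // (le_trans (ler_norm _)) //.
apply: le_trans (dotv_norm_le _ _) _.
apply: (@le_trans _ _ ((n%:R * `|a| + 1) * `|y - z|)).
  by rewrite ler_wpM2r // lerDl.
by rewrite -ler_pdivlMl ?ltr_wpDl ?mulr_ge0 // mulrC ltW.
Qed.

Lemma polar_bounded A r : 0 < r -> ball 0 r `<=` A -> bounded_set (polar A).
Proof.
move=> r0 rA; apply: (@bounded_onI _ _ _ _ id (2 / r)) => a aA.
apply: rV_norm_le => [|i]; first by rewrite divr_ge0 ?ltW.
have hb s : `|s| <= 1 -> dotv a ((s * (r / 2)) *: delta_mx 0 i) <= 1.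
  move=> s1; apply/aA/rA/ballP_norm; rewrite sub0r normrN normrZ norm_delta_rV mulr1.
  rewrite normrM (gtr0_norm (_ : 0 < r / 2)) ?divr_gt0 //.
  have := normr_ge0 s; nra.
have := hb 1 _; rewrite normr1 => /(_ (lexx _)).
have := hb (- 1) _; rewrite normrN normr1 => /(_ (lexx _)).
rewrite !dotvZr dotv_delta => h1 h2.
by rewrite ler_pdivlMr // -[X in _ * X]gtr0_norm // -normrM ler_norml; apply/andP; split; lra.
Qed.

End support_polar.

(** * Separation of a point from a convex set, and the bipolar theorem *)

Section separation.
Context (R : realType) (n : nat).
Implicit Types (A B C K : set 'rV[R]_n) (x y : 'rV[R]_n).

Lemma continuous_sum_fun (T : topologicalType) (I : Type) (r : seq I)
    (F : I -> T -> R) : (forall i, continuous (F i)) ->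
  continuous (fun t => \sum_(i <- r) F i t).
Proof.
by move=> cF; apply: (@continuous_big R I _ _ xpredT) => //; exact: add_continuous.
Qed.

Lemma dist_continuous x : continuous (fun y => dotv (y - x) (y - x)).
Proof.
apply: continuous_sum_fun => i y.
have c : continuous (fun z : 'rV[R]_n => (z - x) 0 i).
  apply: (@lipschitz_continuousW R _ _ _ 1) => z w; rewrite mul1r.
  rewrite (_ : _ - _ = (z - w) 0 i) ?le_coord_norm // !mxE; ring.
exact: (continuousM (c y) (c y)).
Qed.

(** The functional is [x - c], with [c] the point of [C] nearest to [x] for the Euclidean distance:
    if [y] lay beyond the hyperplane through [c], a small move from [c] towards [y] would come
    closer to [x]. *)
Lemma separation_compact C x : compact C -> convex_set C -> C !=set0 -> ~ C x ->
  exists a m, (forall y, C y -> dotv a y <= m) /\ m < dotv a x.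
Proof.
move=> cC convC C0 Cx.
have [c /set_mem Cc minc] := EVT_min_rV C0 cC (continuous_subspaceT (@dist_continuous x)).
have xc : x - c != 0 by rewrite subr_eq0; apply/negP => /eqP E; apply: Cx; rewrite E.
exists (x - c), (dotv (x - c) c); split; last first.
  by rewrite -subr_gt0 -dotvBr dotv_sqr_gt0.
move=> y Cy; rewrite -subr_le0 -dotvBr leNgt; apply/negP => h.
pose q := dotv (y - c) (y - c).
have q0 : 0 <= q by apply: sumr_ge0 => i _; rewrite -expr2 sqr_ge0.
pose p := dotv (x - c) (y - c).
(* Moving by [l] changes the squared distance by [l ^+ 2 * q - 2 * l * p], so a small [l] wins; the
   divisor [q + 1] stays positive when [q = 0]. *)
have [l [l0 l1 lq]] : exists l, [/\ 0 < l, l <= 1 & l * q < 2 * p].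
  have p0 : 0 < p := h.
  exists (Num.min 1 (p / (q + 1))).
  have q1 : 0 < q + 1 by lra.
  split; first by rewrite lt_min ltr01 divr_gt0.
    by rewrite ge_min lexx.
  apply: (@le_lt_trans _ _ (p / (q + 1) * q)).
    by rewrite ler_wpM2r // ge_min lexx orbT.
  rewrite mulrAC ltr_pdivrMr //; nra.
have := minc (l *: y + (1 - l) *: c).
rewrite inE => /(_ (convex_comb convC Cy Cc (ltW l0) l1)).
have -> : l *: y + (1 - l) *: c - x = l *: (y - c) - (x - c).
  by apply/rowP => i; rewrite !mxE; ring.
rewrite -(opprB x c) dotvNl dotvNr opprK.
have E (u v : 'rV[R]_n) : dotv (l *: u - v) (l *: u - v) =
    l * l * dotv u u - 2 * l * dotv v u + dotv v v.
  by rewrite !(dotvBl, dotvBr, dotvZl, dotvZr) (dotvC u v); ring.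
rewrite E -/p -/q; nra.
Qed.

Lemma compact_rV_closed A : compact A -> closed A.
Proof. by apply: compact_closed; exact: norm_hausdorff. Qed.

Lemma bipolar C r x : compact C -> convex_set C -> 0 < r -> ball 0 r `<=` C ->
  support_fun (polar C) x <= 1 -> C x.
Proof.
move=> cC convC r0 rC hx; apply: contrapT => Cx.
have C0 : C 0 by apply: rC; exact: ballxx.
have [|a [m [am mx]]] := separation_compact cC convC _ Cx; first by exists 0.
have m0 : 0 <= m by rewrite -(dotv0r a) am.
(* A level strictly between the two sides: dividing [a] by it gives an element of the polar whose
   value at [x] exceeds 1. *)
pose s := (m + dotv a x) / 2.
have s0 : 0 < s by rewrite /s; lra.
have pa : polar C (s^-1 *: a).
  move=> y /am ay; rewrite dotvZl mulrC ler_pdivrMr // mul1r /s; lra.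
have := le_trans (le_support_fun x (polar_bounded r0 rC) pa) hx.
rewrite dotvZr mulrC ler_pdivrMr // mul1r dotvC /s; lra.
Qed.

(** [bipolar] only reaches the closure. In one direction the strict inequality leaves room to dilate
    [x] and then shrink back into the interior; in the other, openness provides a dilate of [x]
    inside [A]. *)
Lemma support_polar_lt1 A r x : open A -> convex_set A -> bounded_set A ->
  0 < r -> ball 0 r `<=` A -> support_fun (polar A) x < 1 <-> A x.
Proof.
move=> oA cA bA r0 rA; have bp := polar_bounded r0 rA.
have p0 : polar A !=set0 by exists 0; exact: polar0.
split => [h|Ax].
- have h0 : 0 <= support_fun (polar A) x by apply: support_fun_ge0 => //; exact: polar0.
  pose s := (support_fun (polar A) x + 1) / 2.
  have s0 : 0 < s by rewrite /s; lra.
  have cl : closure A (s^-1 *: x).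
    apply: (@bipolar _ r) => //.
    - by apply: bounded_closed_compact; [exact: closure_bounded|exact: closed_closure].
    - exact: closure_convex.
    - by apply: (subset_trans rA); exact: subset_closure.
    - rewrite polar_closure support_funZ ?invr_gt0 // mulrC ler_pdivrMr // mul1r /s; lra.
  have s1 : s < 1 by rewrite /s; lra.
  have := convex_cone_interior cA r0 rA cl (ltW s0) s1.
  rewrite subr0 add0r scalerA divff ?gt_eqF // scale1r; exact: interior_subset.
- have [e e0 Ae] : exists2 e, 0 < e & A ((1 + e) *: x).
    have /nbhs_ballP[d /= d0 dA] : nbhs x A by apply: open_nbhs_nbhs.
    have x1 : 0 < `|x| + 1 by rewrite ltr_wpDl.
    exists (d / 2 / (`|x| + 1)); first by rewrite !divr_gt0.
    apply/dA/ballP_norm; rewrite scalerDl scale1r opprD addrA subrr sub0r normrN.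
    rewrite normrZ gtr0_norm ?divr_gt0 // mulrAC ltr_pdivrMr //.
    by have := normr_ge0 x; nra.
  apply: (@le_lt_trans _ _ (1 + e)^-1); last by rewrite invf_lt1; lra.
  apply: support_fun_le => // a aA; rewrite -(ler_pM2l (x := 1 + e)); last by lra.
  by rewrite divff ?gt_eqF //; [rewrite dotvC -dotvZr; exact: aA|lra].
Qed.

(** The Cauchy-Schwarz inequality for a gauge and its dual: [y] divided by [support_fun A y] lies in
    the polar. The inner ball makes this divisor positive when [y != 0]. *)
Lemma dotv_le_polar A r x y : bounded_set A -> 0 < r -> ball 0 r `<=` A ->
  dotv x y <= support_fun (polar A) x * support_fun A y.
Proof.
move=> bA r0 rA; have := support_fun_ball_ge y bA r0 rA.
have [->|y0] := eqVneq y 0.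
  rewrite dotv0r support_fun0 ?mulr0 //; exists 0; apply: rA; exact: ballxx.
move=> h; have h0 : 0 < support_fun A y.
  by apply: lt_le_trans h; rewrite mulr_gt0 ?divr_gt0 // normr_gt0.
rewrite -ler_pdivrMr // mulrC -dotvZr; apply: le_support_fun.
  exact: polar_bounded rA.
by move=> z Az; rewrite dotvZl mulrC ler_pdivrMr // mul1r le_support_fun.
Qed.

Lemma convex_body_ball K : convex_body K -> origin_symmetric K ->
  exists2 r, 0 < r & ball 0 r `<=` K.
Proof.
move=> [_ cK [p /nbhs_ballP[r /= r0 rK]]] sK; exists r => // w /ballP_norm.
rewrite sub0r normrN => wr.
(* [w] is the midpoint of [p + w] and of the reflection of [p - w], both in [K] by symmetry. *)
have -> : w = 2^-1 *: (p + w) + (1 - 2^-1) *: (w - p).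
  by apply/rowP => i; rewrite !mxE; field.
apply: convex_comb => //; try lra.
  by apply/rK/ballP_norm; rewrite opprD addrA subrr sub0r normrN.
rewrite -opprB; apply: sK; apply/rK/ballP_norm.
by rewrite opprB addrCA subrr addr0.
Qed.

Lemma convex_body_bounded K : convex_body K -> bounded_set K.
Proof. by move=> [cK _ _]; exact: compact_bounded. Qed.

(** A point of the interior of the closure stays in the closure when pushed slightly away from [c];
    the point itself then lies strictly inside the segment from [c], where [convex_cone_interior]
    applies. *)
Lemma interior_convex_closure A : open A -> convex_set A -> A !=set0 ->
  interior (closure A) `<=` A.
Proof.
move=> oA cA [c Ac] x /nbhs_ballP[d /= d0 dA].
have /nbhs_ballP[r /= r0 rA] : nbhs c A by apply: open_nbhs_nbhs.
have e1 : 0 < `|x - c| + 1 by rewrite ltr_wpDl.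
pose e := d / 2 / (`|x - c| + 1).
have e0 : 0 < e by rewrite !divr_gt0.
have cl : closure A (x + e *: (x - c)).
  apply/dA/ballP_norm; rewrite opprD addrA subrr sub0r normrN.
  rewrite normrZ gtr0_norm // /e mulrAC ltr_pdivrMr //.
  by have := normr_ge0 (x - c); nra.
have s0 : 0 <= (1 + e)^-1 by rewrite invr_ge0; lra.
have s1 : (1 + e)^-1 < 1 by rewrite invf_lt1; lra.
have := convex_cone_interior cA r0 rA cl s0 s1.
have -> : c + (1 + e)^-1 *: (x + e *: (x - c) - c) = x.
  by apply/rowP => i; rewrite !mxE; field; lra.
exact: interior_subset.
Qed.

End separation.

(** * Existence of a largest inscribed homothet *)

Section inradius_theory.
Context (R : realType) (n : nat).
Variables (K Omega : set 'rV[R]_n.+1) (r : R).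
Hypotheses (r0 : 0 < r) (rK : ball 0 r `<=` K) (bK : bounded_set K).
Hypothesis cO : convex_domain Omega.

Let inner : set R :=
  [set t | exists2 x, Omega x & homothet x t K `<=` closure Omega].

Lemma inscribed_le : exists2 T : R, 0 < T &
  forall x t, closure Omega x -> homothet x t K `<=` closure Omega -> t <= T.
Proof.
have [_ _ /closure_bounded/bounded_rV_le[M M0 OM] _] := cO.
exists (4 * M / r); first by rewrite divr_gt0 ?mulr_gt0.
move=> x t Ox tO; have [t0|t0] := leP t 0.
  by apply: (le_trans t0); rewrite divr_ge0 ?mulr_ge0 // ltW.
pose y : 'rV[R]_n.+1 := (r / 2) *: delta_mx 0 0.
have yK : K y.
  apply/rK/ballP_norm; rewrite sub0r normrN normrZ norm_delta_rV gtr0_norm ?divr_gt0 //.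
  by rewrite mulr1 ltr_pdivrMr //; have := r0; lra.
have h1 : `|t *: y + x| <= M by rewrite addrC; apply/OM/tO; exists y.
have : `|t *: y| <= M + M.
  rewrite -{1}(addrK x (t *: y)); apply: le_trans (ler_normB _ _) _.
  by apply: lerD => //; exact: OM.
rewrite 2!normrZ norm_delta_rV (gtr0_norm t0) gtr0_norm ?divr_gt0 // mulr1 ler_pdivlMr //.
by rewrite mulrA ler_pdivrMr //; lra.
Qed.

Let inner_ubound : has_ubound inner.
Proof.
have [T T0 hT] := inscribed_le; exists T => t [x Ox tO].
by apply: hT tO; exact: subset_closure.
Qed.

Lemma inscribed_le_inradius x t : Omega x -> homothet x t K `<=` closure Omega ->
  t <= inradius K Omega.
Proof. by move=> Ox xt; apply: ub_le_sup => //; exists x. Qed.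

(** Compactness gives a best pair of centre and ratio with the centre in the closure, whereas
    [inradius] wants it in [Omega]. A positive ratio puts a ball around the centre, and an open
    convex set is the interior of its closure. *)
Lemma inradius_attained : exists x0, [/\ Omega x0, 0 < inradius K Omega &
  homothet x0 (inradius K Omega) K `<=` closure Omega].
Proof.
have [oO [x1 Ox1] bO cvO] := cO.
have [M M0 KM] := bounded_rV_le bK.
have [e e0 eO] : exists2 e, 0 < e & homothet x1 e K `<=` closure Omega.
  have /nbhs_ballP[d /= d0 dO] : nbhs x1 Omega by apply: open_nbhs_nbhs.
  exists (d / 2 / M); first by rewrite !divr_gt0.
  move=> _ [y Ky <-]; apply/subset_closure/dO/ballP_norm.
  rewrite opprD addrA subrr sub0r normrN normrZ gtr0_norm ?divr_gt0 //.
  apply: (@le_lt_trans _ _ (d / 2 / M * M)); first by rewrite ler_wpM2l ?divr_ge0 ?KM // ltW.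
  by rewrite divfK ?gt_eqF //; lra.
have [T T0 hT] := inscribed_le.
pose S : set ('rV[R]_n.+1 * R) := (closure Omega `*` `[0, T]%classic) `&`
  \bigcap_(y in K) [set p | closure Omega (p.1 + p.2 *: y)].
have cP : compact (closure Omega `*` `[0, T]%classic).
  apply: compact_setX; last exact: segment_compact.
  by apply: bounded_closed_compact; [exact: closure_bounded|exact: closed_closure].
have cS : compact S.
  apply: (subclosed_compact _ cP); last by move=> p [].
  apply: closedI; first by apply: compact_closed => //; exact: norm_hausdorff.
  apply: closed_bigI => y Ky.
  apply: (@preimage_closed _ _ (fun p : 'rV[R]_n.+1 * R => p.1 + p.2 *: y)).
    move=> p _; apply: cvgD; first exact: cvg_fst.
    by apply: cvgZ; [exact: cvg_snd|exact: cvg_cst].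
  exact: closed_closure.
have inS x t : closure Omega x -> 0 <= t -> homothet x t K `<=` closure Omega -> S (x, t).
  move=> Ox t0 xt; split; last by move=> y Ky /=; apply: xt; exists y.
  by split => //=; rewrite in_itv /= t0 (hT x).
have S1 : S (x1, e) by apply: inS => //; [exact: subset_closure|exact: ltW].
have csnd : {within S, continuous (snd : 'rV[R]_n.+1 * R -> R)}.
  by apply: continuous_subspaceT => p; exact: cvg_snd.
have [[x0 t0] /set_mem[[/= Ox0 t0T] t0K] maxS] :=
  compact_EVT_max (ex_intro _ _ S1) cS csnd.
have et0 : e <= t0 by apply: (maxS (x1, e)); rewrite inE.
have t0gt : 0 < t0 by apply: lt_le_trans et0.
have x0K : homothet x0 t0 K `<=` closure Omega.
  by move=> _ [y Ky <-]; exact: (t0K y Ky).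
have O0 : Omega x0.
  apply: interior_convex_closure => //; first by exists x1.
  apply/nbhs_ballP; exists (t0 * r); first by rewrite /= mulr_gt0.
  move=> w /ballP_norm xw; apply: x0K; exists (t0^-1 *: (w - x0)).
    apply/rK/ballP_norm; rewrite sub0r normrN normrZ gtr0_norm ?invr_gt0 //.
    by rewrite mulrC ltr_pdivrMr // mulrC distrC.
  by rewrite scalerA divff ?gt_eqF // scale1r addrC subrK.
have E : inradius K Omega = t0.
  apply/le_anti/andP; split; last exact: inscribed_le_inradius x0K.
  apply: ge_sup; first by exists t0, x0.
  move=> t [x Ox xt]; have [tn|tp] := leP t 0; first exact: le_trans (ltW t0gt).
  apply: (maxS (x, t)); rewrite inE; apply: inS => //; first exact: subset_closure.
  exact: ltW.
by exists x0; rewrite E; split.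
Qed.

End inradius_theory.

(** * Functions of class C^k *)

Section smooth_functions.
Context (R : realType).

Lemma continuous_addf (T : topologicalType) (f g : T -> R) t :
  {for t, continuous f} -> {for t, continuous g} ->
  {for t, continuous (fun u => f u + g u)}.
Proof. by move=> cf cg; exact: (@continuousD _ _ _ f g t cf cg). Qed.

Lemma continuous_mulf (T : topologicalType) (f g : T -> R) t :
  {for t, continuous f} -> {for t, continuous g} ->
  {for t, continuous (fun u => f u * g u)}.
Proof. by move=> cf cg; exact: (@continuousM _ _ f g t cf cg). Qed.

Lemma Ck_onS_intro n k (f : 'rV[R]_n -> R) (g : 'I_n -> 'rV[R]_n -> R) :
  continuous f -> (forall i x, is_derive x (delta_mx 0 i) f (g i x)) ->
  (forall i, Ck_on k setT (g i)) -> Ck_on k.+1 setT f.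
Proof.
move=> cf fg Cg; split=> [x _|i]; first exact: cf.
split=> [x _|]; first exact: (@ex_derive _ _ _ _ _ _ _ (fg i x)).
rewrite (_ : partial i f = g i) //; apply/funext => x.
exact: (@derive_val _ _ _ _ _ _ _ (fg i x)).
Qed.

Lemma Ck_on_continuous n k (f : 'rV[R]_n -> R) : Ck_on k setT f -> continuous f.
Proof. by case: k => [|k] [cf _] x; exact: cf. Qed.

Lemma Ck_onS_is_derive n k (f : 'rV[R]_n -> R) i x : Ck_on k.+1 setT f ->
  is_derive x (delta_mx 0 i) f (partial i f x).
Proof. by move=> [_ /(_ i)[df _]]; apply: derivableP; exact: df. Qed.

Lemma Ck_onS_partial n k (f : 'rV[R]_n -> R) i : Ck_on k.+1 setT f ->
  Ck_on k setT (partial i f).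
Proof. by move=> [_ /(_ i)[_ ]]. Qed.

Lemma Ck_onW n k (f : 'rV[R]_n -> R) : Ck_on k.+1 setT f -> Ck_on k setT f.
Proof.
elim: k f => [|k IH] f Cf; first by split => // x _; exact: (Ck_on_continuous Cf).
apply: (Ck_onS_intro (Ck_on_continuous Cf)) => [i x|i].
  exact: Ck_onS_is_derive Cf.
exact/IH/Ck_onS_partial.
Qed.

Lemma Ck_on_cst n k (c : R) : Ck_on k setT (fun _ : 'rV[R]_n => c).
Proof.
elim: k c => [|k IH] c; first by split => // x _; exact: cst_continuous.
by apply: (@Ck_onS_intro _ _ _ (fun _ _ => 0)) => // x; exact: cst_continuous.
Qed.

Lemma Ck_onD n k (f g : 'rV[R]_n -> R) : Ck_on k setT f -> Ck_on k setT g ->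
  Ck_on k setT (fun x => f x + g x).
Proof.
elim: k f g => [|k IH] f g Cf Cg.
  split => // x _; apply: continuous_addf; [exact: (Ck_on_continuous Cf)|exact: (Ck_on_continuous Cg)].
apply: (@Ck_onS_intro _ _ _ (fun i x => partial i f x + partial i g x)).
- by move=> x; apply: continuous_addf; [exact: (Ck_on_continuous Cf)|exact: (Ck_on_continuous Cg)].
- move=> i x; have ? := Ck_onS_is_derive i x Cf; have ? := Ck_onS_is_derive i x Cg.
  exact: is_deriveD.
- by move=> i; apply: IH; exact: Ck_onS_partial.
Qed.

Lemma Ck_onM n k (f g : 'rV[R]_n -> R) : Ck_on k setT f -> Ck_on k setT g ->
  Ck_on k setT (fun x => f x * g x).
Proof.
elim: k f g => [|k IH] f g Cf Cg.
  split => // x _; apply: continuous_mulf; [exact: (Ck_on_continuous Cf)|exact: (Ck_on_continuous Cg)].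
apply: (@Ck_onS_intro _ _ _ (fun i x => f x * partial i g x + g x * partial i f x)).
- by move=> x; apply: continuous_mulf; [exact: (Ck_on_continuous Cf)|exact: (Ck_on_continuous Cg)].
- move=> i x; have ? := Ck_onS_is_derive i x Cf; have ? := Ck_onS_is_derive i x Cg.
  exact: is_deriveM.
- by move=> i; apply: Ck_onD; apply: IH; rewrite ?Ck_onW //; exact: Ck_onS_partial || exact: Ck_onW.
Qed.

Lemma Ck_on_sum n k (I : Type) (s : seq I) (F : I -> 'rV[R]_n -> R) :
  (forall a, Ck_on k setT (F a)) -> Ck_on k setT (fun x => \sum_(a <- s) F a x).
Proof.
move=> CF; elim: s => [|a s IH].
  by under eq_fun do rewrite big_nil; exact: Ck_on_cst.
by under eq_fun do rewrite big_cons; exact: Ck_onD.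
Qed.

Lemma is_derive_sum_seq (V : normedModType R) (I : Type) (s : seq I)
    (F : I -> V -> R) (dF : I -> R) x v :
  (forall a, is_derive x v (F a) (dF a)) ->
  is_derive x v (fun y => \sum_(a <- s) F a y) (\sum_(a <- s) dF a).
Proof.
move=> dFF; elim: s => [|a s IH].
  by under eq_fun do rewrite big_nil; rewrite big_nil; exact: is_derive_cst.
by under eq_fun do rewrite big_cons; rewrite big_cons; exact: is_deriveD.
Qed.

(* Functions of one variable that are [k] times continuously differentiable on
   [D], in the form needed to differentiate compositions. *)
Fixpoint C1k (k : nat) (D : set R) (F : R -> R) : Prop :=
  (forall t, D t -> {for t, continuous F}) /\
  match k with
  | 0 => True
  | k'.+1 => exists F' : R -> R,
      (forall t, D t -> is_derive t 1 F (F' t)) /\ C1k k' D F'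
  end.

Lemma is_derive_continuous (F : R -> R) (t d : R) :
  is_derive t 1 F d -> {for t, continuous F}.
Proof.
move=> dF; apply/differentiable_continuous/derivable1_diffP.
exact: (@ex_derive _ _ _ _ _ _ _ dF).
Qed.

Lemma C1kS_intro k (D : set R) (F F' : R -> R) :
  (forall t, D t -> is_derive t 1 F (F' t)) -> C1k k D F' -> C1k k.+1 D F.
Proof.
by move=> dF CF'; split; [move=> t /dF; exact: is_derive_continuous|exists F'].
Qed.

Lemma is_derive_comp (V : normedModType R) (F : R -> R) (f : V -> R) x v a b :
  is_derive (f x) 1 F a -> is_derive x v f b ->
  is_derive x v (F \o f) (a * b).
Proof.
move=> dF df; pose h (t : R) := f (t *: v + x).
have dh : is_derive (0 : R) 1 h b.
  by apply: is_derive_line df => t; rewrite /h addr0 /GRing.scale /= mulr1.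
have h0 : h 0 = f x by rewrite /h scale0r add0r.
rewrite -h0 in dF; have := is_derive1_comp dF dh.
apply: is_derive_line => t; rewrite /h /= addr0 /GRing.scale /= mulr1.
done.
Qed.

Lemma Ck_on_comp n k (D : set R) (F : R -> R) (f : 'rV[R]_n -> R) :
  C1k k D F -> (forall x, D (f x)) -> Ck_on k setT f ->
  Ck_on k setT (fun x => F (f x)).
Proof.
elim: k F => [|k IH] F CF Df Cf.
  split => // x _; apply: continuous_comp; first exact: (Ck_on_continuous Cf).
  by apply: CF.1.
have [cF [F' [dF CF']]] := CF.
apply: (@Ck_onS_intro _ _ _ (fun i x => F' (f x) * partial i f x)).
- move=> x; apply: continuous_comp; first exact: (Ck_on_continuous Cf).
  exact: cF.
- move=> i x; apply: is_derive_comp; first exact: dF.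
  exact: Ck_onS_is_derive Cf.
- move=> i; apply: Ck_onM; last exact: Ck_onS_partial.
  by apply: IH => //; exact: Ck_onW.
Qed.

Lemma C1kW k D F : C1k k.+1 D F -> C1k k D F.
Proof.
elim: k F => [|k IH] F [cF [F' [dF CF']]]; first by split.
by split=> //; exists F'; split => //; exact: IH.
Qed.

Lemma C1kD k D F G : C1k k D F -> C1k k D G -> C1k k D (fun t => F t + G t).
Proof.
elim: k F G => [|k IH] F G [cF CF] [cG CG].
  by split=> // t Dt; apply: continuous_addf; [exact: cF|exact: cG].
have [[F' [dF CF']] [G' [dG CG']]] := (CF, CG).
apply: (@C1kS_intro _ _ _ (fun t => F' t + G' t)); last exact: IH.
by move=> t Dt; have ? := dF t Dt; have ? := dG t Dt; exact: is_deriveD.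
Qed.

Lemma C1kM k D F G : C1k k D F -> C1k k D G -> C1k k D (fun t => F t * G t).
Proof.
elim: k F G => [|k IH] F G CF CG.
  by split=> // t Dt; apply: continuous_mulf; [exact: CF.1|exact: CG.1].
have [[cF [F' [dF CF']]] [cG [G' [dG CG']]]] := (CF, CG).
apply: (@C1kS_intro _ _ _ (fun t => F t * G' t + G t * F' t)).
  by move=> t Dt; have ? := dF t Dt; have ? := dG t Dt; exact: is_deriveM.
by apply: C1kD; apply: IH => //; exact: C1kW.
Qed.

Lemma C1k_cst k D c : C1k k D (fun=> c).
Proof.
elim: k c => [|k IH] c; first by split => // t _; exact: cst_continuous.
exact: (@C1kS_intro _ _ _ (fun=> 0)).
Qed.

Lemma C1k_id k D : C1k k D id.
Proof.
case: k => [|k]; first by split => // t _; exact: cvg_id.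
by apply: (@C1kS_intro _ _ _ (fun=> 1)) => //; exact: C1k_cst.
Qed.

Lemma C1k_expR k D : C1k k D expR.
Proof.
elim: k => [|k IH]; first by split => // t _; exact: continuous_expR.
exact: (@C1kS_intro _ _ _ expR).
Qed.

Lemma C1k_inv k : C1k k [set t | 0 < t] (fun t => t^-1).
Proof.
elim: k => [|k IH].
  by split => // t /= t0; apply: cvgV; rewrite ?gt_eqF //; exact: cvg_id.
apply: (@C1kS_intro _ _ _ (fun t => -1 * (t^-1 * t^-1))).
  move=> t /= t0; have t0' : id t != 0 by rewrite gt_eqF.
  have := @is_deriveV R id t 1 1 t0' _; rewrite /GRing.scale /= mulr1.
  by rewrite -exprVn expr2 mulN1r => h; exact: h.
by apply: C1kM; [exact: C1k_cst|exact: C1kM].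
Qed.

Lemma C1k_ln k : C1k k [set t | 0 < t] (@ln R).
Proof.
case: k => [|k].
  by split => // t /= t0; exact: (is_derive_continuous (is_derive1_ln t0)).
apply: (@C1kS_intro _ _ _ (fun t => t^-1)); last exact: C1k_inv.
Qed.

End smooth_functions.

(** * A smooth positive part *)

Section flat_functions.
Context (R : realType) (d : R) (d0 : 0 < d).

Lemma expR_ge_pow (p : nat) (y : R) : 0 < y -> (y / p.+1%:R) ^+ p.+1 <= expR y.
Proof.
move=> y0; have q0 : 0 <= y / p.+1%:R by rewrite divr_ge0 // ltW.
rewrite [X in _ <= expR X](_ : y = p.+1%:R * (y / p.+1%:R)) ?expRM_natl; last first.
  by rewrite mulrC divfK.
rewrite lerXn2r ?nnegrE ?expR_ge0 //.
by apply: le_trans (expR_ge1Dx _); rewrite lerDr.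
Qed.

(** The powers [t^-1 ^+ m] make the family closed under differentiation up to linear combinations,
    so smoothness at every order follows by induction. *)
Definition flat (m : nat) (t : R) : R :=
  if 0 < t then t^-1 ^+ m * expR (- (d / t)) else 0.

Lemma flat_le_sqr m : exists C, forall t, `|flat m t| <= C * t ^+ 2.
Proof.
(* The exponent [p.+1 = m + 2] cancels [t^-1 ^+ m] and leaves the [t ^+ 2] that makes the derivative
   at 0 vanish. *)
pose p := m.+1; exists ((p.+1%:R / d) ^+ p.+1) => t; rewrite /flat.
case: ifPn => t0; last by rewrite normr0 mulr_ge0 ?sqr_ge0 // exprn_ge0 // divr_ge0 // ltW.
rewrite ger0_norm ?mulr_ge0 ?expR_ge0 ?exprn_ge0 ?invr_ge0 ?(ltW t0) //.
have dt : 0 < d / t by rewrite divr_gt0.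
have h := expR_ge_pow p dt.
have h0 : 0 < (d / t / p.+1%:R) ^+ p.+1 by rewrite exprn_gt0 // divr_gt0.
rewrite expRN; apply: (@le_trans _ _ (t^-1 ^+ m * ((d / t / p.+1%:R) ^+ p.+1)^-1)).
  by rewrite ler_wpM2l ?exprn_ge0 ?invr_ge0 ?(ltW t0) // lef_pV2 // posrE ?expR_gt0.
rewrite le_eqVlt; apply/orP; left; apply/eqP.
rewrite -exprVn (_ : (d / t / p.+1%:R)^-1 = p.+1%:R / d * t); last first.
  by field; rewrite ?(gt_eqF t0) ?(gt_eqF d0) // nat1r pnatr_eq0.
rewrite exprMn mulrCA; congr (_ * _).
rewrite /p !exprS expr0 mulr1 exprVn.
have : t ^+ m != 0 by rewrite expf_neq0 // gt_eqF.
by move=> tm; field.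
Qed.

Lemma is_derive_quadratic (F : R -> R) (C : R) :
  (forall t, `|F t| <= C * t ^+ 2) -> is_derive (0 : R) 1 F 0.
Proof.
move=> FC; have F0 : F 0 = 0.
  by apply/eqP; rewrite -normr_le0; have := FC 0; rewrite expr0n /= mulr0.
have C0 : 0 <= C by have := le_trans (normr_ge0 _) (FC 1); rewrite expr1n mulr1.
have lim0 : (fun h : R => h^-1 *: ((F \o shift 0) (h *: 1) - F 0)) @ 0^' --> (0 : R).
  apply/cvgrPdist_lt => e e0.
  have dl : 0 < e / (C + 1) by rewrite divr_gt0 // ltr_wpDl.
  exists (e / (C + 1)) => //= h; rewrite /ball_ /= sub0r normrN => hd h0.
  rewrite sub0r normrN F0 subr0 /= /GRing.scale /= mulr1 addr0 normrM normfV.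
  rewrite mulrC ltr_pdivrMr ?normr_gt0 //.
  apply: le_lt_trans (FC h) _; rewrite -(real_normK (num_real h)) expr2 mulrA.
  rewrite ltr_pM2r ?normr_gt0 //.
  rewrite ltr_pdivlMr ?ltr_wpDl // in hd.
  have := normr_ge0 h; nra.
split; first by apply: (cvgP 0); exact: lim0.
by apply: (@cvg_lim _ _ _ _ _ _ _ lim0); exact: norm_hausdorff.
Qed.

Lemma is_derive_flat m (t : R) : is_derive t 1 (flat m)
  (- m%:R * flat m.+1 t + d * flat m.+2 t).
Proof.
have [t0|t0|t0] := ltrgt0P t.
- have tn0 : t != 0 by rewrite gt_eqF.
  pose X (s : R) := s^-1 ^+ m; pose E (s : R) := expR (- (d * s^-1)).
  apply: (@near_eq_is_derive _ _ _ (fun s => X s * E s)).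
    by near=> s; rewrite /flat ifT //; near: s; exact: lt_nbhsr.
  have dV : is_derive t 1 (fun s : R => s^-1) (- (t^-1 ^+ 2)).
    have := @is_deriveV R id t 1 1 tn0 _; rewrite /GRing.scale /= mulr1 exprVn; exact.
  have dX : is_derive t 1 X (m%:R * t^-1 ^+ m.-1 * - (t^-1 ^+ 2)).
    apply: (@is_derive_comp _ _ (fun u => u ^+ m) (fun s : R => s^-1)) => //.
    split; first exact: exprn_derivable.
    by rewrite exp_derive /GRing.scale /= mulr1.
  have dE : is_derive t 1 E (expR (- (d * t^-1)) * (d * t^-1 ^+ 2)).
    apply: (@is_derive_comp _ _ expR (fun s : R => - (d * s^-1))).
    have := @is_deriveN _ _ _ _ _ _ _ (is_deriveZ d dV).
    by rewrite /GRing.scale /= mulrN opprK.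
  have := is_deriveM dX dE; rewrite /X /E /GRing.scale /= => h.
  rewrite [X in is_derive _ _ _ X](_ : _ = t^-1 ^+ m * (expR (- (d / t)) * (d * t^-1 ^+ 2)) +
    expR (- (d / t)) * (m%:R * t^-1 ^+ m.-1 * - t^-1 ^+ 2)) //.
  rewrite /flat t0; case: (m) => [|k] /=; first by rewrite !expr0 !expr1 mul0r; ring.
  by rewrite !exprS; ring.
- apply: (@near_eq_is_derive _ _ _ (fun=> 0)).
    near=> s; rewrite /flat ifF //; apply/negbTE; rewrite -leNgt ltW //.
    by near: s; exact: lt_nbhsl.
  rewrite /flat ltNge (ltW t0) /= !mulr0 addr0; exact: is_derive_cst.
- have [C FC] := flat_le_sqr m; rewrite t0 /flat ltxx !mulr0 addr0.
  exact: is_derive_quadratic FC.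
Unshelve. all: by end_near. Qed.

Lemma C1k_flat k m : C1k k setT (flat m).
Proof.
elim: k m => [|k IH] m.
  by split => // t _; exact: (is_derive_continuous (is_derive_flat m t)).
apply: C1kS_intro => [t _|]; first exact: is_derive_flat.
by apply: C1kD; apply: C1kM => //; exact: C1k_cst.
Qed.

(* A smooth substitute for the positive part; its slope (1 + y) exp (- y), with
   y = d / t, is at most 1. *)
Definition soft (t : R) := t * flat 0 t.
Definition soft' (t : R) := flat 0 t + d * flat 1 t.

Lemma C1k_soft k : C1k k setT soft.
Proof. by apply: C1kM; [exact: C1k_id|exact: C1k_flat]. Qed.

Lemma soft_le0 t : t <= 0 -> soft t = 0.
Proof. by move=> t0; rewrite /soft /flat ltNge t0 mulr0. Qed.

Lemma soft'_le0 t : t <= 0 -> soft' t = 0.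
Proof. by move=> t0; rewrite /soft' /flat ltNge t0 /= mulr0 addr0. Qed.

Lemma is_derive_soft (t : R) : is_derive t 1 soft (soft' t).
Proof.
have df := is_derive_flat 0 t.
have := @is_deriveM R _ id (flat 0) t 1 1 _ _ df.
rewrite /GRing.scale /= mulr1 oppr0 mul0r add0r => h.
rewrite /soft' (_ : flat 0 t + d * flat 1 t = t * (d * flat 2 t) + flat 0 t); first exact: h.
rewrite addrC; congr (_ + _); rewrite /flat; case: ifP => [t0|]; rewrite ?mulr0 //.
by rewrite expr1 expr2; field; rewrite gt_eqF.
Qed.

Lemma flat0_itv t : 0 <= flat 0 t <= 1.
Proof.
rewrite /flat; case: ifPn => t0; last by rewrite lexx ler01.
by rewrite expr0 mul1r expR_ge0 -expR0 ler_expR oppr_le0 divr_ge0 // ltW.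
Qed.

Lemma soft'_eq t : 0 < t -> soft' t = flat 0 t * (1 + d / t).
Proof. by move=> t0; rewrite /soft' /flat t0 expr1 expr0; ring. Qed.

Lemma soft'_itv t : 0 <= soft' t <= 1.
Proof.
have [t0|t0] := leP t 0; first by rewrite soft'_le0 // lexx ler01.
have dt : 0 < d / t by rewrite divr_gt0.
rewrite soft'_eq //; apply/andP; split.
  by apply: mulr_ge0; [have /andP[] := flat0_itv t|lra].
rewrite /flat t0 expr0 mul1r expRN mulrC ler_pdivrMr ?expR_gt0 // mul1r.
exact: expR_ge1Dx.
Qed.

Lemma soft_le t : 0 <= t -> t - d <= soft t <= t.
Proof.
rewrite le_eqVlt => /predU1P[<-|t0]; first by rewrite soft_le0 // sub0r lexx oppr_le0 ltW.
apply/andP; split; last first.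
  by rewrite /soft ler_piMr ?(ltW t0) //; have /andP[] := flat0_itv t.
rewrite /soft /flat t0 expr0 mul1r.
have := expR_ge1Dx (- (d / t)); rewrite -(ler_pM2l t0) mulrDr mulr1 mulrN.
by rewrite mulrCA divff ?gt_eqF // mulr1.
Qed.

Lemma soft_ge0 t : 0 <= soft t.
Proof.
have [t0|t0] := leP t 0; first by rewrite soft_le0.
by apply: mulr_ge0; [exact: ltW|have /andP[] := flat0_itv t].
Qed.

(** With [y = d / t <= 1] the slope is at least [(1 + y) (1 - y) >= 1 - y]. It is thus guaranteed
    close to 1 only where [t] is large compared with [d], which is the origin of the boundary
    layer. *)
Lemma soft'_ge t : 0 < t -> 1 - soft' t <= d / t.
Proof.
move=> t0; have dt : 0 < d / t by rewrite divr_gt0.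
have /andP[s0 s1] := soft'_itv t.
have [dt1|dt1] := leP 1 (d / t); first lra.
have : 1 - d / t <= flat 0 t.
  by rewrite /flat t0 expr0 mul1r (le_trans _ (expR_ge1Dx _)).
rewrite soft'_eq //; nra.
Qed.

End flat_functions.

(** * Smooth approximation of support functions *)

Lemma is_derive_affine (R : realType) (V : normedModType R) (f : V -> R) x v (d : R) :
  (forall h, f (h *: v + x) = f x + h * d) -> is_derive x v f d.
Proof.
move=> fE.
have lim : (fun h : R => h^-1 *: ((f \o shift x) (h *: v) - f x)) @ 0^' --> d.
  apply: (@cvg_near_cst _ _ _ _ _ _); rewrite near_withinE; near=> h => h0 /=.
  by rewrite fE addrAC subrr add0r /GRing.scale /= mulrA mulVf // mul1r.
split; first by apply: (cvgP d); exact: lim.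
by apply: (@cvg_lim _ _ _ _ _ _ _ lim); exact: norm_hausdorff.
Unshelve. all: by end_near. Qed.

Section soft_max.
Context (R : realType) (n : nat).
Variables (s : seq 'rV[R]_n) (x0 : 'rV[R]_n) (sg : R).
Hypotheses (s0 : s != [::]) (sg0 : 0 < sg).
Implicit Types x y : 'rV[R]_n.

Let l (b : 'rV[R]_n) x := dotv b (x - x0).
Let w b x := expR (sg * l b x).
Let S x := \sum_(b <- s) w b x.

Definition softmax x := sg^-1 * ln (S x).
Definition softmax_grad x : 'rV[R]_n := \sum_(b <- s) (w b x / S x) *: b.

Let w_le_S b x : b \in s -> w b x <= S x.
Proof.
move=> bs; rewrite /S (big_rem b) //= lerDl sumr_ge0 // => a _; exact: expR_ge0.
Qed.

Let S_gt0 x : 0 < S x.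
Proof.
have [b bs] : exists b, b \in s by case: s s0 => // b ? _; exists b; rewrite mem_head.
by apply: lt_le_trans (w_le_S x bs); exact: expR_gt0.
Qed.

Let sum_w x : \sum_(b <- s) w b x / S x = 1.
Proof. by rewrite -mulr_suml divff // gt_eqF //; exact: S_gt0. Qed.

Let l_derive b x i : is_derive x (delta_mx 0 i) (l b) (b 0 i).
Proof.
apply: is_derive_affine => h; rewrite /l -addrA [in LHS]dotvDr dotvZr dotv_delta; exact: addrC.
Qed.

Let l_Ck k b : Ck_on k setT (l b).
Proof.
have cl : continuous (l b).
  apply: (@lipschitz_continuousW R _ _ _ (n%:R * `|b|)) => x y.
  rewrite /l -dotvBr opprB addrA subrK; exact: dotv_norm_le.
case: k => [|k]; first by split => // x _; exact: cl.
apply: (Ck_onS_intro cl); first by move=> i x; exact: l_derive.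
by move=> i; exact: Ck_on_cst.
Qed.

Lemma softmax_Ck k : Ck_on k setT softmax.
Proof.
apply: Ck_onM; first exact: Ck_on_cst.
apply: Ck_on_comp (C1k_ln R k) S_gt0 _; apply: Ck_on_sum => b.
apply: (@Ck_on_comp _ _ _ setT expR (fun x => sg * l b x)) => //; first exact: C1k_expR.
by apply: Ck_onM => //; exact: Ck_on_cst.
Qed.

Lemma softmax_derive x i :
  is_derive x (delta_mx 0 i) softmax (softmax_grad x 0 i).
Proof.
have dw b : is_derive x (delta_mx 0 i) (w b) (w b x * (sg * b 0 i)).
  apply: (@is_derive_comp _ _ expR (fun x => sg * l b x)).
  exact: (is_deriveZ sg (l_derive b x i)).
have dS := is_derive_sum_seq s dw.
have := is_deriveZ sg^-1 (@is_derive_comp _ _ (@ln R) S _ _ _ _ (is_derive1_ln (S_gt0 x)) dS).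
rewrite [X in is_derive _ _ _ X](_ : _ = softmax_grad x 0 i) //.
rewrite /softmax_grad summxE /GRing.scale /= !mulr_sumr; apply: eq_bigr => b _.
by rewrite mxE; field; rewrite !gt_eqF.
Qed.

Let dotv_grad x y : dotv (softmax_grad x) y = \sum_(b <- s) (w b x / S x) * dotv b y.
Proof.
rewrite /softmax_grad; elim: s => [|b t IH]; first by rewrite !big_nil dotv0l.
by rewrite !big_cons dotvDl dotvZl IH.
Qed.

Lemma softmax_grad_le x y c : (forall b, b \in s -> dotv b y <= c) ->
  dotv (softmax_grad x) y <= c.
Proof.
move=> h; rewrite dotv_grad -(mul1r c) -(sum_w x) mulr_suml big_seq [leRHS]big_seq.
apply: ler_sum => b bs; rewrite ler_wpM2l ?h //.
by rewrite divr_ge0 ?expR_ge0 // ltW.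
Qed.

Lemma softmax_ge b x : b \in s -> dotv b (x - x0) <= softmax x.
Proof.
move=> bs; rewrite /softmax mulrC ler_pdivlMr // -[leLHS]expRK mulrC ler_ln ?posrE ?expR_gt0 //.
exact: (w_le_S x bs).
Qed.

Lemma softmax_le x c : (forall b, b \in s -> dotv b (x - x0) <= c) ->
  softmax x <= c + (size s)%:R / sg.
Proof.
move=> h; rewrite /softmax mulrC ler_pdivrMr // mulrDl divfK ?gt_eqF //.
rewrite -[leRHS]expRK ler_ln ?posrE ?expR_gt0 //.
apply: (@le_trans _ _ (\sum_(b <- s) expR (sg * c))).
  by rewrite /S !big_seq; apply: ler_sum => b bs; rewrite ler_expR ler_pM2l // h.
rewrite big_const_seq count_predT iter_addr_0 addrC expRD (mulrC c) -[leLHS]mulr_natl.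
by rewrite ler_wpM2r ?expR_ge0 // (le_trans _ (expR_ge1Dx _)) // lerDr.
Qed.

(** Substitute for Euler's identity. If the value of [b] exceeds that of [a] by [u], the weight of
    [a] is at most [expR (- sg * u)], and [u * expR (- sg * u) <= sg^-1]: each term of the average
    loses at most [sg^-1]. *)
Lemma softmax_grad_ge b x : b \in s ->
  dotv b (x - x0) - (size s)%:R / sg <= dotv (softmax_grad x) (x - x0).
Proof.
move=> bs; rewrite dotv_grad lerBlDl -lerBlDr.
have -> : dotv b (x - x0) = \sum_(a <- s) w a x / S x * dotv b (x - x0).
  by rewrite -mulr_suml sum_w mul1r.
rewrite -sumrB.
apply: (@le_trans _ _ (\sum_(a <- s) sg^-1)); last first.
  by rewrite big_const_seq count_predT iter_addr_0 mulr_natl.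
apply: ler_sum => a _; rewrite -mulrBr -!/(l _ _).
have [ab|ab] := leP (l b x) (l a x).
  apply: (@le_trans _ _ 0); last by rewrite invr_ge0 ltW.
  by rewrite mulr_ge0_le0 ?subr_le0 // divr_ge0 ?expR_ge0 // ltW.
set u := l b x - l a x; have u0 : 0 < u by rewrite subr_gt0.
rewrite -(ler_pM2l sg0) divff ?gt_eqF // mulrCA mulrAC ler_pdivrMr // mul1r.
apply: le_trans (w_le_S x bs).
have -> : w b x = w a x * expR (sg * u).
  by rewrite /w -expRD /u; congr expR; ring.
by rewrite ler_wpM2l ?expR_ge0 // (le_trans _ (expR_ge1Dx _)) // lerDr.
Qed.

End soft_max.

Section approximation.
Context (R : realType) (n : nat).
Implicit Types (A : set 'rV[R]_n) (x : 'rV[R]_n).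

Lemma finite_net A e : bounded_set A -> 0 < e ->
  exists s : seq 'rV[R]_n, {in s, forall b, A b} /\
    forall a, A a -> exists2 b, b \in s & `|b - a| < e.
Proof.
move=> bA e0.
have : compact (closure A).
  by apply: bounded_closed_compact; [exact: closure_bounded|exact: closed_closure].
rewrite compact_cover => /(_ 'rV[R]_n A (fun b => ball b e)).
case=> [b _|x Ax|D DA AD]; first exact: ball_open.
  have [y Ay xy] := closure_rV_approx Ax e0.
  by exists y => //; apply/ballP_norm; rewrite distrC.
exists (finmap.enum_fset D); split => [b bD|a Aa]; first by have /set_mem := DA _ bD.
have [b bD /ballP_norm ba] := AD a (subset_closure Aa).
by exists b.
Qed.

(* [f] is a smooth approximation of the support function of [A] centred at
   [x0], and its gradient [G] takes its values in the closed convex hull of [A]. *)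
Definition smooth_support A (x0 : 'rV[R]_n) (eta : R) (f : 'rV[R]_n -> R)
    (G : 'rV[R]_n -> 'rV[R]_n) : Prop :=
  [/\ forall k, Ck_on k setT f,
      forall x i, is_derive x (delta_mx 0 i) f (G x 0 i),
      forall x y c, (forall a, A a -> dotv a y <= c) -> dotv (G x) y <= c,
      forall x, support_fun A (x - x0) - eta * `|x - x0| <= f x
                  <= support_fun A (x - x0) + eta &
      forall x, support_fun A (x - x0) - eta * (1 + `|x - x0|)
                  <= dotv (G x) (x - x0)].

(** The net comes first, with mesh [eta / (n + 1)] because [dotv] costs a factor [n] in the sup
    norm; the sharpness [sg] is chosen afterwards, from the size of the net. *)
Lemma smooth_support_exists A x0 eta : bounded_set A -> A !=set0 -> 0 < eta ->
  exists f G, smooth_support A x0 eta f G.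
Proof.
move=> bA A0 eta0.
have e0 : 0 < eta / (n%:R + 1) by rewrite divr_gt0 // ltr_wpDl.
have [s [sA As]] := finite_net bA e0.
have [a0 Aa0] := A0; have [b0 b0s _] := As a0 Aa0.
have s0 : s != [::] by case: s b0s {sA As}.
pose sg := ((size s)%:R + 1) / eta.
have sg0 : 0 < sg by rewrite divr_gt0 // ltr_wpDl.
have ssg : (size s)%:R / sg <= eta.
  rewrite /sg invf_div mulrA ler_pdivrMr ?ltr_wpDl //.
  by rewrite mulrC ler_pM2l // lerDl.
have net x c : (forall b, b \in s -> dotv b x <= c) ->
    support_fun A x - eta * `|x| <= c.
  move=> h; rewrite lerBlDr; apply: support_fun_le => // a Aa.
  have [b bs ba] := As a Aa.
  rewrite dotvC -(subrK b a) dotvDl addrC lerD ?h // (le_trans (ler_norm _)) //.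
  apply: le_trans (dotv_norm_le _ _) _; rewrite ler_wpM2r //.
  apply: (@le_trans _ _ ((n%:R + 1) * `|a - b|)); first by rewrite ler_wpM2r // lerDl.
  by rewrite -ler_pdivlMl ?ltr_wpDl // mulrC distrC ltW.
exists (softmax s x0 sg), (softmax_grad s x0 sg); split.
- exact: softmax_Ck.
- by move=> x i; exact: softmax_derive.
- by move=> x y c h; apply: softmax_grad_le => // b /sA; exact: h.
- move=> x; apply/andP; split.
    by apply: net => b bs; apply: softmax_ge.
  apply: (@le_trans _ _ (support_fun A (x - x0) + (size s)%:R / sg)); last by rewrite lerD2l.
  by apply: softmax_le => // b /sA Ab; rewrite dotvC le_support_fun.
- move=> x; have := net (x - x0) (dotv (softmax_grad s x0 sg x) (x - x0) + eta) _.
  rewrite mulrDr mulr1 => h; suff : support_fun A (x - x0) - eta * `|x - x0| <=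
      dotv (softmax_grad s x0 sg x) (x - x0) + eta by lra.
  apply: h => b bs; have := softmax_grad_ge x0 s0 sg0 x bs; lra.
Qed.

End approximation.

(** * Test functions and the divergence identity *)

Lemma continuous_addT (R : realType) (T : topologicalType) (f g : T -> R) :
  continuous f -> continuous g -> continuous (fun x => f x + g x).
Proof. by move=> cf cg x; apply: continuous_addf; [exact: cf|exact: cg]. Qed.

Lemma continuous_mulT (R : realType) (T : topologicalType) (f g : T -> R) :
  continuous f -> continuous g -> continuous (fun x => f x * g x).
Proof. by move=> cf cg x; apply: continuous_mulf; [exact: cf|exact: cg]. Qed.

Lemma integrable_add d (T : measurableType d) (R : realType)
    (mu : {measure set T -> \bar R}) (D : set T) (f g : T -> R) : measurable D ->
  mu.-integrable D (EFin \o f) -> mu.-integrable D (EFin \o g) ->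
  mu.-integrable D (EFin \o (fun x => f x + g x)).
Proof. by move=> mD f_ g_; have := integrableD mD f_ g_; exact: eq_integrable. Qed.

Lemma integrable_scale d (T : measurableType d) (R : realType)
    (mu : {measure set T -> \bar R}) (D : set T) (c : R) (f : T -> R) :
  measurable D -> mu.-integrable D (EFin \o f) ->
  mu.-integrable D (EFin \o (fun x => c * f x)).
Proof. by move=> mD f_; have := integrableZl mD c f_; exact: eq_integrable. Qed.

Section test_functions.
Context (R : realType) (n : nat) (Omega : set 'rV[R]_n).
Hypotheses (oO : open Omega) (bO : bounded_set Omega).
Let mu := @lebesgue_rV R n.
Implicit Types (phi u : 'rV[R]_n -> R) (g : 'rV[R]_n -> 'rV[R]_n).

Let mO : measurable Omega := rV_open_measurable oO.

Lemma test_fun_Ck phi k : test_fun Omega phi -> Ck_on k setT phi.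
Proof. by case. Qed.

Lemma test_fun_out phi x : test_fun Omega phi -> ~ Omega x -> phi x = 0.
Proof.
move=> [_ _ sO] Ox; apply: contrapT => /eqP px; apply/Ox/sO; exact: subset_closure.
Qed.

Lemma test_fun_partial_out phi i x : test_fun Omega phi -> ~ Omega x ->
  partial i phi x = 0.
Proof.
move=> [_ _ sO] Ox; have /closed_openC : closed (closure [set x | phi x != 0]).
  exact: closed_closure.
move=> oC; have Cx : (~` closure [set x | phi x != 0]) x by move=> /sO.
have nx : \near x, (fun=> 0) x = phi x.
  have : nbhs x (~` closure [set x | phi x != 0]) by apply: open_nbhs_nbhs.
  apply: filterS => y Cy; apply/esym/eqP/negPn/negP => py; apply: Cy.
  exact: subset_closure.
have d0 : is_derive x (delta_mx 0 i) (fun _ : 'rV[R]_n => 0 : R) 0 by exact: is_derive_cst.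
by have [_] := near_eq_is_derive nx d0.
Qed.

Lemma integral_by_parts phi (h : 'rV[R]_n -> R) i : test_fun Omega phi ->
  Ck_on 1 setT h ->
  \int[mu]_(x in Omega) (h x * partial i phi x) =
  - \int[mu]_(x in Omega) (partial i h x * phi x).
Proof.
move=> tphi Ch; have C1 := test_fun_Ck 1 tphi.
have cphi := Ck_on_continuous C1; have ch := Ck_on_continuous Ch.
have cdphi := Ck_on_continuous (Ck_onS_partial i C1).
have cdh := Ck_on_continuous (Ck_onS_partial i Ch).
pose df x := h x * partial i phi x + phi x * partial i h x.
have cdf : continuous df.
  by apply: continuous_addT; apply: continuous_mulT.
have [M M0 OM] := bounded_rV_le bO.
have out x : M < `|x| -> ~ Omega x by move=> Mx /OM; rewrite leNgt Mx.
have I0 : (\int[mu]_x (df x)%:E = 0)%E.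
  apply: (@integral_partial_compact _ _ i (fun x => h x * phi x) _ M) => //.
  - move=> x; have ? := Ck_onS_is_derive i x Ch; have ? := Ck_onS_is_derive i x C1.
    exact: is_deriveM.
  - by move=> x /out Ox; rewrite (test_fun_out tphi) // mulr0.
  - move=> x /out Ox; rewrite /df (test_fun_out tphi) //.
    by rewrite (test_fun_partial_out i tphi) // mulr0 mul0r addr0.
have : \int[mu]_(x in Omega) df x = 0.
  rewrite Rintegral_mkcond (_ : df \_ Omega = df); first by rewrite /Rintegral I0.
  apply/funext => x; rewrite /patch; case: ifPn => // /negP Ox.
  have {}Ox : ~ Omega x by move=> ?; apply: Ox; rewrite inE.
  by rewrite /df (test_fun_out tphi) // (test_fun_partial_out i tphi) // mulr0 mul0r addr0.
rewrite RintegralD //; last 2 first.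
- by apply: continuous_integrable => //; apply: continuous_mulT.
- by apply: continuous_integrable => //; apply: continuous_mulT.
move=> /eqP; rewrite addr_eq0 => /eqP ->; congr (- _).
by apply: eq_Rintegral => x _; rewrite mulrC.
Qed.

Definition grad phi : 'rV[R]_n -> 'rV[R]_n := fun x => \row_i partial i phi x.

Lemma gradE phi x i : grad phi x 0 i = partial i phi x.
Proof. by rewrite mxE. Qed.

Lemma continuous_L2 (f : 'rV[R]_n -> R) : continuous f -> L2_on Omega f.
Proof.
move=> cf; split; first by apply: measurable_funTS; exact: continuous_rV_measurable.
have : mu.-integrable Omega (EFin \o (fun x => f x ^+ 2)).
  apply: continuous_integrable => //; under eq_fun do rewrite expr2.
  exact: continuous_mulT.
move=> /integrableP[_]; under eq_integral do rewrite /= ger0_norm ?sqr_ge0 //.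
by [].
Qed.

Lemma W12_0_test phi : test_fun Omega phi -> W12_0 Omega phi (grad phi).
Proof.
move=> tphi; have C1 := test_fun_Ck 1 tphi; split; first split.
- exact/continuous_L2/(Ck_on_continuous C1).
- move=> i; under eq_fun do rewrite gradE.
  exact/continuous_L2/(Ck_on_continuous (Ck_onS_partial i C1)).
- move=> psi tpsi i; rewrite (integral_by_parts i tpsi C1); congr (- _).
  by apply: eq_Rintegral => x _; rewrite gradE.
- exists (fun=> phi); split => //.
  rewrite [X in X @ _ --> _](_ : _ = fun=> 0%E); first exact: cvg_cst.
  apply/funext => k; apply: integral0_eq => x _.
  rewrite subrr expr0n /= add0r big1 // => i _.
  by rewrite gradE subrr expr0n.
Qed.

Lemma L2_sqr_integrable (f : 'rV[R]_n -> R) : L2_on Omega f ->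
  mu.-integrable Omega (EFin \o (fun x => f x ^+ 2)).
Proof.
move=> [mf foo]; apply/integrableP; split.
  by apply/measurable_EFinP; exact: measurable_funX.
by under eq_integral do rewrite /= ger0_norm ?sqr_ge0 //.
Qed.

Lemma cst_integrable (c : R) : mu.-integrable Omega (EFin \o cst c).
Proof. by apply: continuous_integrable => // x; exact: cst_continuous. Qed.

Lemma mul_cont_L2_integrable (h f : 'rV[R]_n -> R) : continuous h -> L2_on Omega f ->
  mu.-integrable Omega (EFin \o (fun x => h x * f x)).
Proof.
move=> ch Lf; apply: (@le_integrable _ _ _ _ _ mO _
    (EFin \o (fun x => h x ^+ 2 + f x ^+ 2))) => //.
- apply/measurable_EFinP; apply: measurable_funM; last by case: Lf.
  by apply: measurable_funTS; exact: continuous_rV_measurable.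
- move=> x Ox /=; rewrite lee_fin [leRHS]ger0_norm ?addr_ge0 ?sqr_ge0 //.
  by rewrite ler_norml; apply/andP; split; nra.
- by apply: integrable_add => //; apply: L2_sqr_integrable => //; exact: continuous_L2.
Qed.

Lemma L2_integrable (f : 'rV[R]_n -> R) : L2_on Omega f ->
  mu.-integrable Omega (EFin \o f).
Proof.
move=> Lf; have c1 : continuous (fun _ : 'rV[R]_n => (1 : R)) by move=> x; exact: cst_continuous.
have := mul_cont_L2_integrable c1 Lf; apply: eq_integrable => // x _ /=.
by rewrite mul1r.
Qed.

Lemma L2B (f h : 'rV[R]_n -> R) : L2_on Omega f -> L2_on Omega h ->
  L2_on Omega (fun x => f x - h x).
Proof.
move=> Lf Lh; split; first by apply: measurable_funB; [case: Lf|case: Lh].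
have : mu.-integrable Omega (EFin \o (fun x => (f x - h x) ^+ 2)).
  apply: (@le_integrable _ _ _ _ _ mO _
    (EFin \o (fun x => 2 * f x ^+ 2 + 2 * h x ^+ 2))) => //.
  - apply/measurable_EFinP; apply: measurable_funX.
    by apply: measurable_funB; [case: Lf|case: Lh].
  - move=> x Ox /=; rewrite lee_fin ger0_norm ?sqr_ge0 //.
    have := sqr_ge0 (f x); have := sqr_ge0 (h x); have := sqr_ge0 (f x + h x).
    by move=> *; rewrite ger0_norm; nra.
  - by apply: integrable_add => //; apply: integrable_scale => //; exact: L2_sqr_integrable.
by move=> /integrableP[_]; under eq_integral do rewrite /= ger0_norm ?sqr_ge0 //.
Qed.

End test_functions.

Lemma integrable_sum_fun d (T : measurableType d) (R : realType)
    (mu : {measure set T -> \bar R}) (D : set T) (I : Type) (s : seq I)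
    (F : I -> T -> R) : measurable D ->
  (forall i, mu.-integrable D (EFin \o F i)) ->
  mu.-integrable D (EFin \o (fun x => \sum_(i <- s) F i x)).
Proof.
move=> mD iF; elim: s => [|i s IH].
  by under eq_fun do rewrite big_nil; apply: eq_integrable (integrable0 mu D).
by under eq_fun do rewrite big_cons; exact: integrable_add.
Qed.

Lemma Rintegral_sum_fun d (T : measurableType d) (R : realType)
    (mu : {measure set T -> \bar R}) (D : set T) (I : Type) (s : seq I)
    (F : I -> T -> R) : measurable D ->
  (forall i, mu.-integrable D (EFin \o F i)) ->
  \int[mu]_(x in D) (\sum_(i <- s) F i x) = \sum_(i <- s) \int[mu]_(x in D) F i x.
Proof.
move=> mD iF; elim: s => [|i s IH].
  by rewrite big_nil; under eq_Rintegral do rewrite big_nil; rewrite Rintegral_cst // mul0r.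
under eq_Rintegral do rewrite big_cons.
by rewrite RintegralD // ?big_cons ?IH //; exact: integrable_sum_fun.
Qed.

Section divergence_identity.
Context (R : realType) (n : nat) (Omega : set 'rV[R]_n) (x0 : 'rV[R]_n).
Hypotheses (oO : open Omega) (bO : bounded_set Omega).
Let mu := @lebesgue_rV R n.
Implicit Types (phi u : 'rV[R]_n -> R) (g : 'rV[R]_n -> 'rV[R]_n).

Let mO : measurable Omega := rV_open_measurable oO.
Let z i (x : 'rV[R]_n) := (x - x0) 0 i.

Let z_derive i j x : is_derive x (delta_mx 0 j) (z i) (i == j)%:R.
Proof. by apply: is_derive_affine => h; rewrite /z !mxE /=; ring. Qed.

Let z_continuous i : continuous (z i).
Proof.
apply: (@lipschitz_continuousW R _ _ _ 1) => x y; rewrite mul1r.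
by rewrite (_ : _ - _ = (x - y) 0 i) ?le_coord_norm // /z !mxE; ring.
Qed.

Let z_Ck i : Ck_on 1 setT (z i).
Proof.
apply: (Ck_onS_intro (z_continuous (i:=i)) (fun j x => z_derive i j x)) => j.
exact: Ck_on_cst.
Qed.

Lemma dotv_coord (a x : 'rV[R]_n) : dotv a (x - x0) = \sum_i z i x * a 0 i.
Proof. by apply: eq_bigr => i _; rewrite mulrC. Qed.

Lemma integral_grad_test phi : test_fun Omega phi ->
  \int[mu]_(x in Omega) dotv (grad phi x) (x - x0) =
  - (n%:R * \int[mu]_(x in Omega) phi x).
Proof.
move=> tphi; have C1 := test_fun_Ck 1 tphi.
under eq_Rintegral do rewrite dotv_coord.
rewrite Rintegral_sum_fun //; last first.
  move=> i; apply: continuous_integrable => //; apply: continuous_mulT => //.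
  under eq_fun do rewrite gradE; exact: (Ck_on_continuous (Ck_onS_partial i C1)).
rewrite (eq_bigr (fun=> - \int[mu]_(x in Omega) phi x)).
  by rewrite sumr_const card_ord mulNrn mulr_natl.
move=> i _; under eq_Rintegral do rewrite gradE.
rewrite (integral_by_parts oO bO i tphi (z_Ck i)); congr (- _).
apply: eq_Rintegral => x _.
by rewrite /partial (@derive_val _ _ _ _ _ _ _ (z_derive i i x)) eqxx mul1r.
Qed.

(** The difference [L] of the two sides is linear in the pair [(u, g)], vanishes on test functions,
    and is continuous for the norm of W^{1,2} because [x - x0] is bounded on [Omega]. *)
Lemma W12_0_divergence u g : W12_0 Omega u g ->
  \int[mu]_(x in Omega) dotv (g x) (x - x0) = - (n%:R * \int[mu]_(x in Omega) u x).
Proof.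
move=> [[Lu Lg _] [phi [tphi q0]]].
have [M M0 zM] : exists2 M, 0 < M & forall i x, Omega x -> `|z i x| <= M.
  have [M M0 OM] := bounded_rV_le bO; exists (M + `|x0|); first by rewrite ltr_pwDl.
  move=> i x Ox; apply: le_trans (le_coord_norm _ _) _.
  by apply: le_trans (ler_normB _ _) _; rewrite lerD2r OM.
pose V := fine (mu Omega).
have V0 : 0 <= V by rewrite fine_ge0.
pose C := n%:R + M; have C0 : 0 < C by rewrite ltr_wpDl.
pose L := n%:R * \int[mu]_(x in Omega) u x + \int[mu]_(x in Omega) dotv (g x) (x - x0).
suff L0 : L = 0 by apply/eqP; rewrite -subr_eq0 opprK addrC; apply/eqP.
suff h s : 0 < s -> `|L| <= C * ((n%:R + 1) * V + 1) * s.
  apply/eqP; rewrite -normr_le0 leNgt; apply/negP => L0.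
  have D0 : 0 < C * ((n%:R + 1) * V + 1).
    by rewrite mulr_gt0 // ltr_wpDl // mulr_ge0 // addr_ge0.
  have := h (`|L| / (C * ((n%:R + 1) * V + 1)) / 2) _.
  rewrite !divr_gt0 // => /(_ isT); rewrite mulrA mulrCA divff ?gt_eqF // mulr1.
  by move: L0; lra.
move=> s0.
have [k qk] : exists k, (\int[mu]_(x in Omega) ((u x - phi k x) ^+ 2 +
    \sum_(i < n) (g x 0 i - partial i (phi k) x) ^+ 2)%:E < (s ^+ 2)%:E)%E.
  have /fine_cvgP[fin /cvgrPdist_lt q1] := q0.
  have s2 : 0 < s ^+ 2 by rewrite exprn_gt0.
  have [k _ /(_ k (leqnn k))[kf kq]] := filterI fin (q1 _ s2); exists k.
  rewrite -(fineK kf) lte_fin; move: kq; rewrite sub0r normrN /=.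
  by apply: le_lt_trans; exact: ler_norm.
have tk := tphi k; have C1 := test_fun_Ck 1 tk.
have Lphi : L2_on Omega (phi k) by apply: continuous_L2 => //; exact: (Ck_on_continuous C1).
have Lpar i : L2_on Omega (fun x => partial i (phi k) x).
  by apply: continuous_L2 => //; exact: (Ck_on_continuous (Ck_onS_partial i C1)).
pose e0 x := u x - phi k x; pose e i x := g x 0 i - partial i (phi k) x.
have Le0 : L2_on Omega e0 by exact: L2B.
have Le i : L2_on Omega (e i) by exact: L2B.
pose Q x := e0 x ^+ 2 + \sum_(i < n) e i x ^+ 2.
have iQ : mu.-integrable Omega (EFin \o Q).
  apply: integrable_add => //; first exact: L2_sqr_integrable.
  by apply: integrable_sum_fun => // i; exact: L2_sqr_integrable.
have Qs : \int[mu]_(x in Omega) Q x <= s ^+ 2.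
  rewrite -lee_fin /Rintegral fineK; first exact: ltW.
  exact: integrable_fin_num.
pose a x := n%:R * e0 x + \sum_(i < n) z i x * e i x.
have ize i : mu.-integrable Omega (EFin \o (fun x => z i x * e i x)).
  by apply: mul_cont_L2_integrable.
have ie0 : mu.-integrable Omega (EFin \o e0) by exact: L2_integrable.
have ia : mu.-integrable Omega (EFin \o a).
  apply: integrable_add => //; first exact: integrable_scale.
  exact: integrable_sum_fun.
have aL : \int[mu]_(x in Omega) a x = L.
  rewrite RintegralD //; last 2 first.
  - exact: integrable_scale.
  - exact: integrable_sum_fun.
  rewrite RintegralZl // RintegralB //; last 2 first.
  - exact: L2_integrable.
  - exact: L2_integrable.
  have iz f : L2_on Omega f -> forall i, mu.-integrable Omega (EFin \o (fun x => z i x * f x)).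
    by move=> Lf i; apply: mul_cont_L2_integrable.
  have -> : \int[mu]_(x in Omega) (\sum_(i < n) z i x * e i x) =
      \int[mu]_(x in Omega) dotv (g x) (x - x0) -
      \int[mu]_(x in Omega) dotv (grad (phi k) x) (x - x0).
    rewrite -RintegralB //; last 2 first.
    - under eq_fun do rewrite dotv_coord; apply: integrable_sum_fun => // i; exact: iz.
    - under eq_fun do rewrite dotv_coord; apply: integrable_sum_fun => // i.
      by under eq_fun do rewrite gradE; exact: iz.
    apply: eq_Rintegral => x _; rewrite !dotv_coord -sumrB; apply: eq_bigr => i _.
    by rewrite /e gradE mulrBr.
  by rewrite integral_grad_test // /L; ring.
have ab x : Omega x -> `|a x| <= C * ((n%:R + 1) * s + s^-1 * Q x).
  (* Stands in for the Cauchy-Schwarz inequality: as [s ^+ 2] bounds the integral of [Q], both terms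
     integrate to at most a multiple of [s]. *)
  move=> Ox; have amgm t : `|t| <= s + s^-1 * t ^+ 2.
    rewrite -(ler_pM2l s0) mulrDr mulrA divff ?gt_eqF // mul1r -(real_normK (num_real t)).
    have := sqr_ge0 (`|t| - s); have := normr_ge0 t; nra.
  apply: (@le_trans _ _ (C * `|e0 x| + \sum_(i < n) C * `|e i x|)).
    apply: le_trans (ler_normD _ _) _; apply: lerD.
      by rewrite normrM normr_nat ler_wpM2r // lerDl ltW.
    apply: le_trans (ler_norm_sum _ _ _) _; apply: ler_sum => i _.
    by rewrite normrM ler_wpM2r // (le_trans (zM _ _ Ox)) // lerDr.
  rewrite -mulr_sumr -mulrDr ler_wpM2l ?(ltW C0) //.
  apply: (@le_trans _ _ (s + s^-1 * e0 x ^+ 2 + \sum_(i < n) (s + s^-1 * e i x ^+ 2))).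
    by apply: lerD => //; apply: ler_sum.
  rewrite big_split /= sumr_const card_ord -mulr_sumr /Q -mulr_natl.
  by rewrite le_eqVlt; apply/orP; left; apply/eqP; ring.
have ic (c : R) : mu.-integrable Omega (EFin \o cst c) by exact: cst_integrable.
have iS : mu.-integrable Omega (EFin \o (fun x => (n%:R + 1) * s + s^-1 * Q x)).
  exact: (integrable_add mO (ic _) (integrable_scale s^-1 mO iQ)).
rewrite -aL; apply: le_trans (le_normr_Rintegral mO ia) _.
apply: (@le_trans _ _ (\int[mu]_(x in Omega) (C * ((n%:R + 1) * s + s^-1 * Q x)))).
  apply: le_Rintegral => //.
  - exact: integrable_norm.
  - exact: (integrable_scale C mO iS).
rewrite RintegralZl //.
rewrite RintegralD //; [|exact: ic|exact: integrable_scale].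
rewrite Rintegral_cst // RintegralZl // -/V -mulrA ler_wpM2l ?(ltW C0) //.
rewrite [leRHS]mulrDl mul1r mulrAC lerD2l.
by rewrite ler_pdivrMl // -expr2.
Qed.

End divergence_identity.

(** * Upper bound for the torsional rigidity *)

(** The optimal choice is [t = X / A]. Since [A] may vanish, [A + d] is used instead, and
    [d = e / (B + 1)] keeps the extra term [d * B] below [e]. *)
Lemma sqr_le_mul_of_amgm (R : realFieldType) (X A B : R) : 0 <= A -> 0 <= B ->
  (forall t, 0 < t -> 2 * X <= t * A + t^-1 * B) -> 0 <= X -> X ^+ 2 <= A * B.
Proof.
move=> A0 B0 h; rewrite le_eqVlt => /predU1P[<-|X0].
  by rewrite expr0n /= mulr_ge0.
apply/ler_addgt0Pr => e e0.
have B1 : 0 < B + 1 by rewrite ltr_wpDl.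
pose d := e / (B + 1); have d0 : 0 < d by rewrite divr_gt0.
have Ad : 0 < A + d by rewrite ltr_wpDl.
have := h (X / (A + d)); rewrite divr_gt0 // invf_div => /(_ isT) h1.
have h2 : X / (A + d) * A <= X.
  by rewrite mulrAC ler_pdivrMr // ler_pM2l // lerDl ltW.
have h3 : X <= (A + d) / X * B by lra.
have h4 : X ^+ 2 <= (A + d) * B.
  by rewrite expr2; move: h3; rewrite mulrAC ler_pdivlMr.
apply: (le_trans h4); rewrite mulrDl lerD2l /d mulrAC ler_pdivrMr //.
by rewrite ler_pM2l // lerDl.
Qed.

Section torsion_upper_bound.
Context (R : realType) (n : nat) (Omega K : set 'rV[R]_n) (x0 : 'rV[R]_n) (r : R).
Hypotheses (oO : open Omega) (bO : bounded_set Omega).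
Hypotheses (r0 : 0 < r) (rK : ball 0 r `<=` K) (bK : bounded_set K).
Hypothesis sK : origin_symmetric K.
Let mu := @lebesgue_rV R n.
Implicit Types (phi u : 'rV[R]_n -> R) (g : 'rV[R]_n -> 'rV[R]_n).

Let mO : measurable Omega := rV_open_measurable oO.
Let k0 (x : 'rV[R]_n) := support_fun (polar K) (x - x0).

Let K0 : K !=set0. Proof. by exists 0; apply: rK; exact: ballxx. Qed.

Lemma support_shift_continuous (A : set 'rV[R]_n) (y0 : 'rV[R]_n) :
  bounded_set A -> A !=set0 -> continuous (fun x : 'rV[R]_n => support_fun A (x - y0)).
Proof.
move=> /bounded_rV_le[M M0 AM] A0.
apply: (@lipschitz_continuousW R _ _ _ (n%:R * M)) => x y.
apply: le_trans (support_fun_lipschitz _ _ A0 AM) _.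
by rewrite opprB addrA subrK.
Qed.

Let k0_continuous : continuous k0.
Proof. by apply: support_shift_continuous; [exact: polar_bounded rK|exact: polar_neq0]. Qed.

Lemma measurable_comp_coord (F : 'rV[R]_n -> R) g : continuous F ->
  (forall i, measurable_fun Omega (fun x => g x 0 i)) ->
  measurable_fun Omega (fun x => F (g x)).
Proof.
(* [measurable_fun_rV] speaks of maps defined on the whole space, so [g] is extended by 0 outside
   [Omega]. *)
move=> cF mg; pose g' x : 'rV[R]_n := if x \in Omega then g x else 0.
have mg' : measurable_fun setT g'.
  apply: measurable_fun_rV => i.
  have := (measurable_restrictT _ mO).1 (mg i).
  rewrite (_ : _ \_ Omega = (fun x => g' x 0 i)) //.
  by apply/funext => x; rewrite /patch /g'; case: ifP => // _; rewrite mxE.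
apply: (@eq_measurable_fun _ _ _ _ _ (F \o g')).
  by move=> x xO /=; rewrite /g' xO.
apply: measurable_funTS; apply: measurableT_comp mg'; exact: continuous_rV_measurable.
Qed.

Lemma support_fun_L2 g : (forall i, L2_on Omega (fun x => g x 0 i)) ->
  L2_on Omega (fun x => support_fun K (g x)).
Proof.
move=> Lg; have cK := support_fun_continuous bK K0.
have mK : measurable_fun Omega (fun x => support_fun K (g x)).
  by apply: measurable_comp_coord => // i; case: (Lg i).
have [M M0 KM] := bounded_rV_le bK.
split => //; have : mu.-integrable Omega (EFin \o (fun x => support_fun K (g x) ^+ 2)).
  apply: (@le_integrable _ _ _ _ _ mO _
    (EFin \o (fun x => (n%:R * M) ^+ 2 * \sum_(i < n) (g x 0 i) ^+ 2))) => //.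
  - by apply/measurable_EFinP; exact: measurable_funX.
  - move=> x Ox; rewrite lee_fin ger0_norm ?sqr_ge0 // ger0_norm; last first.
      by rewrite mulr_ge0 ?sqr_ge0 // sumr_ge0 // => i _; exact: sqr_ge0.
    have hle : `|support_fun K (g x)| <= n%:R * M * `|g x|.
      have := support_fun_lipschitz (g x) 0 K0 KM.
      by rewrite support_fun0 // !subr0.
    have gle : `|g x| ^+ 2 <= \sum_(i < n) (g x 0 i) ^+ 2.
      have S0 : 0 <= \sum_(i < n) (g x 0 i) ^+ 2 by apply: sumr_ge0 => i _; exact: sqr_ge0.
      rewrite -[leRHS]sqr_sqrtr // lerXn2r ?nnegrE ?sqrtr_ge0 //.
      apply: rV_norm_le => [|i]; first exact: sqrtr_ge0.
      rewrite -sqrtr_sqr ler_wsqrtr // (bigD1 i) //= lerDl.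
      by apply: sumr_ge0 => j _; exact: sqr_ge0.
    rewrite -(real_normK (num_real (support_fun K (g x)))).
    apply: (@le_trans _ _ ((n%:R * M * `|g x|) ^+ 2)).
      by rewrite lerXn2r ?nnegrE ?mulr_ge0 // ltW.
    by rewrite exprMn ler_wpM2l ?sqr_ge0.
  - apply: integrable_scale => //; apply: integrable_sum_fun => // i.
    exact: L2_sqr_integrable.
move=> /integrableP[_]; under eq_integral do rewrite /= ger0_norm ?sqr_ge0 //.
by [].
Qed.

Lemma W12_0_energy_bound u g : W12_0 Omega u g ->
  (n%:R * \int[mu]_(x in Omega) u x) ^+ 2 <=
  (\int[mu]_(x in Omega) k0 x ^+ 2) *
  \int[mu]_(x in Omega) support_fun K (g x) ^+ 2.
Proof.
move=> Wu; have [[Lu Lg _] _] := Wu.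
have LK := support_fun_L2 Lg.
have Lk0 : L2_on Omega k0 by exact: continuous_L2.
have [ik0 iK] := (L2_sqr_integrable Lk0, L2_sqr_integrable LK).
have idot : mu.-integrable Omega (EFin \o (fun x => dotv (g x) (x - x0))).
  under eq_fun do rewrite dotv_coord; apply: integrable_sum_fun => // i.
  apply: mul_cont_L2_integrable => //.
  apply: (@lipschitz_continuousW R _ _ _ 1) => x y; rewrite mul1r.
  by rewrite (_ : _ - _ = (x - y) 0 i) ?le_coord_norm // !mxE; ring.
rewrite -(real_normK (num_real (n%:R * _))).
apply: sqr_le_mul_of_amgm => //.
- by apply: Rintegral_ge0 => x _; exact: sqr_ge0.
- by apply: Rintegral_ge0 => x _; exact: sqr_ge0.
move=> t t0.
rewrite -normrN -(W12_0_divergence x0 oO bO Wu).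
rewrite -!RintegralZl // -RintegralD //; last 2 first.
- exact: integrable_scale.
- exact: integrable_scale.
apply: (@le_trans _ _ (2 * \int[mu]_(x in Omega) `|dotv (g x) (x - x0)|)).
  by rewrite ler_pM2l // le_normr_Rintegral.
rewrite -RintegralZl //; last exact: integrable_norm.
apply: le_Rintegral => //.
- by apply: integrable_scale => //; exact: integrable_norm.
- by apply: integrable_add => //; exact: integrable_scale.
move=> x Ox; have bp := polar_bounded r0 rK.
have h : `|dotv (g x) (x - x0)| <= k0 x * support_fun K (g x).
  rewrite dotvC ler_norml; apply/andP; split; last exact: (@dotv_le_polar _ _ K r).
  rewrite lerNl -dotvNr -(support_funN (g x) sK); exact: (@dotv_le_polar _ _ K r).
have h2 : 2 * (k0 x * support_fun K (g x)) <=
    t * k0 x ^+ 2 + t^-1 * support_fun K (g x) ^+ 2.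
  rewrite -(ler_pM2l t0) [leRHS]mulrDr (mulrA t t^-1) divff ?gt_eqF // mul1r.
  by have := sqr_ge0 (t * k0 x - support_fun K (g x)); nra.
by apply: le_trans h2; rewrite ler_pM2l.
Qed.

End torsion_upper_bound.

(** * Trial functions *)

Section cutoff.
Context (R : realType) (n : nat) (Omega A B : set 'rV[R]_n) (x0 : 'rV[R]_n).
Variables (c M : R).
Hypotheses (oO : open Omega) (bO : bounded_set Omega).
Hypotheses (bA : bounded_set A) (bB : bounded_set B) (A0 : A 0) (AB : A `<=` B).
Let j (x : 'rV[R]_n) := support_fun A (x - x0).
Let k (x : 'rV[R]_n) := support_fun B (x - x0).
Hypothesis Oj : forall x, Omega x <-> j x < 1.
Hypotheses (c0 : 0 < c) (jge : forall x, c * `|x - x0| <= j x).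
Hypotheses (M1 : 1 <= M) (OM : forall x, Omega x -> `|x - x0| <= M /\ k x <= M).

Variables (e : R).
Hypotheses (e0 : 0 < e) (e2 : e <= 2^-1).
(** The first bound gives [eta * |x - x0| <= (e / 2) * j x] at every point, also far from [Omega],
    and serves for the support of the cut-off; the second makes all approximation errors at most [e]
    on [Omega]. *)
Let eta := Num.min (c * e / 2) (e / (1 + M)).
Variables (f F : 'rV[R]_n -> R) (G H : 'rV[R]_n -> 'rV[R]_n).
Hypotheses (fG : smooth_support A x0 eta f G) (FH : smooth_support B x0 eta F H).
Variables (al be ga : R).

Let t x := 1 - e - f x.
Let P x := al + be * f x + ga * F x.

(* A test function close to (1 - j) (al + be * j + ga * k); [f] and [F] are smooth
   approximations of the gauges [j] and [k]. *)
Definition cutoff x := soft e (t x) * P x.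

Let eta0 : 0 < eta.
Proof.
rewrite lt_min !divr_gt0 ?mulr_gt0 //; have := M1; lra.
Qed.

Let eta_c : eta <= c * e / 2. Proof. by rewrite ge_min lexx. Qed.

Let eta_M : eta * (1 + M) <= e.
Proof.
have M10 : 0 < 1 + M by have := M1; lra.
by rewrite -ler_pdivlMr // ge_min lexx orbT.
Qed.

Lemma cutoff_Ck q : Ck_on q setT cutoff.
Proof.
have [Cf _ _ _ _] := fG; have [CF _ _ _ _] := FH.
apply: Ck_onM.
  apply: (@Ck_on_comp _ _ _ setT (soft e) t) => //; first exact: C1k_soft.
  apply: Ck_onD; first exact: Ck_on_cst.
  have -> : (fun x => - f x) = (fun x => -1 * f x) by apply/funext => x; rewrite mulN1r.
  by apply: Ck_onM => //; exact: Ck_on_cst.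
apply: Ck_onD; last by apply: Ck_onM => //; exact: Ck_on_cst.
apply: Ck_onD; first exact: Ck_on_cst.
by apply: Ck_onM => //; exact: Ck_on_cst.
Qed.

Lemma cutoff_grad x : grad cutoff x =
  (soft e (t x) * be - soft' e (t x) * P x) *: G x + (soft e (t x) * ga) *: H x.
Proof.
have [_ df _ _ _] := fG; have [_ dF _ _ _] := FH.
apply/rowP => i; rewrite gradE.
have dt : is_derive x (delta_mx 0 i) t (- G x 0 i).
  have := is_deriveB (is_derive_cst (1 - e : R) x (delta_mx 0 i)) (df x i).
  by rewrite sub0r.
have ds := @is_derive_comp _ _ (soft e) t x _ _ _ (is_derive_soft e0 (t x)) dt.
have dP : is_derive x (delta_mx 0 i) P (be * G x 0 i + ga * H x 0 i).
  have d1 := is_deriveZ be (df x i); have d2 := is_deriveZ ga (dF x i).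
  have := is_deriveD (is_deriveD (is_derive_cst al x (delta_mx 0 i)) d1) d2.
  by rewrite add0r.
rewrite /partial (@derive_val _ _ _ _ _ _ _ (is_deriveM ds dP)) !mxE /GRing.scale /=.
ring.
Qed.

Let j_ge0 x : 0 <= j x. Proof. exact: support_fun_ge0. Qed.

Let j_le_k x : j x <= k x.
Proof. by apply: support_funS => //; exists 0. Qed.

(** Where the cut-off is nonzero, [f x < 1 - e], while [f x >= (1 - e / 2) * j x] by the choice of
    [eta]; and [1 - e <= (1 - e / 2) ^+ 2]. *)
Let supp_cutoff x : cutoff x != 0 -> j x <= 1 - e / 2.
Proof.
have [_ _ _ hf _] := fG.
move=> cx; have tx : 0 < t x.
  by rewrite ltNge; apply/negP => /(soft_le0 e) s0; move: cx; rewrite /cutoff s0 mul0r eqxx.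
have /andP[h1 _] := hf x; rewrite -/(j x) in h1.
have h2 : eta * `|x - x0| <= e / 2 * j x.
  apply: (@le_trans _ _ (c * e / 2 * `|x - x0|)); first by rewrite ler_wpM2r.
  have -> : c * e / 2 * `|x - x0| = e / 2 * (c * `|x - x0|) by ring.
  by rewrite ler_wpM2l // divr_ge0 // ltW.
rewrite /t in tx; have j0 := j_ge0 x; have := e0; have := e2; nra.
Qed.

Lemma cutoff_test : test_fun Omega cutoff.
Proof.
have sO : closure [set x | cutoff x != 0] `<=` [set x | j x <= 1 - e / 2].
  have cl : closed [set x | j x <= 1 - e / 2].
    apply: (@preimage_closed _ _ j [set y | y <= 1 - e / 2]); last exact: closed_le.
    by move=> x _; apply: support_shift_continuous => //; exists 0.
  rewrite [X in _ `<=` X](iffLR (closure_id _) cl).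
  by apply: closureS => x; exact: supp_cutoff.
have sO' : closure [set x | cutoff x != 0] `<=` Omega.
  by move=> x /sO /= jx; apply/Oj; apply: (le_lt_trans jx); have := e0; lra.
split; [exact: cutoff_Ck| |exact: sO'].
apply: bounded_closed_compact; last exact: closed_closure.
have [C C0 OC] := bounded_rV_le bO.
by apply: (@bounded_onI _ _ _ _ id C) => x /sO'; exact: OC.
Qed.

Section pointwise.
Variables (x : 'rV[R]_n) (Ox : Omega x).

Let eta_z : eta * `|x - x0| <= e.
Proof.
have [xM _] := OM Ox; apply: le_trans eta_M; rewrite ler_wpM2l ?(ltW eta0) //; lra.
Qed.

Let eta_e : eta <= e.
Proof. by apply: le_trans eta_M; rewrite ler_peMr ?(ltW eta0) //; have := M1; lra. Qed.

Let eta_z1 : eta * (1 + `|x - x0|) <= e.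
Proof.
by have [xM _] := OM Ox; apply: le_trans eta_M; rewrite ler_wpM2l ?(ltW eta0) //; lra.
Qed.

Let f_bnd : j x - e <= f x <= j x + e.
Proof.
have [_ _ _ /(_ x)/andP[h1 h2] _] := fG; rewrite -/(j x) in h1 h2.
have := eta_z; have := eta_e; lra.
Qed.

Let F_bnd : k x - e <= F x <= k x + e.
Proof.
have [_ _ _ /(_ x)/andP[h1 h2] _] := FH; rewrite -/(k x) in h1 h2.
have := eta_z; have := eta_e; lra.
Qed.

Let G_bnd : j x - e <= dotv (G x) (x - x0) <= j x.
Proof.
have [_ _ conv _ /(_ x) h1] := fG; rewrite -/(j x) in h1.
apply/andP; split; first by have := eta_z1; lra.
by apply: conv => a Aa; rewrite dotvC; exact: le_support_fun.
Qed.

Let H_bnd : k x - e <= dotv (H x) (x - x0) <= k x.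
Proof.
have [_ _ conv _ /(_ x) h1] := FH; rewrite -/(k x) in h1.
apply/andP; split; first by have := eta_z1; lra.
by apply: conv => a Ba; rewrite dotvC; exact: le_support_fun.
Qed.

Let jx1 : j x < 1. Proof. exact/Oj. Qed.
Let kxM : k x <= M. Proof. by have [] := OM Ox. Qed.

(** Three losses of [e]: the shift in [t], the distance from [f] to [j], and the gap between [soft]
    and the identity. In the upper bound the shift absorbs the case where [f] lies below [j]. *)
Let s_bnd : 1 - j x - 3 * e <= soft e (t x) <= 1 - j x.
Proof.
have := e0; have := jx1; have /andP[h1 h2] := f_bnd.
have [t0|t0] := leP (t x) 0.
  by rewrite soft_le0 // => ? ?; apply/andP; move: t0; rewrite /t; split; lra.
have /andP[s1 s2] := soft_le e0 (ltW t0); move: s1 s2; rewrite {1 4}/t.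
by move=> *; apply/andP; split; lra.
Qed.

Definition cutoff_cst : R := `|al| + (`|be| + `|ga|) * (M + 1).

Let P0 := al + be * j x + ga * k x.

Let P_bnd : `|P x| <= cutoff_cst.
Proof.
have /andP[f1 f2] := f_bnd; have /andP[F1 F2] := F_bnd.
have j0 := j_ge0 x; have jk := j_le_k x; have := (e0, e2, M1, kxM, jx1).
move=> [[[[e0' e2'] M1'] kM] j1].
have hf : `|f x| <= M + 1 by rewrite ler_norml; apply/andP; split; lra.
have hF : `|F x| <= M + 1 by rewrite ler_norml; apply/andP; split; lra.
rewrite /P /cutoff_cst mulrDl addrA.
apply: le_trans (ler_normD _ _) _; apply: lerD; last by rewrite normrM ler_wpM2l.
apply: le_trans (ler_normD _ _) _; apply: lerD => //; by rewrite normrM ler_wpM2l.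
Qed.

Let P_P0 : `|P x - P0| <= cutoff_cst * e.
Proof.
have /andP[f1 f2] := f_bnd; have /andP[F1 F2] := F_bnd.
have hf : `|f x - j x| <= e by rewrite ler_norml; apply/andP; split; lra.
have hF : `|F x - k x| <= e by rewrite ler_norml; apply/andP; split; lra.
have -> : P x - P0 = be * (f x - j x) + ga * (F x - k x) by rewrite /P /P0; ring.
apply: (@le_trans _ _ ((`|be| + `|ga|) * e)).
  rewrite mulrDl; apply: le_trans (ler_normD _ _) _.
  by apply: lerD; rewrite normrM ler_wpM2l.
rewrite ler_wpM2r ?(ltW e0) // /cutoff_cst.
have b0 : 0 <= `|be| + `|ga| by rewrite addr_ge0.
have := normr_ge0 al; have := M1; nra.
Qed.

Lemma cutoff_approx : `|cutoff x - (1 - j x) * P0| <= 4 * cutoff_cst * e.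
Proof.
have -> : cutoff x - (1 - j x) * P0 =
    (soft e (t x) - (1 - j x)) * P x + (1 - j x) * (P x - P0).
  by rewrite /cutoff; ring.
have j0 := j_ge0 x; have j1 := jx1; have /andP[s1 s2] := s_bnd.
apply: (@le_trans _ _ (3 * e * cutoff_cst + 1 * (cutoff_cst * e))); last first.
  by rewrite le_eqVlt; apply/orP; left; apply/eqP; ring.
apply: le_trans (ler_normD _ _) _; rewrite !normrM; apply: lerD.
  by rewrite ler_pM // ler_norml; apply/andP; split; have := e0; lra.
by rewrite ler_pM // ger0_norm; lra.
Qed.

Lemma cutoff_cst_ge0 : 0 <= cutoff_cst.
Proof. exact: le_trans P_bnd. Qed.

(** The subtracted term is [(x - x0).grad] of [(1 - j) * P0] as homogeneity would give it. All
    errors are of order [e] uniformly, except the one carrying the slope defect [1 - soft'], which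
    is kept apart as a quotient that is small only inside [Omega]. *)
Lemma cutoff_euler :
  `|dotv (grad cutoff x) (x - x0) -
    (((1 - j x) * be - P0) * j x + (1 - j x) * ga * k x)| <=
  (6 * e + 4 * e / Num.max (4 * e) (1 - j x)) * cutoff_cst.
Proof.
rewrite cutoff_grad dotvDl !dotvZl.
have j0 := j_ge0 x; have j1 := jx1; have jk := j_le_k x.
have := (e0, e2, M1, kxM) => -[[[e0' e2'] M1'] kM].
have /andP[s1 s2] := s_bnd; have hP := P_bnd; have hPP := P_P0.
have /andP[G1 G2] := G_bnd; have /andP[H1 H2] := H_bnd.
set s := soft e (t x) in s1 s2 *; set s' := soft' e (t x).
have [s'0 s'1] : 0 <= s' /\ s' <= 1 by apply/andP/soft'_itv.
(* If [1 - j x <= 4 * e] the right side is 1; otherwise [t x >= (1 - j x) / 2], well above [e], and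
   [soft'_ge] applies. *)
have hs' : 1 - s' <= 4 * e / Num.max (4 * e) (1 - j x).
  have m0 : 0 < Num.max (4 * e) (1 - j x) by rewrite lt_max subr_gt0 j1 orbT.
  rewrite ler_pdivlMr //.
  have [h|h] := leP (1 - j x) (4 * e).
    nra.
  have t2 : (1 - j x) / 2 <= t x by have /andP[f1 f2] := f_bnd; rewrite /t; lra.
  have tx : 0 < t x by lra.
  have := soft'_ge e0 tx; rewrite -/s' ler_pdivlMr //.
  move=> h1; have p : 0 <= 1 - s' by lra.
  have : (1 - s') * ((1 - j x) / 2) <= (1 - s') * t x by rewrite ler_wpM2l.
  by lra.
set a := dotv (G x) _ in G1 G2 *; set b := dotv (H x) _ in H1 H2 *.
have -> : (s * be - s' * P x) * a + s * ga * b -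
    (((1 - j x) * be - P0) * j x + (1 - j x) * ga * k x) =
    be * (s * a - (1 - j x) * j x) + ga * (s * b - (1 - j x) * k x)
    + ((1 - s') * (P x * a) + (P x * (j x - a) - j x * (P x - P0))) by ring.
have ha : `|a| <= 1 by rewrite ler_norml; apply/andP; split; lra.
have hb1 : `|s * a - (1 - j x) * j x| <= 4 * e * (M + 1).
  have -> : s * a - (1 - j x) * j x = (s - (1 - j x)) * a + (1 - j x) * (a - j x) by ring.
  apply: le_trans (ler_normD _ _) _; rewrite !normrM.
  apply: (@le_trans _ _ (3 * e * 1 + 1 * e)); last by nra.
  by apply: lerD; apply: ler_pM => //; rewrite ler_norml; apply/andP; split; lra.
have hb2 : `|s * b - (1 - j x) * k x| <= 4 * e * (M + 1).
  have -> : s * b - (1 - j x) * k x = (s - (1 - j x)) * b + (1 - j x) * (b - k x) by ring.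
  apply: le_trans (ler_normD _ _) _; rewrite !normrM.
  apply: (@le_trans _ _ (3 * e * (M + 1) + 1 * e)); last by nra.
  by apply: lerD; apply: ler_pM => //; rewrite ler_norml; apply/andP; split; lra.
have C0 := cutoff_cst_ge0.
have n0 := normr_ge0 al.
have E1 : `|be * (s * a - (1 - j x) * j x) + ga * (s * b - (1 - j x) * k x)|
    <= 4 * e * cutoff_cst.
  apply: le_trans (ler_normD _ _) _; rewrite !normrM.
  apply: (@le_trans _ _ (`|be| * (4 * e * (M + 1)) + `|ga| * (4 * e * (M + 1)))).
    by apply: lerD; rewrite ler_wpM2l.
  rewrite /cutoff_cst; nra.
have E2 : `|(1 - s') * (P x * a)| <= 4 * e / Num.max (4 * e) (1 - j x) * cutoff_cst.
  rewrite !normrM; apply: ler_pM => //; rewrite ?mulr_ge0 //.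
    by rewrite ger0_norm //; lra.
  by rewrite -[leRHS]mulr1; apply: ler_pM.
have E3 : `|P x * (j x - a) - j x * (P x - P0)| <= 2 * e * cutoff_cst.
  apply: le_trans (ler_normB _ _) _; rewrite !normrM.
  apply: (@le_trans _ _ (cutoff_cst * e + 1 * (cutoff_cst * e))); last by lra.
  by apply: lerD; apply: ler_pM => //; rewrite ler_norml; apply/andP; split; lra.
apply: le_trans (ler_normD _ _) _; rewrite [leRHS]mulrDl.
have := ler_normD ((1 - s') * (P x * a)) (P x * (j x - a) - j x * (P x - P0)); lra.
Qed.

(** The gradient is a combination of [G x] and [H x], on both of which h_K is at most [rho]. The
    coefficient of [G x] approximates [- (2 * j x + ga * k x)], whose sign is fixed by the last
    hypothesis, so taking its absolute value loses nothing. No layer term appears, since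
    [soft' <= 1] works in favour of the upper bound. *)
Lemma cutoff_energy (K : set 'rV[R]_n) (rho : R) : K !=set0 -> origin_symmetric K ->
  (forall b y, B b -> K y -> dotv b y <= rho) ->
  al = 1 -> be = 1 -> -1 <= ga -> ga <= 0 -> - ga * k x <= 2 * j x ->
  support_fun K (grad cutoff x) <=
  rho * (2 * j x + ga * k x - ga * (1 - j x) + 5 * e).
Proof.
move=> K0 sK BK al1 be1 ga1 ga0 gak.
have j0 := j_ge0 x; have j1 := jx1; have jk := j_le_k x; have e0' := e0.
have /andP[s1 s2] := s_bnd; have /andP[f1 f2] := f_bnd; have /andP[F1 F2] := F_bnd.
have [_ _ convG _ _] := fG; have [_ _ convH _ _] := FH.
have dG y : K y -> `|dotv (G x) y| <= rho.
  move=> Ky; rewrite ler_norml lerNl -dotvNr; apply/andP; split.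
    by apply: convG => a Aa; apply: BK; [exact: AB|exact: sK].
  by apply: convG => a Aa; apply: BK; [exact: AB|].
have dH y : K y -> `|dotv (H x) y| <= rho.
  move=> Ky; rewrite ler_norml lerNl -dotvNr; apply/andP; split.
    by apply: convH => a Aa; apply: BK => //; exact: sK.
  by apply: convH => a Aa; exact: BK.
have rho0 : 0 <= rho by have [y Ky] := K0; exact: le_trans (dG y Ky).
rewrite cutoff_grad; apply: support_fun_le => // y Ky.
rewrite dotvDl !dotvZl; apply: le_trans (ler_norm _) _.
apply: le_trans (ler_normD _ _) _.
rewrite [X in X + _ <= _]normrM [X in _ + X <= _]normrM be1 mulr1.
have Pe : P x = 1 + f x + ga * F x by rewrite /P al1 be1 mul1r.
have gF : ga * k x - e <= ga * F x <= ga * k x + e by apply/andP; split; nra.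
have /andP[gF1 gF2] := gF.
have gk0 : ga * k x <= 0 by nra.
have h1 : `|soft e (t x) - soft' e (t x) * P x| <= 2 * j x + ga * k x + 5 * e.
  have [t0|t0] := leP (t x) 0.
    by rewrite soft_le0 // soft'_le0 // mul0r subr0 normr0; lra.
  have /andP[s'0 s'1] := soft'_itv e0 (t x).
  have upper : soft' e (t x) * P x - soft e (t x) <= 2 * j x + ga * k x + 5 * e.
    have : soft' e (t x) * P x <= 1 + j x + ga * k x + 2 * e.
      apply: (@le_trans _ _ (soft' e (t x) * (1 + j x + ga * k x + 2 * e))).
        by rewrite ler_wpM2l // Pe; lra.
      by rewrite ler_piMl //; lra.
    by lra.
  (* If [P x < 0], then [1 - j x <= 2 * e] and every term is small. Otherwise [soft] and [soft']
     share the factor [flat e 0 (t x)], and what remains is [P x - t x] up to a nonnegative term. *)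
  have lower : - (4 * e) <= soft' e (t x) * P x - soft e (t x).
    have [P0'|P0'] := leP 0 (P x); last first.
      have Pm : - (2 * e) <= P x by rewrite Pe; lra.
      have : soft' e (t x) * - (2 * e) <= soft' e (t x) * P x by rewrite ler_wpM2l.
      have : 1 - j x <= 2 * e by move: P0'; rewrite Pe; lra.
      by nra.
    have /andP[q0 q1] := flat0_itv e0 (t x).
    rewrite soft'_eq // /soft.
    have et0 : 0 <= e / t x by rewrite divr_ge0 // ltW.
    have Pt : - (2 * e) <= P x - t x by rewrite Pe /t; lra.
    have : flat e 0 (t x) * (P x - t x) <=
        flat e 0 (t x) * (1 + e / t x) * P x - t x * flat e 0 (t x).
      have -> : flat e 0 (t x) * (1 + e / t x) * P x - t x * flat e 0 (t x) =
        flat e 0 (t x) * (P x - t x) + flat e 0 (t x) * (e / t x) * P x by ring.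
      by rewrite lerDl mulr_ge0 // mulr_ge0.
    have : flat e 0 (t x) * - (2 * e) <= flat e 0 (t x) * (P x - t x) by rewrite ler_wpM2l.
    by nra.
  by rewrite ler_norml; apply/andP; split; lra.
have h2 : `|soft e (t x) * ga| <= - ga * (1 - j x).
  rewrite [leLHS]normrM mulrC (ler0_norm ga0) ler_wpM2l ?oppr_ge0 // ger0_norm //.
  exact: soft_ge0.
have -> : rho * (2 * j x + ga * k x - ga * (1 - j x) + 5 * e) =
   (2 * j x + ga * k x + 5 * e) * rho + (- ga * (1 - j x)) * rho by ring.
apply: lerD; first by apply: ler_pM => //; exact: dG.
by apply: ler_pM => //; exact: dH.
Qed.

End pointwise.

End cutoff.

(** * Moments of the gauges *)

Section moments.
Context (R : realType) (n : nat) (Omega A B : set 'rV[R]_n) (x0 : 'rV[R]_n).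
Variables (c M : R).
Hypotheses (oO : open Omega) (bO : bounded_set Omega).
Hypotheses (bA : bounded_set A) (bB : bounded_set B) (A0 : A 0) (AB : A `<=` B).
Let j (x : 'rV[R]_n) := support_fun A (x - x0).
Let k (x : 'rV[R]_n) := support_fun B (x - x0).
Hypothesis Oj : forall x, Omega x <-> j x < 1.
Hypotheses (c0 : 0 < c) (jge : forall x, c * `|x - x0| <= j x).
Hypotheses (M1 : 1 <= M) (OM : forall x, Omega x -> `|x - x0| <= M /\ k x <= M).
Let mu := @lebesgue_rV R n.
Let mO : measurable Omega := rV_open_measurable oO.

Let j_continuous : continuous j.
Proof. by apply: support_shift_continuous => //; exists 0. Qed.

Let k_continuous : continuous k.
Proof. by apply: support_shift_continuous => //; exists 0; exact: AB. Qed.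

Lemma cutoff_data e : 0 < e -> let eta := Num.min (c * e / 2) (e / (1 + M)) in
  exists f F G H, smooth_support A x0 eta f G /\ smooth_support B x0 eta F H.
Proof.
move=> e0 eta; have eta0 : 0 < eta.
  by rewrite lt_min !divr_gt0 ?mulr_gt0 //; have := M1; lra.
have An0 : A !=set0 by exists 0.
have Bn0 : B !=set0 by exists 0; exact: AB.
have [f [G fG]] := smooth_support_exists x0 bA An0 eta0.
have [F [H FH]] := smooth_support_exists x0 bB Bn0 eta0.
by exists f, F, G, H.
Qed.

(* Bounds the slope defect of the cut-off, which is not uniformly small near the
   boundary of [Omega]. *)
Let layer (e : R) (x : 'rV[R]_n) := 4 * e / Num.max (4 * e) (1 - j x).

Let layer_itv e x : 0 < e -> 0 <= layer e x <= 1.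
Proof.
move=> e0; have e4 : 0 < 4 * e by rewrite mulr_gt0.
have m0 : 0 < Num.max (4 * e) (1 - j x) by rewrite lt_max e4.
apply/andP; split; first by rewrite divr_ge0 // ltW.
by rewrite ler_pdivrMr // mul1r le_max lexx.
Qed.

Let layer_continuous e : 0 < e -> continuous (layer e).
Proof.
move=> e0; have e4 : 0 < 4 * e by rewrite mulr_gt0.
have cj : continuous (fun y : 'rV[R]_n => 1 - j y).
  apply: continuous_addT; first by move=> y; exact: cst_continuous.
  by move=> y; apply: (@continuousN _ _ _ j); exact: j_continuous.
have cm : continuous (fun y : 'rV[R]_n => Num.max (4 * e) (1 - j y)).
  move=> y; apply: (@continuous_max _ _ (fun=> 4 * e) (fun y => 1 - j y)).
    exact: cst_continuous.
  exact: cj.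
apply: continuous_mulT; first by move=> y; exact: cst_continuous.
move=> y; apply: (@continuousV _ _ (fun y => Num.max (4 * e) (1 - j y))).
  by rewrite gt_eqF // lt_max e4.
exact: cm.
Qed.

Let layer_integrable e : 0 < e -> mu.-integrable Omega (EFin \o layer e).
Proof. by move=> e0; apply: continuous_integrable => //; exact: layer_continuous. Qed.

(** Dominated convergence: at a fixed point of [Omega] the layer is of order [e], and it never
    exceeds 1. The sequence [harmonic m / 2] starts at [1 / 2], whence [e <= 2^-1]. *)
Lemma layer_vanishes d : 0 < d -> exists2 e, 0 < e &
  [/\ e <= 2^-1, e <= d & \int[mu]_(x in Omega) layer e x <= d].
Proof.
move=> d0; pose e_ m : R := harmonic m / 2.
have e_0 m : 0 < e_ m by rewrite /e_ /= divr_gt0 // invr_gt0.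
have lim_e : e_ m @[m --> \oo] --> 0.
  by rewrite -(mul0r (2^-1)); apply: cvgMl; exact: cvg_harmonic.
have mf m : measurable_fun Omega (EFin \o layer (e_ m)).
  by have /integrableP[] := layer_integrable (e_0 m).
have lim_x x : Omega x -> (EFin \o layer (e_ m)) x @[m --> \oo] --> 0%:E.
  move=> /Oj jx; have j1 : 0 < 1 - j x by rewrite subr_gt0.
  apply: cvg_EFin; first exact: nearW.
  apply: (@squeeze_cvgr _ _ _ _ (fun=> 0) (fun m => e_ m * (4 / (1 - j x)))).
  - apply: nearW => m; have /andP[l0 _] := layer_itv x (e_0 m); apply/andP; split => //.
    have -> : e_ m * (4 / (1 - j x)) = 4 * e_ m / (1 - j x) by ring.
    have e4 : 0 <= 4 * e_ m by rewrite mulr_ge0 // ltW.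
    change (4 * e_ m / Num.max (4 * e_ m) (1 - j x) <= 4 * e_ m / (1 - j x)).
    by rewrite ler_wpM2l // lef_pV2 ?posrE // ?lt_max ?j1 ?orbT // le_max lexx orbT.
  - exact: cvg_cst.
  - by rewrite -(mul0r (4 / (1 - j x))); apply: cvgMl; exact: lim_e.
have bnd m x : Omega x -> (`|(EFin \o layer (e_ m)) x| <= 1)%E.
  move=> _; have /andP[l0 l1] := layer_itv x (e_0 m).
  by rewrite /= lee_fin ger0_norm.
have [_ _] := @dominated_convergence _ _ _ mu Omega mO
  (fun m => EFin \o layer (e_ m)) (fun=> 0%E) (fun=> 1%E) mf (measurable_cst _)
  (aeW _ lim_x) (cst_integrable oO bO 1)
  (aeW _ (fun x m Ox => bnd m x Ox)).
rewrite integral0 => /fine_cvgP[_ /cvgrPdist_lt/(_ _ d0) h1].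
have /cvgrPdist_lt/(_ _ d0) h2 := lim_e.
have [m _ /(_ m (leqnn m))[hm1 hm2]] := filterI h1 h2.
exists (e_ m) => //; split.
- by rewrite /e_ ler_pdivrMr // mulVf // invf_le1 // ler1n.
- by move: hm2; rewrite sub0r normrN gtr0_norm // => /ltW.
- move: hm1; rewrite sub0r normrN /= => hm1; apply/ltW; apply: le_lt_trans hm1.
  exact: ler_norm.
Unshelve. all: by end_near. Qed.

Let contI (h : 'rV[R]_n -> R) : continuous h -> mu.-integrable Omega (EFin \o h).
Proof. exact: continuous_integrable. Qed.

Let cc (a : R) : continuous (fun _ : 'rV[R]_n => a).
Proof. by move=> x; exact: cst_continuous. Qed.

Let integral_close (f g h : 'rV[R]_n -> R) : continuous f -> continuous g ->
  continuous h -> (forall x, Omega x -> `|f x - g x| <= h x) ->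
  `|\int[mu]_(x in Omega) f x - \int[mu]_(x in Omega) g x|
    <= \int[mu]_(x in Omega) h x.
Proof.
move=> cf cg ch fgh; rewrite -RintegralB //; [|exact: contI|exact: contI].
have cfg : continuous (fun x => f x - g x).
  apply: continuous_addT => // x; apply: (@continuousN _ _ _ g); exact: cg.
apply: le_trans (le_normr_Rintegral mO (contI cfg)) _.
apply: le_Rintegral => //; [exact: integrable_norm (contI cfg)|exact: contI].
Qed.

Let quadratic_continuous (a0 a1 a2 a3 a4 a5 : R) :
  continuous (fun x => a0 + a1 * j x + a2 * k x + a3 * j x ^+ 2
                       + a4 * (j x * k x) + a5 * k x ^+ 2).
Proof.
have cjj : continuous (fun x => j x ^+ 2).
  by under eq_fun do rewrite expr2; exact: continuous_mulT.
have ckk : continuous (fun x => k x ^+ 2).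
  by under eq_fun do rewrite expr2; exact: continuous_mulT.
have cjk : continuous (fun x => j x * k x) by exact: continuous_mulT.
by do 5?apply: continuous_addT; (try apply: continuous_mulT) => //; exact: cc.
Qed.

Let V := fine (mu Omega).
Let m1 := \int[mu]_(x in Omega) j x.
Let m2 := \int[mu]_(x in Omega) k x.
Let m3 := \int[mu]_(x in Omega) (j x ^+ 2).
Let m4 := \int[mu]_(x in Omega) (j x * k x).
Let m5 := \int[mu]_(x in Omega) (k x ^+ 2).

(** Every limiting integrand is a quadratic polynomial in the two gauges, so six moments suffice.
    The function [h] comes with an equation, which [ring] settles whatever the form of the
    integrand. *)
Lemma integral_quadratic (a0 a1 a2 a3 a4 a5 : R) (h : 'rV[R]_n -> R) :
  (forall x, h x = a0 + a1 * j x + a2 * k x + a3 * j x ^+ 2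
                   + a4 * (j x * k x) + a5 * k x ^+ 2) ->
  continuous h /\ \int[mu]_(x in Omega) h x =
    a0 * V + a1 * m1 + a2 * m2 + a3 * m3 + a4 * m4 + a5 * m5.
Proof.
move=> hE; have -> : h = (fun x => a0 + a1 * j x + a2 * k x + a3 * j x ^+ 2
  + a4 * (j x * k x) + a5 * k x ^+ 2) by exact/funext.
split; first exact: quadratic_continuous.
have cjj : continuous (fun x => j x ^+ 2).
  by under eq_fun do rewrite expr2; exact: continuous_mulT.
have ckk : continuous (fun x => k x ^+ 2).
  by under eq_fun do rewrite expr2; exact: continuous_mulT.
have cjk : continuous (fun x => j x * k x) by exact: continuous_mulT.
have sc a (f : 'rV[R]_n -> R) : continuous f -> continuous (fun x => a * f x).
  by move=> cf; apply: continuous_mulT => //; exact: cc.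
have D (f g : 'rV[R]_n -> R) : continuous f -> continuous g ->
    \int[mu]_(x in Omega) (f x + g x) =
    \int[mu]_(x in Omega) f x + \int[mu]_(x in Omega) g x.
  by move=> cf cg; apply: RintegralD => //; exact: contI.
have Z a (f : 'rV[R]_n -> R) : continuous f ->
    \int[mu]_(x in Omega) (a * f x) = a * \int[mu]_(x in Omega) f x.
  by move=> cf; apply: RintegralZl => //; exact: contI.
have s0 : continuous (fun _ : 'rV[R]_n => a0) by exact: cc.
have s1 : continuous (fun x => a0 + a1 * j x).
  by apply: continuous_addT => //; exact: sc.
have s2 : continuous (fun x => a0 + a1 * j x + a2 * k x).
  by apply: continuous_addT => //; exact: sc.
have s3 : continuous (fun x => a0 + a1 * j x + a2 * k x + a3 * j x ^+ 2).
  by apply: continuous_addT => //; exact: sc.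
have s4 : continuous (fun x => a0 + a1 * j x + a2 * k x + a3 * j x ^+ 2
    + a4 * (j x * k x)) by apply: continuous_addT => //; exact: sc.
rewrite (D _ _ s4 (sc a5 _ ckk)) (D _ _ s3 (sc a4 _ cjk)) (D _ _ s2 (sc a3 _ cjj)).
rewrite (D _ _ s1 (sc a2 _ k_continuous)) (D _ _ s0 (sc a1 _ j_continuous)).
by rewrite Rintegral_cst // (Z _ _ j_continuous) (Z _ _ k_continuous) (Z _ _ cjj)
  (Z _ _ cjk) (Z _ _ ckk).
Qed.

(* The limit, along cut-off functions, of the divergence identity for
   (1 - j) (al + be * j + ga * k), whose degree-one homogeneous gauges [j] and [k]
   satisfy x . grad j = j and x . grad k = k. *)
Lemma euler_identity (al be ga : R) :
  n%:R * \int[mu]_(x in Omega) ((1 - j x) * (al + be * j x + ga * k x)) +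
  \int[mu]_(x in Omega) (((1 - j x) * be - (al + be * j x + ga * k x)) * j x
                         + (1 - j x) * ga * k x) = 0.
Proof.
pose P0 x := al + be * j x + ga * k x.
pose v x := (1 - j x) * P0 x.
pose T x := ((1 - j x) * be - P0 x) * j x + (1 - j x) * ga * k x.
have [cv _] := @integral_quadratic al (be - al) ga (- be) (- ga) 0 v
  (fun x => ltac:(rewrite /v /P0; ring)).
have [cT _] := @integral_quadratic 0 (be - al) ga (- 2 * be) (- 2 * ga) 0 T
  (fun x => ltac:(rewrite /T /P0; ring)).
set L := _ + _; pose C := cutoff_cst M al be ga.
have C0 : 0 <= C by rewrite /C /cutoff_cst addr_ge0 // mulr_ge0 ?addr_ge0 //; have := M1; lra.
have V0 : 0 <= V by rewrite fine_ge0.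
have D0 : 0 < C * (n%:R * 4 * V + 6 * V + 1) + 1.
  by rewrite ltr_wpDl // mulr_ge0 // !addr_ge0 // !mulr_ge0.
suff h d : 0 < d -> `|L| <= d * (C * (n%:R * 4 * V + 6 * V + 1) + 1).
  apply/eqP; rewrite -normr_le0 leNgt; apply/negP => L0.
  have := h (`|L| / (C * (n%:R * 4 * V + 6 * V + 1) + 1) / 2).
  rewrite !divr_gt0 // => /(_ isT); rewrite mulrAC divfK ?gt_eqF //.
  by move: L0; lra.
move=> d0; have [e e0 [e2 ed lay]] := layer_vanishes d0.
have [f [F [G [H [fG FH]]]]] := cutoff_data e0.
pose phi := cutoff e f F al be ga.
have tphi : test_fun Omega phi by apply: cutoff_test fG FH _ _ _.
have Cphi := test_fun_Ck 1 tphi; have cphi := Ck_on_continuous Cphi.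
pose dphi x := dotv (grad phi x) (x - x0).
have cd : continuous dphi.
  have -> : dphi = (fun x => \sum_i (x - x0) 0 i * partial i phi x).
    by apply/funext => x; rewrite /dphi dotv_coord; apply: eq_bigr => i _; rewrite gradE.
  apply: continuous_sum_fun => i; apply: continuous_mulT.
    apply: (@lipschitz_continuousW R _ _ _ 1) => x y; rewrite mul1r.
    by rewrite (_ : _ - _ = (x - y) 0 i) ?le_coord_norm // !mxE; ring.
  exact: (Ck_on_continuous (Ck_onS_partial i Cphi)).
have E := integral_grad_test x0 oO bO tphi; rewrite -/(dphi _) in E.
have approx x : Omega x -> `|phi x - v x| <= 4 * C * e.
  move=> Ox; exact: (cutoff_approx bA bB A0 AB Oj c0 M1 OM e0 e2 fG FH al be ga Ox).
have euler x : Omega x -> `|dphi x - T x| <= (6 * e + layer e x) * C.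
  move=> Ox; exact: (cutoff_euler bA bB A0 AB Oj c0 M1 OM e0 e2 fG FH al be ga Ox).
have h1 := integral_close cphi cv (@cc (4 * C * e)) approx.
have cl : continuous (fun x => (6 * e + layer e x) * C).
  apply: continuous_mulT; last exact: cc.
  by apply: continuous_addT; [exact: cc|exact: layer_continuous].
have h2 := integral_close cd cT cl euler.
rewrite Rintegral_cst // -/V in h1.
have h3 : \int[mu]_(x in Omega) ((6 * e + layer e x) * C) =
    (6 * e * V + \int[mu]_(x in Omega) layer e x) * C.
  have ci : mu.-integrable Omega (EFin \o (fun _ : 'rV[R]_n => 6 * e)).
    by apply: contI; exact: cc.
  have li := layer_integrable e0.
  by rewrite RintegralZr ?RintegralD ?Rintegral_cst //; exact: integrable_add.
rewrite h3 in h2.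
have -> : L = n%:R * (\int[mu]_(x in Omega) v x - \int[mu]_(x in Omega) phi x) +
    (\int[mu]_(x in Omega) T x - \int[mu]_(x in Omega) dphi x).
  by rewrite E /L; ring.
apply: le_trans (ler_normD _ _) _; rewrite normrM normr_nat.
rewrite distrC in h1; rewrite distrC in h2.
have n0 : 0 <= n%:R :> R by [].
have h1' := ler_wpM2l n0 h1.
have CV0 : 0 <= C * V by rewrite mulr_ge0.
have nCV0 : 0 <= n%:R * (C * V) by rewrite mulr_ge0.
have g1 : n%:R * (4 * C * e * V) <= 4 * d * (n%:R * (C * V)) by nra.
have g2 : 6 * e * V * C <= 6 * d * (C * V) by nra.
have g3 : (\int[mu]_(x in Omega) layer e x) * C <= d * C by rewrite ler_wpM2r.
by move: h1' h2 g1 g2 g3 d0; lra.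
Qed.

(** The Euler identity for [1 - j], [(1 - j) * j] and [(1 - j) * k]; the second relation is then
    combined with the first. *)
Lemma moment_identities :
  [/\ (n%:R + 1) * m1 = n%:R * V, (n%:R + 2) * m3 = n%:R * V &
      (n%:R + 1) * m2 = (n%:R + 2) * m4].
Proof.
have I1 (a0 a1 a2 a3 a4 a5 : R) (h : 'rV[R]_n -> R)
    (hE : forall x, h x = a0 + a1 * j x + a2 * k x + a3 * j x ^+ 2
                   + a4 * (j x * k x) + a5 * k x ^+ 2) :=
  (integral_quadratic hE).2.
have := euler_identity 1 0 0.
rewrite (@I1 1 (-1) 0 0 0 0); last by move=> x; ring.
rewrite (@I1 0 (-1) 0 0 0 0); last by move=> x; ring.
move=> e1.
have := euler_identity 0 1 0.
rewrite (@I1 0 1 0 (-1) 0 0); last by move=> x; ring.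
rewrite (@I1 0 1 0 (-2) 0 0); last by move=> x; ring.
move=> e2.
have := euler_identity 0 0 1.
rewrite (@I1 0 0 1 0 (-1) 0); last by move=> x; ring.
rewrite (@I1 0 0 1 0 (-2) 0); last by move=> x; ring.
move=> e3; split; move: e1 e2 e3; lra.
Qed.

End moments.

(** * Lower bound for the torsional rigidity *)

Lemma sqr_le_approx (R : realFieldType) (I a C : R) : 0 <= C ->
  (forall e, 0 < e -> e <= 2^-1 -> exists2 y, `|y - I| <= C * e & y ^+ 2 <= a + C * e) ->
  I ^+ 2 <= a.
Proof.
move=> C0 h; apply/ler_addgt0Pr => d d0.
pose D := C * (1 + 2 * `|I| + C) + 1.
have I0 := normr_ge0 I.
have D0 : 0 < D by rewrite ltr_wpDl // mulr_ge0 // !addr_ge0 // mulr_ge0.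
pose e := Num.min 2^-1 (d / D).
have e0 : 0 < e by rewrite lt_min invr_gt0 ltr0n divr_gt0.
have e2 : e <= 2^-1 by rewrite ge_min lexx.
have eD : D * e <= d by rewrite mulrC -ler_pdivlMr // ge_min lexx orbT.
have [y yI ya] := h e e0 e2.
have h1 : I ^+ 2 - y ^+ 2 <= `|y - I| * `|I + y|.
  by rewrite -normrM -normrN; apply: le_trans (ler_norm _); rewrite le_eqVlt; apply/orP; left; apply/eqP; ring.
have h2 : `|I + y| <= 2 * `|I| + C * e.
  have -> : I + y = 2 * I + (y - I) by ring.
  by apply: le_trans (ler_normD _ _) _; rewrite normrM ger0_norm // lerD2l.
have h3 : `|y - I| * `|I + y| <= C * e * (2 * `|I| + C) .
  apply: ler_pM => //; apply: (le_trans h2); rewrite lerD2l ler_piMr //; lra.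
by move: eD ya h1 h3; rewrite /D; nra.
Qed.

Lemma le0_of_quadratic (R : realFieldType) (X Y e0 : R) : 0 < e0 ->
  (forall e, 0 < e -> e <= e0 -> X * e <= Y * e ^+ 2) -> X <= 0.
Proof.
move=> e00 h; rewrite leNgt; apply/negP => X0.
have Y1 : 0 < `|Y| + 1 by rewrite ltr_wpDl.
pose e := Num.min e0 (X / (`|Y| + 1) / 2).
have p0 : 0 < e by rewrite lt_min e00 !divr_gt0.
have pe : e <= e0 by rewrite ge_min lexx.
have pX : (`|Y| + 1) * e <= X / 2.
  by rewrite mulrC -ler_pdivlMr // mulrAC ge_min lexx orbT.
have := h e p0 pe; rewrite expr2 mulrA ler_pM2r //.
have := ler_norm Y; nra.
Qed.

Section torsion_lower_bound.
Context (R : realType) (n : nat) (Omega A B K : set 'rV[R]_n) (x0 : 'rV[R]_n).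
Variables (c M r rho tau : R).
Hypotheses (n_gt0 : (0 < n)%N) (oO : open Omega) (bO : bounded_set Omega).
Hypotheses (bA : bounded_set A) (bB : bounded_set B) (A0 : A 0) (AB : A `<=` B).
Let j (x : 'rV[R]_n) := support_fun A (x - x0).
Let k (x : 'rV[R]_n) := support_fun B (x - x0).
Hypothesis Oj : forall x, Omega x <-> j x < 1.
Hypotheses (c0 : 0 < c) (jge : forall x, c * `|x - x0| <= j x).
Hypotheses (M1 : 1 <= M) (OM : forall x, Omega x -> `|x - x0| <= M /\ k x <= M).
Hypotheses (r0 : 0 < r) (rK : ball 0 r `<=` K) (bK : bounded_set K).
Hypothesis sK : origin_symmetric K.
Hypothesis BK : forall b y, B b -> K y -> dotv b y <= rho.
Hypotheses (tau0 : 0 <= tau) (torsion_tau : (torsion Omega K <= tau%:E)%E).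
Let mu := @lebesgue_rV R n.
Let mO : measurable Omega := rV_open_measurable oO.

Let K0 : K !=set0. Proof. by exists 0; apply: rK; exact: ballxx. Qed.

(** [tau] is an arbitrary real bound of the torsion, so the supremum need not be known to be finite.
    Written as a product, the inequality also covers a vanishing integral. *)
Lemma torsion_test phi : test_fun Omega phi ->
  (\int[mu]_(x in Omega) phi x) ^+ 2 <=
  tau * \int[mu]_(x in Omega) support_fun K (grad phi x) ^+ 2.
Proof.
move=> tphi; set D := (X in tau * X).
have D0 : 0 <= D by apply: Rintegral_ge0 => x _; exact: sqr_ge0.
have [->|I0] := eqVneq (\int[mu]_(x in Omega) phi x) 0.
  by rewrite expr0n /= mulr_ge0.
have W := W12_0_test oO bO tphi.
have Dp : 0 < D.
  rewrite lt_neqAle D0 andbT eq_sym; apply/negP => /eqP D00.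
  (* The upper bound acts here as a Poincare inequality: a nonzero integral forces a positive
     energy, so the quotient is a genuine one. *)
  have := W12_0_energy_bound 0 oO bO r0 rK bK sK W; rewrite -/mu -/D D00 mulr0.
  rewrite exprn_even_le0 //= mulf_eq0 (negbTE I0) orbF pnatr_eq0 => /eqP n0.
  by move: n_gt0; rewrite n0.
rewrite -ler_pdivrMr // -lee_fin; apply: le_trans torsion_tau.
apply: ereal_sup_ubound; exists phi, (grad phi); split => // z; case/eqP: I0.
rewrite /Rintegral (@ae_eq_integral _ _ _ mu Omega (cst 0%E)) //.
- by rewrite integral0.
- apply/measurable_EFinP; apply: measurable_funTS; apply: continuous_rV_measurable.
  exact: (Ck_on_continuous (test_fun_Ck 1 tphi)).
- by apply: filterS z => x z Ox; rewrite z.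
Qed.

Let V := fine (mu Omega).
Let V0 : 0 <= V. Proof. by rewrite fine_ge0. Qed.

Lemma cutoff_inequality ga : -1 <= ga -> ga <= 0 ->
  (forall x, - ga * k x <= 2 * j x) ->
  (\int[mu]_(x in Omega) ((1 - j x) * (1 + 1 * j x + ga * k x))) ^+ 2 <=
  tau * (rho ^+ 2 * \int[mu]_(x in Omega)
    (2 * j x + ga * k x - ga * (1 - j x)) ^+ 2).
Proof.
move=> ga1 ga0 gak.
pose v x := (1 - j x) * (1 + 1 * j x + ga * k x).
pose W x := 2 * j x + ga * k x - ga * (1 - j x).
have quad := @integral_quadratic R n Omega A B x0 oO bO bA bB A0 AB.
have [cv _] := quad 1 0 ga (-1) (- ga) 0 v (fun x => ltac:(rewrite /v /j /k; ring)).
have [cW _] := quad (- ga) (2 + ga) ga 0 0 0 W (fun x => ltac:(rewrite /W /j /k; ring)).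
have cW2 : continuous (fun x => W x ^+ 2).
  by under eq_fun do rewrite expr2; exact: continuous_mulT.
pose C := cutoff_cst M 1 1 ga.
have C0 : 0 <= C by rewrite /C /cutoff_cst addr_ge0 // mulr_ge0 ?addr_ge0 //; have := M1; lra.
have rho0 : 0 <= rho by have [y Ky] := K0; rewrite -(dotv0l y); apply: BK => //; exact: AB.
(* [4 * C * V] bounds the error on the integral of the trial function. In the energy,
   [55 = 10 * 3 + 25] comes from expanding [(W x + 5 * e) ^+ 2] with [W x <= 3] and [e <= 1]. *)
apply: (@sqr_le_approx _ _ _ (4 * C * V + tau * rho ^+ 2 * 55 * V)).
  by rewrite addr_ge0 // !mulr_ge0 // sqr_ge0.
move=> e e0 e2.
have [f [F [G [H [fG FH]]]]] := cutoff_data x0 bA bB A0 AB c0 M1 e0.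
pose phi := cutoff e f F 1 1 ga.
have tphi : test_fun Omega phi by exact: (cutoff_test bO bA A0 Oj jge e0 e2 fG FH).
have Cphi := test_fun_Ck 1 tphi; have cphi := Ck_on_continuous Cphi.
have contI h : continuous h -> mu.-integrable Omega (EFin \o h) by exact: continuous_integrable.
have tr0 : 0 <= tau * rho ^+ 2 by rewrite mulr_ge0 ?sqr_ge0.
have CV0 : 0 <= C * V by rewrite mulr_ge0.
exists (\int[mu]_(x in Omega) phi x).
- rewrite -RintegralB //; [|exact: contI|exact: contI].
  have cd : continuous (fun x => phi x - v x).
    by apply: continuous_addT => // x; apply: (@continuousN _ _ _ v); exact: cv.
  apply: le_trans (le_normr_Rintegral mO (contI _ cd)) _.
  apply: (@le_trans _ _ (\int[mu]_(x in Omega) (4 * C * e))).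
    apply: le_Rintegral => //; [exact: integrable_norm (contI _ cd)|exact: cst_integrable|].
    by move=> x Ox; exact: (cutoff_approx bA bB A0 AB Oj c0 M1 OM e0 e2 fG FH 1 1 ga Ox).
  rewrite Rintegral_cst // -/V.
  have : 0 <= tau * rho ^+ 2 * 55 * V * e by rewrite !mulr_ge0 ?sqr_ge0 // ltW.
  lra.
- apply: le_trans (torsion_test tphi) _.
  have [[_ Lg _] _] := W12_0_test oO bO tphi.
  have iS := L2_sqr_integrable (support_fun_L2 oO r0 rK bK Lg).
  have iW : mu.-integrable Omega (EFin \o (fun x => W x ^+ 2 + 55 * e)).
    by apply: integrable_add => //; [exact: contI|exact: cst_integrable].
  have h1 : \int[mu]_(x in Omega) support_fun K (grad phi x) ^+ 2 <=
      rho ^+ 2 * (\int[mu]_(x in Omega) W x ^+ 2 + 55 * e * V).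
    have -> : \int[mu]_(x in Omega) W x ^+ 2 + 55 * e * V =
        \int[mu]_(x in Omega) (W x ^+ 2 + 55 * e).
      rewrite RintegralD //; [|exact: contI|exact: cst_integrable].
      by rewrite Rintegral_cst.
    rewrite -RintegralZl //; apply: le_Rintegral => //; first exact: integrable_scale.
    move=> x Ox; have jx1 : j x < 1 by exact/Oj.
    have j0 : 0 <= j x by exact: support_fun_ge0.
    have jk : j x <= k x by apply: support_funS => //; exists 0.
    have gk := gak x.
    have W0 : 0 <= W x by rewrite /W; nra.
    have W3 : W x <= 3 by rewrite /W; nra.
    have h0 : 0 <= support_fun K (grad phi x).
      by apply: support_fun_ge0 => //; apply: rK; exact: ballxx.
    have hW : support_fun K (grad phi x) <= rho * (W x + 5 * e).
      exact: (cutoff_energy bA bB A0 AB Oj c0 M1 OM e0 fG FH Ox K0 sK BK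
        erefl erefl ga1 ga0 gk).
    apply: (@le_trans _ _ ((rho * (W x + 5 * e)) ^+ 2)).
      by rewrite lerXn2r ?nnegrE // (le_trans h0).
    rewrite exprMn ler_wpM2l ?sqr_ge0 //.
    have : e * W x <= e * 3 by rewrite ler_wpM2l // ltW.
    by nra.
  apply: (@le_trans _ _ (tau * (rho ^+ 2 * (\int[mu]_(x in Omega) W x ^+ 2 + 55 * e * V)))).
    by rewrite ler_wpM2l.
  have : 0 <= C * V * e by rewrite mulr_ge0 // ltW.
  lra.
Qed.

Let m1 := \int[mu]_(x in Omega) j x.
Let m2 := \int[mu]_(x in Omega) k x.
Let N : R := n%:R.

Let N_gt0 : 0 < N. Proof. by rewrite ltr0n. Qed.

Let m3 := \int[mu]_(x in Omega) (j x ^+ 2).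
Let m4 := \int[mu]_(x in Omega) (j x * k x).
Let m5 := \int[mu]_(x in Omega) (k x ^+ 2).

Let moments : [/\ (N + 1) * m1 = N * V, (N + 2) * m3 = N * V &
  (N + 1) * m2 = (N + 2) * m4].
Proof. exact: moment_identities oO bO bA bB A0 AB Oj c0 jge M1 OM. Qed.

Let quad (a0 a1 a2 a3 a4 a5 : R) (h : 'rV[R]_n -> R) :
  (forall x, h x = a0 + a1 * j x + a2 * k x + a3 * j x ^+ 2
                   + a4 * (j x * k x) + a5 * k x ^+ 2) ->
  \int[mu]_(x in Omega) h x =
    a0 * V + a1 * m1 + a2 * m2 + a3 * m3 + a4 * m4 + a5 * m5.
Proof. by move=> /(integral_quadratic oO bO bA bB A0 AB)[]. Qed.

(** For [ga = 0] the trial function is [1 - j ^+ 2]: its integral is [V - m3 = 2 * V / (N + 2)] and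
    its energy at most [4 * rho ^+ 2 * m3], with [m3 = N * V / (N + 2)]. *)
Lemma torsion_lower : 0 < V -> V / (N * (N + 2)) <= tau * rho ^+ 2.
Proof.
move=> V_gt0; have [_ e3 _] := moments.
have gak x : - 0 * k x <= 2 * j x.
  by rewrite oppr0 mul0r mulr_ge0 //; exact: support_fun_ge0.
have := cutoff_inequality _ (lexx 0) gak; rewrite lerN10 => /(_ isT).
rewrite (quad (a0 := 1) (a1 := 0) (a2 := 0) (a3 := -1) (a4 := 0) (a5 := 0)); last first.
  by move=> x; ring.
rewrite (quad (a0 := 0) (a1 := 0) (a2 := 0) (a3 := 4) (a4 := 0) (a5 := 0)); last first.
  by move=> x; ring.
rewrite !mul0r !addr0 mul1r !add0r => h.
have N2 : 0 < N + 2 by have := N_gt0; lra.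
have m3E : m3 = N * V / (N + 2) by rewrite -e3 mulrC mulKf // gt_eqF.
have m30 : 0 < m3 by rewrite m3E divr_gt0 // mulr_gt0.
rewrite -(ler_pM2r (x := 4 * m3)) ?mulr_gt0 //.
rewrite -[leRHS]mulrA; apply: le_trans h.
rewrite m3E le_eqVlt; apply/orP; left; apply/eqP; field.
by rewrite !gt_eqF.
Qed.

(* The first-order condition at [e = 0] for the trial functions with [ga = - e]. *)
Lemma torsion_equality : 0 < V -> tau * rho ^+ 2 = V / (N * (N + 2)) ->
  (exists2 e1, 0 < e1 & forall x, e1 * k x <= 2 * j x) -> m2 <= m1.
Proof.
move=> V_gt0 tauE [e1 e10 e1k].
have [i1 i3 i4] := moments.
have N2 : 0 < N + 2 by have := N_gt0; lra.
have N1 : 0 < N + 1 by have := N_gt0; lra.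
pose T := V / (N * (N + 2)).
have T0 : 0 < T by rewrite divr_gt0 // mulr_gt0.
have VE : V = N * (N + 2) * T by rewrite /T mulrC divfK // gt_eqF // mulr_gt0.
have key e : 0 < e -> e <= Num.min 1 e1 ->
    (V - m3 - e * (m2 - m4)) ^+ 2 <= T * ((2 - e) ^+ 2 * m3 + e ^+ 2 * (m5 + V - 2 * m2)
      + 2 * e * (2 - e) * (m1 - m4)).
  rewrite le_min => e0 /andP[el1 ee1].
  have gak x : - (- e) * k x <= 2 * j x.
    rewrite opprK (le_trans _ (e1k x)) // ler_wpM2r //.
    by apply: support_fun_ge0 => //; exact: AB.
  have := cutoff_inequality _ _ gak; rewrite lerN2 el1 oppr_le0 (ltW e0) => /(_ isT isT).
  rewrite mulrA tauE -/T.
  rewrite (quad (a0 := 1) (a1 := 0) (a2 := - e) (a3 := -1) (a4 := e) (a5 := 0)); last first.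
    by move=> x; ring.
  rewrite (quad (a0 := e ^+ 2) (a1 := 2 * e * (2 - e)) (a2 := - 2 * e ^+ 2)
     (a3 := (2 - e) ^+ 2) (a4 := - 2 * e * (2 - e)) (a5 := e ^+ 2)); last first.
    by move=> x; ring.
  lra.
clearbody T; have T4 : 0 < 4 * T by rewrite mulr_gt0.
have m3E : m3 = N * N * T.
  by apply: (mulfI (lt0r_neq0 N2)); rewrite i3 VE; ring.
have m4E : (N + 2) * (m2 - m4) = m2 by rewrite mulrBr -i4; ring.
have m13 : (N + 2) * (m1 - m3) = m1.
  rewrite mulrBr i3 -i1; ring.
(* The terms free of [e] in [key] cancel because equality is assumed, so the coefficient of [e] is
   nonpositive; multiplied by [N + 2], its second factor becomes [m2 - m1] through the moment
   relations. *)
suff : 4 * T * (- N * (m2 - m4) - (m1 - m3 - m4)) <= 0.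
  rewrite pmulr_rle0 // => h.
  have : (N + 2) * (- N * (m2 - m4) - (m1 - m3 - m4)) <= 0 by rewrite pmulr_rle0.
  have -> : (N + 2) * (- N * (m2 - m4) - (m1 - m3 - m4)) =
    - N * ((N + 2) * (m2 - m4)) - (N + 2) * (m1 - m3) + (N + 2) * m4 by ring.
  rewrite m4E m13 -i4; lra.
apply: (@le0_of_quadratic _ _ (T * (m3 + m5 + V - 2 * m2 - 2 * (m1 - m4))
  - (m2 - m4) ^+ 2) (Num.min 1 e1)); first by rewrite lt_min ltr01.
move=> e e0 ee; have := key e e0 ee.
have -> : V - m3 = 2 * N * T by rewrite m3E VE; ring.
rewrite m3E; nra.
Qed.

(** Since [j <= k] everywhere, a strict gap at one point would persist on an open set of positive
    measure and give [m1 < m2]. *)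
Lemma gauge_eq : m2 <= m1 -> forall x, Omega x -> k x <= j x.
Proof.
move=> m21 x Ox; rewrite leNgt; apply/negP => jk.
have cj : continuous j by apply: support_shift_continuous => //; exists 0.
have ck : continuous k by apply: support_shift_continuous => //; exists 0; exact: AB.
have ckj : continuous (fun y => k y - j y).
  by apply: continuous_addT => // y; apply: (@continuousN _ _ _ j); exact: cj.
pose d := (k x - j x) / 2; have d0 : 0 < d by rewrite divr_gt0 // subr_gt0.
pose U := Omega `&` [set y | d < k y - j y].
have oU : open U.
  apply: openI => //.
  have : open ((fun y => k y - j y) @^-1` [set t | d < t]).
    apply: open_comp; first by move=> y _; exact: ckj.
    exact: open_gt.
  by [].
have Ux : U x by split => //=; rewrite /d; move: jk; lra.
have mU := rV_open_measurable oU.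
have muU := lebesgue_rV_open_gt0 oU (ex_intro _ x Ux).
have iO : mu.-integrable Omega (EFin \o (fun y => k y - j y)) by exact: continuous_integrable.
have kj0 y : Omega y -> 0 <= k y - j y.
  by move=> _; rewrite subr_ge0; apply: support_funS => //; exists 0.
have h : (d%:E * mu U <= \int[mu]_(y in Omega) (k y - j y)%:E)%E.
  rewrite -integral_cst //.
  apply: (@le_trans _ _ (\int[mu]_(y in U) (k y - j y)%:E)%E).
    apply: ge0_le_integral => //.
    - by move=> y _; rewrite lee_fin ltW.
    - apply/measurable_EFinP; apply: measurable_funTS; exact: continuous_rV_measurable.
    - by move=> y [_ /= dy]; rewrite lee_fin ltW.
  apply: ge0_subset_integral => //.
  - by case/integrableP : iO.
  - by move=> y [].
have I0 : \int[mu]_(y in Omega) (k y - j y) = m2 - m1.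
  by rewrite RintegralB //; exact: continuous_integrable.
have : (0 < (m2 - m1)%:E)%E.
  rewrite -I0 /Rintegral fineK; last exact: integrable_fin_num.
  by apply: lt_le_trans h; rewrite mule_gt0 // lte_fin.
by rewrite lte_fin subr_gt0 ltNge m21.
Qed.

End torsion_lower_bound.

(** * Gauges of inscribed homothets *)

Section translated_gauge.
Context (R : realType) (n : nat) (Omega : set 'rV[R]_n) (x0 : 'rV[R]_n).
Hypotheses (cO : convex_domain Omega) (Ox0 : Omega x0).

Definition recenter : set 'rV[R]_n := [set y | Omega (x0 + y)].

Let oO : open Omega. Proof. by case: cO. Qed.

Lemma recenter_open : open recenter.
Proof.
rewrite openE => y /= Oy; have /nbhs_ballP[e /= e0 eO] : nbhs (x0 + y) Omega.
  by apply: open_nbhs_nbhs.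
apply/nbhs_ballP; exists e => //= w /ballP_norm yw; apply/eO/ballP_norm.
by rewrite opprD addrACA subrr add0r.
Qed.

Lemma recenter_convex : convex_set recenter.
Proof.
have [_ _ _ cv] := cO; apply: convex_combI => y w l Oy Ow l0 l1; rewrite /recenter /=.
have -> : x0 + (l *: y + (1 - l) *: w) = l *: (x0 + y) + (1 - l) *: (x0 + w).
  by apply/rowP => i; rewrite !mxE; ring.
exact: convex_comb.
Qed.

Lemma recenter_bounded : bounded_set recenter.
Proof.
have [_ _ /bounded_rV_le[M M0 OM] _] := cO.
apply: (@bounded_onI _ _ _ _ id (M + `|x0|)) => y Oy.
by rewrite -(addKr x0 y) addrC (le_trans (ler_normB _ _)) // lerD2r OM.
Qed.

Lemma recenter_ball : exists2 r, 0 < r & ball 0 r `<=` recenter.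
Proof.
have /nbhs_ballP[e /= e0 eO] : nbhs x0 Omega by apply: open_nbhs_nbhs.
exists e => // w /ballP_norm; rewrite sub0r => w0; apply/eO/ballP_norm.
by rewrite opprD addrA subrr sub0r.
Qed.

Lemma recenter_closure y : closure Omega (x0 + y) -> closure recenter y.
Proof.
move=> Cy; apply: closure_rVI => e e0; have [w Ow yw] := closure_rV_approx Cy e0.
exists (w - x0); first by rewrite /recenter /= addrC subrK.
by rewrite opprB addrA [y + x0]addrC.
Qed.

Lemma recenter_polar_bounded : bounded_set (polar recenter).
Proof. by have [r r0 rO] := recenter_ball; exact: polar_bounded rO. Qed.

Lemma recenter_gauge x : Omega x <-> support_fun (polar recenter) (x - x0) < 1.
Proof.
have [r r0 rO] := recenter_ball.
have h := support_polar_lt1 (x - x0) recenter_open recenter_convex recenter_bounded r0 rO.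
have E : recenter (x - x0) = Omega x by rewrite /recenter /= addrC subrK.
by rewrite -E; split=> /h.
Qed.

Lemma recenter_gauge_ge : exists2 c, 0 < c &
  forall x, c * `|x - x0| <= support_fun (polar recenter) (x - x0).
Proof.
have [M M0 OM] := bounded_rV_le recenter_bounded.
have d0 : 0 < (n%:R * M + 1)^-1 by rewrite invr_gt0 ltr_wpDl // mulr_ge0 // ltW.
exists ((n%:R * M + 1)^-1 / 2); first by rewrite divr_gt0.
move=> x; apply: support_fun_ball_ge => //; first exact: recenter_polar_bounded.
move=> a /ballP_norm; rewrite sub0r normrN => ad y /OM yM.
apply: le_trans (ler_norm _) _; apply: le_trans (dotv_norm_le _ _) _.
have D0 : 0 < n%:R * M + 1 by rewrite -invr_gt0.
apply: (@le_trans _ _ (n%:R * (n%:R * M + 1)^-1 * M)).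
  by rewrite ler_pM // ?mulr_ge0 // ler_wpM2l // ltW.
by rewrite mulrAC ler_pdivrMr // mul1r lerDl.
Qed.

(** The last estimate, linear growth of one gauge against linear lower growth of the other, is what
    gives a range of [e] on which [2 * j - e * k] stays nonnegative. *)
Lemma recenter_bounds (B : set 'rV[R]_n) : bounded_set B -> B !=set0 ->
  (exists2 M, 1 <= M & forall x, Omega x ->
     `|x - x0| <= M /\ support_fun B (x - x0) <= M) /\
  (exists2 e, 0 < e & forall x,
     e * support_fun B (x - x0) <= 2 * support_fun (polar recenter) (x - x0)).
Proof.
move=> bB B0; have [L L0 BL] := bounded_rV_le bB.
have kL x : support_fun B (x - x0) <= n%:R * L * `|x - x0|.
  have := support_fun_lipschitz (x - x0) 0 B0 BL; rewrite support_fun0 // !subr0.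
  by apply: le_trans; exact: ler_norm.
have nL0 : 0 <= n%:R * L by rewrite mulr_ge0 // ltW.
split.
  have [M M0 OM] := bounded_rV_le recenter_bounded.
  exists (1 + M + n%:R * L * M); first by rewrite -addrA lerDl addr_ge0 ?mulr_ge0 // ltW.
  move=> x Ox; have xM : `|x - x0| <= M by apply: OM; rewrite /recenter /= addrC subrK.
  have h : n%:R * L * `|x - x0| <= n%:R * L * M by rewrite ler_wpM2l.
  have := kL x; have : 0 <= n%:R * L * M by rewrite mulr_ge0 // ltW.
  by move=> *; split; lra.
have [c c0 hc] := recenter_gauge_ge.
have D0 : 0 < n%:R * L + 1 by rewrite ltr_wpDl.
exists (2 * c / (n%:R * L + 1)); first by rewrite divr_gt0 // mulr_gt0.
move=> x; have h := hc x.
apply: (@le_trans _ _ (2 * (c * `|x - x0|))); last by rewrite ler_pM2l.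
rewrite mulrAC ler_pdivrMr // -mulrA mulrA -[leRHS]mulrA -[leLHS]mulrA.
rewrite ler_pM2l // -[leRHS]mulrA ler_pM2l //.
by apply: (le_trans (kL x)); rewrite mulrC ler_wpM2l // lerDl.
Qed.

End translated_gauge.

Lemma homothetE (R : realType) n (K : set 'rV[R]_n) x0 (t : R) x : t != 0 ->
  homothet x0 t K x <-> K (t^-1 *: (x - x0)).
Proof.
move=> t0; split; first by move=> [y Ky <-]; rewrite addrAC subrr add0r scalerA mulVf ?scale1r.
by move=> Kx; exists (t^-1 *: (x - x0)) => //; rewrite scalerA divff // scale1r addrC subrK.
Qed.

Lemma interior_convex (R : realType) n (K : set 'rV[R]_n) :
  convex_set K -> convex_set (interior K).
Proof.
move=> cK; apply: convex_combI => x y l /nbhs_ballP[d /= d0 dK] /nbhs_ballP[e /= e0 eK] l0 l1.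
apply/nbhs_ballP; exists (Num.min d e); first by rewrite /= lt_min d0.
move=> w /ballP_norm; rewrite lt_min => /andP[wd we].
pose u := w - (l *: x + (1 - l) *: y).
have -> : w = l *: (x + u) + (1 - l) *: (y + u).
  by rewrite /u; apply/rowP => i; rewrite !mxE; ring.
rewrite distrC -/u in wd; rewrite distrC -/u in we.
by apply: convex_comb => //; [apply/dK|apply/eK]; apply/ballP_norm;
  rewrite opprD addrA subrr sub0r normrN.
Qed.

(** * Torsional rigidity against the inradius: bound, rigidity, and the model domain *)

Section torsion_inradius.
Context (R : realType) (n : nat).
Let N := n.+1.
Context (K : set 'rV[R]_N).
Hypotheses (K_body : convex_body K) (K_sym : origin_symmetric K).
Let cN : R := (N%:R * (N%:R + 2))^-1.

Let N0 : 0 < N%:R :> R. Proof. by rewrite ltr0n. Qed.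

Let cN0 : 0 < cN.
Proof. by rewrite invr_gt0 mulr_gt0 // addr_gt0. Qed.

Lemma measure_domain (Omega : set 'rV[R]_N) : convex_domain Omega ->
  exists2 V, 0 < V & lebesgue_rV R N Omega = V%:E.
Proof.
move=> [oO O0 bO _]; have mO := rV_open_measurable oO.
have gt0 := lebesgue_rV_open_gt0 oO O0; have fin := lebesgue_rV_bounded mO bO.
have f : lebesgue_rV R N Omega \is a fin_num by rewrite ge0_fin_numE.
exists (fine (lebesgue_rV R N Omega)); last by rewrite fineK.
by rewrite fine_gt0 // gt0.
Qed.

Section lower.
Variable Omega : set 'rV[R]_N.
Hypothesis cO : convex_domain Omega.
Let rad := inradius K Omega.

(** The torsion is an extended real, so both halves are stated for its real bounds [tau]; the
    equality case of the theorem is the one where [tau] is the torsion itself. *)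
Lemma inradius_bound_and_rigidity : 0 < rad /\ forall tau : R, 0 <= tau ->
  (torsion Omega K <= tau%:E)%E ->
  cN * rad ^+ 2 * fine (lebesgue_rV R N Omega) <= tau /\
  (tau = cN * rad ^+ 2 * fine (lebesgue_rV R N Omega) ->
   exists x, closure Omega = homothet x rad K).
Proof.
have [r r0 rK] := convex_body_ball K_body K_sym.
have bK := convex_body_bounded K_body.
have [x0 [Ox0 rad0 radK]] := inradius_attained r0 rK bK cO.
rewrite -/rad in rad0 radK; split => // tau tau0 tauT.
have [oO O0 bO cvO] := cO.
pose A := polar (recenter Omega x0).
pose RK := homothet 0 rad K; pose B := polar RK.
have bA : bounded_set A by exact: recenter_polar_bounded.
have A0 : A 0 by exact: polar0.
have rad_neq0 : rad != 0 by rewrite gt_eqF.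
have rRK : ball 0 (rad * r) `<=` RK.
  move=> w /ballP_norm; rewrite sub0r normrN => wr; apply/homothetE => //.
  apply/rK/ballP_norm; rewrite sub0r normrN subr0 normrZ gtr0_norm ?invr_gt0 //.
  by rewrite mulrC ltr_pdivrMr // mulrC.
have radr0 : 0 < rad * r by rewrite mulr_gt0.
have bB : bounded_set B by exact: polar_bounded rRK.
(* Polarity reverses the inclusion of the inscribed homothet. That inclusion holds in the closure
   only, which has the same polar as the domain. *)
have AB : A `<=` B.
  rewrite /A -polar_closure; apply: polarS => _ [y Ky <-].
  by rewrite add0r; apply: recenter_closure; apply: radK; exists y.
have Oj := recenter_gauge cO Ox0.
have [c c0 jge] := recenter_gauge_ge cO Ox0.
have [[M M1 OM] e1k] := recenter_bounds cO Ox0 bB (polar_neq0 _).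
have BK b y : B b -> K y -> dotv b y <= rad^-1.
  move=> Bb Ky; rewrite -(ler_pM2l rad0) divff // -dotvZr; apply: Bb.
  by exists y => //; rewrite add0r.
have [V V0 VE] := measure_domain cO.
have Vf : fine (lebesgue_rV R N Omega) = V by rewrite VE.
have Vf0 : 0 < fine (lebesgue_rV R N Omega) by rewrite Vf.
have low := torsion_lower (ltn0Sn n) oO bO bA bB A0 AB Oj c0 jge M1 OM
  r0 rK bK K_sym BK tau0 tauT Vf0.
have rad2 : 0 < rad ^+ 2 by rewrite exprn_gt0.
split.
  rewrite mulrAC -ler_pdivlMr // -exprVn; move: low; rewrite -/N mulrC; exact.
move=> tauE; exists x0; apply/seteqP; split; last exact: radK.
have eq2 : tau * rad^-1 ^+ 2 = fine (lebesgue_rV R N Omega) / (N%:R * (N%:R + 2)).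
  by rewrite tauE exprVn mulrAC mulfK ?gt_eqF // mulrC.
have m21 := torsion_equality (ltn0Sn n) oO bO bA bB A0 AB Oj c0 jge M1 OM
  r0 rK bK K_sym BK tau0 tauT Vf0 eq2 e1k.
have kj := gauge_eq oO bO bA bB A0 AB m21.
have [cK cvK _] := K_body.
have cRK : compact RK.
  have : compact ((fun y : 'rV[R]_N => 0 + rad *: y) @` K); last by [].
  apply: continuous_compact => //; apply: continuous_subspaceT; apply: (@lipschitz_continuousW R _ _ _ rad) => y w.
  by rewrite !add0r -scalerBr normrZ gtr0_norm.
have cvRK : convex_set RK.
  apply: convex_combI => _ _ l [y Ky <-] [w Kw <-] l0 l1.
  exists (l *: y + (1 - l) *: w); first exact: convex_comb.
  by apply/rowP => i; rewrite !mxE; ring.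
move=> x Cx.
(* On [Omega] the gauges satisfy [k <= j < 1]; the closed condition [k <= 1] passes to the closure,
   and [bipolar] turns it into membership in the homothet. *)
have kx : support_fun B (x - x0) <= 1.
  have cl : closed [set y | support_fun B (y - x0) <= 1].
    have : closed ((fun y : 'rV[R]_N => support_fun B (y - x0)) @^-1` [set t | t <= 1]).
      2: by [].
    apply: preimage_closed.
      by move=> y _; apply: support_shift_continuous => //; exact: polar_neq0.
    exact: closed_le.
  have : closure Omega `<=` [set y | support_fun B (y - x0) <= 1].
    rewrite [X in _ `<=` X](iffLR (closure_id _) cl); apply: closureS => y Oy.
    by apply: le_trans (kj y Oy) _; apply/ltW/Oj.
  exact.
have /homothetE := bipolar cRK cvRK radr0 rRK kx.
by rewrite subr0 => /(_ rad_neq0) h; apply/homothetE.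
Qed.

End lower.

(** The gauge of the interior is that of [K], so the second moment in the energy bound is known to
    be [N * V / (N + 2)], and dividing by [N ^+ 2] gives the constant. For sharpness a lower bound
    on the inradius is enough. *)
Lemma torsion_interior_le : let Omega := interior K in convex_domain Omega /\
  1 <= inradius K Omega /\
  (torsion Omega K <= (cN * fine (lebesgue_rV R N Omega))%:E)%E.
Proof.
move=> Omega.
have [r r0 rK] := convex_body_ball K_body K_sym.
have bK := convex_body_bounded K_body.
have [cK cvK O0] := K_body.
have oO : open Omega by exact: open_interior.
have bO : bounded_set Omega.
  have [M M0 KM] := bounded_rV_le bK.
  by apply: (@bounded_onI _ _ _ _ id M) => x /interior_subset; exact: KM.
have cO : convex_domain Omega by split => //; exact: interior_convex.
have clK : K `<=` closure Omega.
  move=> x Kx; apply: closure_rVI => e e0.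
  have x1 : 0 < `|x| + 1 by rewrite ltr_wpDl.
  pose d := Num.min 1 (e / 2 / (`|x| + 1)).
  have d0 : 0 < d by rewrite lt_min ltr01 !divr_gt0.
  have d1 : d <= 1 by rewrite ge_min lexx.
  exists ((1 - d) *: x).
    have := convex_cone_interior cvK r0 rK (subset_closure Kx) (s := 1 - d).
    rewrite subr0 add0r; apply; lra.
  rewrite scalerBl scale1r opprB addrC subrK normrZ gtr0_norm //.
  have : d * (`|x| + 1) <= e / 2 by rewrite -ler_pdivlMr // ge_min lexx orbT.
  have := normr_ge0 x; nra.
have cK' := compact_rV_closed cK.
have Ox0 : Omega 0 by apply/nbhs_ballP; exists r.
split => //; split.
  apply: (inscribed_le_inradius r0 rK cO Ox0).
  by move=> _ [y Ky <-]; rewrite add0r scale1r; exact: clK.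
pose A := polar (recenter Omega 0).
have AE : A = polar K.
  have -> : A = polar Omega.
    by rewrite /A; congr polar; apply/funext => y; rewrite /recenter /= add0r.
  apply/seteqP; split; last by apply: polarS; exact: interior_subset.
  by rewrite -polar_closure; exact: polarS.
have bA : bounded_set A by exact: recenter_polar_bounded.
have A0 : A 0 by exact: polar0.
have Oj := recenter_gauge cO Ox0.
have [c c0 jge] := recenter_gauge_ge cO Ox0.
have [[M M1 OM] _] := recenter_bounds cO Ox0 bA (polar_neq0 _).
(* The domain is its own inscribed homothet, so the two gauges coincide and [A] is used twice. *)
have [_ e3 _] := moment_identities oO bO bA bA A0 (@subset_refl _ A) Oj c0 jge M1 OM.
set V := fine (lebesgue_rV R N Omega) in e3 *.
have N2 : 0 < N%:R + 2 :> R by rewrite addr_gt0.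
apply: ge_ereal_sup => _ [u [g [W _ ->]]]; rewrite lee_fin.
have := W12_0_energy_bound 0 oO bO r0 rK bK K_sym W; rewrite -AE.
set D := (X in _ <= _ * X); set m3 := (X in _ <= X * _) => eb.
rewrite [X in _ / X](_ : _ = D) //.
have D0 : 0 <= D by apply: Rintegral_ge0 => x _; exact: sqr_ge0.
have V0 : 0 <= V by rewrite fine_ge0.
(* Division by zero returns 0, so a vanishing energy respects the bound. *)
have [DE|Dn0] := eqVneq D 0.
  by rewrite DE invr0 mulr0 mulr_ge0 // ltW.
rewrite ler_pdivrMr; last by rewrite lt_neqAle eq_sym Dn0.
have m3E : m3 = N%:R * V / (N%:R + 2).
  by rewrite -e3 mulrC mulKf // gt_eqF.
rewrite -(ler_pM2l (x := N%:R ^+ 2)) ?exprn_gt0 // -exprMn.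
apply: (le_trans eb); rewrite m3E /cN le_eqVlt; apply/orP; left; apply/eqP.
by field; rewrite !gt_eqF.
Qed.

End torsion_inradius.

Unset Implicit Arguments.
Set Strict Implicit.
Set Printing Implicit Defensive.

Theorem theorem4p2 (R : realType) (n : nat) (N := n.+1) (K : set 'rV[R]_N)
    (K_body : convex_body K) (K_C2 : C2plus K) (K_sym : origin_symmetric K) :
  let cN : R := (N%:R * (N%:R + 2))^-1 in
  (forall Omega : set 'rV[R]_N, convex_domain Omega ->
     ((cN * inradius K Omega ^+ 2)%:E
        <= torsion Omega K / lebesgue_rV R N Omega)%E /\
     ((torsion Omega K / lebesgue_rV R N Omega)%E
        = (cN * inradius K Omega ^+ 2)%:E ->
      exists (x : 'rV[R]_N) (r : R),
        0 <= r /\ closure Omega = homothet x r K)) /\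
  (forall c : R, cN < c ->
     exists2 Omega : set 'rV[R]_N, convex_domain Omega &
       (torsion Omega K / lebesgue_rV R N Omega
          < (c * inradius K Omega ^+ 2)%:E)%E).
Proof.
move=> cN; have cN0 : 0 < cN by rewrite invr_gt0 mulr_gt0 // addr_gt0.
split=> [ Omega cO|c cNc].
- have [V V0 VE] := measure_domain cO.
  have [rad0 main] := inradius_bound_and_rigidity K_body K_sym cO.
  set rad := inradius K Omega in rad0 main *.
  rewrite VE /= in main; rewrite VE inver gt_eqF //.
  have B0 : 0 < cN * rad ^+ 2 * V by rewrite !mulr_gt0 // exprn_gt0.
  case T : (torsion Omega K) => [t| |].
  (* [main] wants a nonnegative bound; the maximum disappears once [h1] and [B0] show that [t] is
     positive. *)
  + have [h1 h2] := main (Num.max t 0) ltac:(by rewrite le_max lexx orbT)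
      ltac:(by rewrite T lee_fin le_max lexx).
    have tpos : 0 < t.
      by have := lt_le_trans B0 h1; rewrite lt_max ltxx orbF.
    rewrite (max_idPl (ltW tpos)) in h1 h2.
    rewrite -EFinM lee_fin; split; first by rewrite ler_pdivlMr.
    move=> [tE]; have [|x xE] := h2; first by rewrite -tE divfK // gt_eqF.
    by exists x, rad; split => //; exact: ltW.
  + rewrite mulyr gtr0_sg ?invr_gt0 // mul1e; split => //.
    exact: leey.
  (* The value [-oo] would make 0 an upper bound of the torsion, against [B0]. *)
  + have [] := main 0 (lexx 0) ltac:(by rewrite T leNye).
    by rewrite leNgt B0.
- have [cO [rad1 Tle]] := torsion_interior_le K_body K_sym.
  exists (interior K) => //.
  have [V V0 VE] := measure_domain cO; rewrite VE /= in Tle.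
  rewrite VE inver gt_eqF //.
  (* The quotient is at most [cN], while [rad1] makes the right-hand side at least [c]. *)
  apply: (@le_lt_trans _ _ cN%:E); first by rewrite lee_pdivrMr // -EFinM.
  rewrite lte_fin; apply: (lt_le_trans cNc).
  have c0 : 0 <= c by rewrite (le_trans (ltW cN0)) // ltW.
  by rewrite ler_peMr // exprn_ege1.
Qed.
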